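(* With $\psi_q$ denoting the $q$-digamma function and $i=\sqrt{-1}$, $$\psi_{e^{\pi}}\!\left(\frac{1-i}{2}\right)-\psi_{e^{\pi}}\!\left(\frac{1+i}{2}\right) = -i\pi-\frac{i\,\Gamma\!\left(\frac14\right)^2}{4\sqrt{2\pi}}.$$
   Context: The $q$-digamma function is the logarithmic derivative $\psi_q(z)=\frac{1}{\Gamma_q(z)}\frac{\partial \Gamma_q(z)}{\partial z}$ of the $q$-Gamma function $\Gamma_q$. For $q>1$ (the case needed here, $q=e^\pi$), $\Gamma_q$ is the standard $q$-Gamma function $$\Gamma_q(z)=\frac{\prod_{n\ge0}(1-q^{-n-1})}{\prod_{n\ge0}(1-q^{-n-z})}\,(q-1)^{1-z}\,q^{z(z-1)/2},$$ where $q^{w}=e^{w\ln q}$, so that $$\psi_q(z)=-\ln(q-1)+\ln q\left(z-\frac12-\sum_{n=0}^\infty\frac{q^{-n-z}}{1-q^{-n-z}}\right).$$ $\Gamma$ is Euler's Gamma function. *)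

(* Defs.v *)
(* Stdlib reals with Coquelicot, whose type C is used for the complex numbers. *)
From Stdlib Require Import Reals.
From Coquelicot Require Import Coquelicot.

Open Scope R_scope.

Definition Cexp (z : C) : C :=
  (exp (Re z) * cos (Im z), exp (Re z) * sin (Im z)).

(* b^w = e^(w ln b); meaningful for b > 0. *)
Definition Rcpow (b : R) (w : C) : C := Cexp (w * RtoC (ln b))%C.

(* f 0 * ... * f (N - 1) *)
Fixpoint Cprod (f : nat -> C) (N : nat) : C :=
  match N with
  | O => RtoC 1
  | S n => (Cprod f n * f n)%C
  end.

(* The limit of the partial products; meaningful when they converge in C. *)
Definition Cprod_inf (f : nat -> C) : C :=
  iota (fun l : C_CompleteNormedModule => filterlim (Cprod f) eventually (locally l)).

Lemma Cprod_inf_unique (f : nat -> C) (l : C) :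
  filterlim (Cprod f) eventually (locally (l : C_CompleteNormedModule)) ->
  Cprod_inf f = l.
Proof.
intros Hl.
exact (iota_filterlim_locally (V := C_CompleteNormedModule) (Cprod f) l Hl).
Qed.

(* The q-Gamma function in its form for q > 1 (for 0 < q < 1 the standard
   formula is a different one). *)
Definition qGamma (q : R) (z : C) : C :=
  (Cprod_inf (fun n => RtoC 1 - Rcpow q (- RtoC (INR n) - RtoC 1))
   / Cprod_inf (fun n => RtoC 1 - Rcpow q (- RtoC (INR n) - z))
   * Rcpow (q - 1) (RtoC 1 - z)
   * Rcpow q (z * (z - RtoC 1) / RtoC 2))%C.

(* C_derive is total; it is the complex derivative where that exists
   (is_C_derive_unique, C_derive_correct), in particular for qGamma q off its poles. *)
Definition qdigamma (q : R) (z : C) : C :=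
  (C_derive (qGamma q) z / qGamma q z)%C.

(* Euler's integral, convergent for s > 0. *)
Definition Gamma (s : R) : R :=
  RInt_gen (fun t : R => Rpower t (s - 1) * exp (- t))
    (at_right 0) (Rbar_locally p_infty).

(* Main.v *)
Require Import Defs.
From Stdlib Require Import Reals Lra Lia Psatz ZArith FunctionalExtensionality
  Ranalysis5 PSeries_reg.
From Coquelicot Require Import Coquelicot.

(** Put q = e^pi. The logarithmic derivative of the infinite product in
    Gamma_q is the series for psi_q [qdigamma_series]. At z = (1 - i) / 2 and
    z = (1 + i) / 2 the numbers q^(-n-z) are i a_n and - i a_n with
    a_n = e^(-pi (n + 1/2)), and the difference of the two n-th terms is
    2 i a_n / (1 + a_n^2) = i sech(pi (n + 1/2)). So everything reduces to
    [qdigamma_difference]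
      pi (sum over n >= 0 of sech(pi (n + 1/2))) = Gamma(1/4)^2 / (4 sqrt(2 pi)).

    The left side is pi D(pi/2) / 2 for D(z) = sum over all integers n of
    sech(z - pi n). Up to scaling, D is the Jacobi function dn of a square
    lattice, and the identity is the evaluation of a lemniscatic period. The
    proof uses neither theta functions nor contour integration.

    Differential equation [lattice_sech_ode]. The product of two distinct
    translates of sech is a difference of two tanh, and the product of one by
    the square of another is also a combination of functions of a single
    translate. Summing these partial fractions over symmetric ranges of
    integers shows that D^2 - sum sech^2 is a constant and that D sum sech^2 =
    sum sech^3 + (constant) D. Since sech'' = sech - 2 sech^3, this is
    D'' = c D - 2 D^3 with one constant c for all z.

    Two real lines [dn_cd_first_order]. D is real on the real line (there it
    is the function dn) and on the line pi/2 + i y (there it is the function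
    cd of y). With a = D(0) and b = D(pi/2), conservation of energy gives
    c = a^2 + b^2 and
      dn'^2 = (a^2 - dn^2) (dn^2 - b^2),   cd'^2 = (a^2 - cd^2) (b^2 - cd^2).
    On [0, pi/2] dn decreases from a to b, and cd decreases from b to 0.

    Periods [dn_period, cd_period]. Separating variables, and passing to
    half-angle tangents, each equation writes the same length pi/2 as
    an integral over [0, 1] of 2 / sqrt of a quartic. The two quartics differ
    by 4 s^2 (a^2 - 2 b^2), so equality of the integrals forces a^2 = 2 b^2
    [dn_0_sq]: this is where the lattice being square enters. Then
    pi/2 = (sqrt 2 / b) (integral of 1 / sqrt(1 + u^4) over [0, 1]).

    The value of that integral [Gamma_quarter_sq]. Gamma(1/4) is four times
    the integral of exp(-t^4) over the half-line. Squaring it and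
    differentiating in the upper bound, as in the classical evaluation of the
    Gaussian integral, expresses the square by the Gaussian integral and
    the integral of 1 / sqrt(1 + u^4). *)

(** * Integrals of exp(-t^p) and the value of Gamma at 1/4 *)

Lemma ex_RInt_of_derivable (f : R -> R) (a b : R) :
  (forall x, ex_derive f x) -> ex_RInt f a b.
Proof.
intros Hf; apply (@ex_RInt_continuous R_CompleteNormedModule); intros x _.
exact (ex_derive_continuous f x (Hf x)).
Qed.

Lemma RInt_mult_l (f : R -> R) (a b c : R) :
  ex_RInt f a b -> RInt (fun x => c * f x) a b = c * RInt f a b.
Proof. exact (RInt_scal (V := R_CompleteNormedModule) f a b c). Qed.

Lemma RInt_ext_R (f g : R -> R) (a b : R) :
  (forall x, Rmin a b < x < Rmax a b -> f x = g x) -> RInt f a b = RInt g a b.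
Proof. exact (RInt_ext (V := R_CompleteNormedModule) f g a b). Qed.

Lemma RInt_const_R (a b c : R) : RInt (fun _ => c) a b = (b - a) * c.
Proof. exact (RInt_const (V := R_CompleteNormedModule) a b c). Qed.

Definition int_exp_pow (p : nat) (x : R) : R := RInt (fun t => exp (- t ^ p)) 0 x.

Lemma is_derive_int_exp_pow (p : nat) (x : R) : is_derive (int_exp_pow p) x (exp (- x ^ p)).
Proof.
assert (Hc : forall t, continuous (fun t => exp (- t ^ p)) t).
{ intros t; apply (ex_derive_continuous (fun t => exp (- t ^ p))).
  auto_derive; trivial. }
apply (is_derive_RInt (fun t => exp (- t ^ p)) (int_exp_pow p) 0 x).
- exists (mkposreal 1 Rlt_0_1); intros y _.
  apply (@RInt_correct R_CompleteNormedModule), ex_RInt_continuous; intros; apply Hc.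
- apply Hc.
Qed.

Lemma int_exp_pow_scale (p : nat) (x : R) :
  int_exp_pow p x = RInt (fun u => x * exp (- (x ^ p * u ^ p))) 0 1.
Proof.
unfold int_exp_pow.
assert (L := RInt_comp_lin (V := R_CompleteNormedModule)
  (fun t => exp (- t ^ p)) x 0 0 1).
rewrite Rmult_0_r, Rmult_1_r, !Rplus_0_r in L.
rewrite <- L.
- apply RInt_ext_R; intros u _.
  rewrite Rplus_0_r, Rpow_mult_distr; reflexivity.
- apply ex_RInt_of_derivable; intros t; auto_derive; trivial.
Qed.

(** The polar-coordinates argument without a double integral: both sides have
    the derivative 2 x exp(-x^p) (integral of exp(-x^p u^p) over u in [0, 1])
    and vanish at 0. H is a primitive in x of 2 x exp(-x^p (1 + u^p)), to be chosen
    in closed form for each exponent p. *)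
Lemma int_exp_pow_square (p : nat) (H : R -> R -> R) (x : R) :
  (forall x u, is_derive (fun x => H x u) x (2 * x * exp (- (x ^ p * (1 + u ^ p))))) ->
  (forall x u, continuous (H x) u) ->
  0 < x ->
  int_exp_pow p x ^ 2 = RInt (H x) 0 1 - RInt (H 0) 0 1.
Proof.
intros HD HC Hx.
set (F := fun x => int_exp_pow p x ^ 2 - RInt (H x) 0 1).
assert (HF : F 0 = F x).
{ apply (eq_is_derive F 0 x); [intros t _ | exact Hx].
  assert (D1 : is_derive (fun x => RInt (H x) 0 1) t
            (RInt (fun u => Derive (fun x => H x u) t) 0 1)).
  { apply (is_derive_RInt_param (fun x u => H x u) 0 1 t).
    - exists (mkposreal 1 Rlt_0_1); intros y _ u _.
      eexists; apply HD.
    - intros u _.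
      apply continuity_2d_pt_ext with (f := fun x u => 2 * x * exp (- (x ^ p * (1 + u ^ p)))).
      { intros y v; symmetry; apply is_derive_unique, HD. }
      assert (Hpow : forall (n : nat) (g : R -> R -> R) x y, continuity_2d_pt g x y ->
                 continuity_2d_pt (fun x y => g x y ^ n) x y).
      { intros n g y v Hg; induction n as [|n IHn]; simpl.
        - apply continuity_2d_pt_const.
        - apply continuity_2d_pt_mult; assumption. }
      apply continuity_2d_pt_mult.
      { apply continuity_2d_pt_mult; [apply continuity_2d_pt_const | apply continuity_2d_pt_id1]. }
      apply (continuity_1d_2d_pt_comp exp).
      { apply derivable_continuous_pt, derivable_pt_exp. }
      apply continuity_2d_pt_opp, continuity_2d_pt_mult.
      { apply Hpow, continuity_2d_pt_id1. }
      apply continuity_2d_pt_plus; [apply continuity_2d_pt_const|].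
      apply Hpow, continuity_2d_pt_id2.
    - exists (mkposreal 1 Rlt_0_1); intros y _.
      apply (@ex_RInt_continuous R_CompleteNormedModule); intros; apply HC. }
  assert (D2 : is_derive (fun x => int_exp_pow p x ^ 2) t (2 * int_exp_pow p t * exp (- t ^ p))).
  { evar_last.
    - apply is_derive_pow, is_derive_int_exp_pow.
    - simpl; ring. }
  assert (D3 : RInt (fun u => Derive (fun x => H x u) t) 0 1
               = 2 * exp (- t ^ p) * int_exp_pow p t).
  { rewrite int_exp_pow_scale, <- RInt_mult_l.
    - apply RInt_ext_R; intros u _; etransitivity; [apply is_derive_unique, HD|].
      replace (- (t ^ p * (1 + u ^ p))) with (- t ^ p + - (t ^ p * u ^ p)) by ring.
      rewrite exp_plus; simpl; ring.
    - apply ex_RInt_of_derivable; intros u; auto_derive; trivial. }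
  unfold F; evar_last.
  - apply (is_derive_minus (fun x => int_exp_pow p x ^ 2) (fun x => RInt (H x) 0 1)); eassumption.
  - rewrite D3; unfold minus, plus, opp, zero; simpl; ring. }
unfold F in HF.
assert (E0 : int_exp_pow p 0 = 0) by (unfold int_exp_pow; rewrite RInt_point; reflexivity).
rewrite E0 in HF; lra.
Qed.

(** For p = 2 a primitive is - exp(-x^2 (1 + u^2)) / (1 + u^2), whose value at
    x = 0 integrates to - arctan 1. *)
Lemma int_exp_pow_gauss_sq (x : R) : 0 < x ->
  int_exp_pow 2 x ^ 2 = PI / 4 - RInt (fun u => exp (- (x ^ 2 * (1 + u ^ 2))) / (1 + u ^ 2)) 0 1.
Proof.
intros Hx.
assert (Hp : forall u : R, 1 + u ^ 2 <> 0) by (intros u; nra).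
rewrite (int_exp_pow_square 2 (fun x u => - (exp (- (x ^ 2 * (1 + u ^ 2))) / (1 + u ^ 2))) x); trivial.
- assert (I0 : is_RInt (fun u => / (1 + u ^ 2)) 0 1 (atan 1 - atan 0)).
  { apply (is_RInt_derive (V := R_CompleteNormedModule) atan).
    - intros u _; auto_derive; trivial; simpl; ring.
    - intros u _; apply (ex_derive_continuous (fun u => / (1 + u ^ 2))); auto_derive; apply (Hp u). }
  rewrite atan_1, atan_0 in I0.
  assert (E : RInt (fun u => - (exp (- (0 ^ 2 * (1 + u ^ 2))) / (1 + u ^ 2))) 0 1 = - (PI / 4)).
  { transitivity (RInt (fun u => -1 * / (1 + u ^ 2)) 0 1).
    - apply RInt_ext_R; intros u _.
      replace (- (0 ^ 2 * (1 + u ^ 2))) with 0 by ring.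
      rewrite exp_0; field; apply Hp.
    - rewrite RInt_mult_l; [|eexists; exact I0].
      rewrite (is_RInt_unique _ _ _ _ I0); lra. }
  rewrite E.
  rewrite (RInt_ext_R (fun u => - (exp (- (x ^ 2 * (1 + u ^ 2))) / (1 + u ^ 2)))
            (fun u => -1 * (exp (- (x ^ 2 * (1 + u ^ 2))) / (1 + u ^ 2)))) by (intros; lra).
  rewrite RInt_mult_l; [lra|].
  apply ex_RInt_of_derivable; intros u; auto_derive; apply Hp.
- intros y u; auto_derive; trivial; simpl pow; field; generalize (Hp u); simpl; rewrite Rmult_1_r; trivial.
- intros y u; apply (ex_derive_continuous (fun u => - (exp (- (y ^ 2 * (1 + u ^ 2))) / (1 + u ^ 2)))).
  auto_derive; apply Hp.
Qed.

Lemma int_exp_pow_0 (p : nat) : int_exp_pow p 0 = 0.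
Proof. exact (RInt_point (V := R_CompleteNormedModule) 0 _). Qed.

Lemma int_exp_pow_le (p : nat) (x y : R) : x <= y -> int_exp_pow p x <= int_exp_pow p y.
Proof.
intros Hxy.
destruct (MVT_gen (int_exp_pow p) x y (fun t => exp (- t ^ p))) as [c [_ Hc]].
- intros t _; apply is_derive_int_exp_pow.
- intros t _; apply derivable_continuous_pt.
  exists (exp (- t ^ p)); apply is_derive_Reals, is_derive_int_exp_pow.
- assert (P := exp_pos (- c ^ p)); nra.
Qed.

Lemma int_exp_pow_ge_0 (p : nat) (x : R) : 0 <= x -> 0 <= int_exp_pow p x.
Proof. intros Hx; rewrite <- (int_exp_pow_0 p); apply int_exp_pow_le, Hx. Qed.

Lemma exp_opp_sq_le (x : R) : 0 < x -> exp (- x ^ 2) <= / x.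
Proof.
intros Hx; rewrite exp_Ropp.
apply Rinv_le_contravar; trivial.
assert (H := exp_ineq1_le (x ^ 2)); nra.
Qed.

Lemma int_exp_pow_gauss_bounds (x : R) : 0 < x ->
  PI / 4 - / x <= int_exp_pow 2 x ^ 2 <= PI / 4.
Proof.
intros Hx; rewrite int_exp_pow_gauss_sq; trivial.
assert (Hp : forall u : R, 0 < 1 + u ^ 2) by (intros u; nra).
assert (Hi : ex_RInt (fun u => exp (- (x ^ 2 * (1 + u ^ 2))) / (1 + u ^ 2)) 0 1).
{ apply ex_RInt_of_derivable; intros u; auto_derive.
  generalize (Hp u); simpl; lra. }
assert (L : 0 <= RInt (fun u => exp (- (x ^ 2 * (1 + u ^ 2))) / (1 + u ^ 2)) 0 1).
{ apply RInt_ge_0; [lra | exact Hi | intros u _].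
  apply Rlt_le, Rdiv_lt_0_compat; [apply exp_pos | apply Hp]. }
assert (U : RInt (fun u => exp (- (x ^ 2 * (1 + u ^ 2))) / (1 + u ^ 2)) 0 1
            <= RInt (fun _ => / x) 0 1).
{ apply RInt_le; [lra | exact Hi | apply ex_RInt_const | intros u _].
  apply Rle_trans with (exp (- x ^ 2)); [|apply exp_opp_sq_le, Hx].
  apply Rle_div_l; [apply Hp|].
  assert (exp (- (x ^ 2 * (1 + u ^ 2))) <= exp (- x ^ 2)).
  { assert (0 <= x ^ 2 * u ^ 2) by (apply Rmult_le_pos; apply pow2_ge_0).
    destruct (Req_dec (- (x ^ 2 * (1 + u ^ 2))) (- x ^ 2)) as [-> | N]; [lra|].
    apply Rlt_le, exp_increasing; lra. }
  assert (P := exp_pos (- x ^ 2)); specialize (Hp u); nra. }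
rewrite RInt_const_R in U; lra.
Qed.

Lemma is_lim_inv_infty : is_lim Rinv p_infty 0.
Proof. apply (is_lim_inv (fun x => x) p_infty p_infty); [apply is_lim_id | discriminate]. Qed.

Lemma is_lim_sqrt_of_sq (f : R -> R) (l : R) :
  (forall x, 0 < x -> 0 <= f x) ->
  is_lim (fun x => f x ^ 2) p_infty l -> is_lim f p_infty (sqrt l).
Proof.
intros Hf Hl.
apply is_lim_ext_loc with (f := fun x => sqrt (f x ^ 2)).
{ exists 0; intros x Hx; apply sqrt_pow2, Hf, Hx. }
apply (filterlim_comp R R R _ sqrt _ (locally l)); [exact Hl|].
apply continuous_sqrt.
Qed.

Lemma is_lim_int_exp_pow_gauss : is_lim (int_exp_pow 2) p_infty (sqrt (PI / 4)).
Proof.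
apply is_lim_sqrt_of_sq.
{ intros x Hx; apply int_exp_pow_ge_0; lra. }
apply (is_lim_le_le_loc (fun x => PI / 4 - / x) (fun _ => PI / 4)).
- exists 0; intros x Hx; apply int_exp_pow_gauss_bounds, Hx.
- replace (PI / 4) with (PI / 4 - 0) at 1 by ring.
  apply is_lim_minus'; [apply is_lim_const | apply is_lim_inv_infty].
- apply is_lim_const.
Qed.

(** Equal to half of the lemniscate constant divided by sqrt 2. *)
Definition lemniscate_int : R := RInt (fun u => / sqrt (1 + u ^ 4)) 0 1.

Lemma one_plus_pow4_pos (u : R) : 0 < 1 + u ^ 4.
Proof. replace (u ^ 4) with ((u ^ 2) ^ 2) by ring; assert (H := pow2_ge_0 (u ^ 2)); lra. Qed.

Lemma ex_RInt_lemniscate : ex_RInt (fun u => / sqrt (1 + u ^ 4)) 0 1.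
Proof.
apply ex_RInt_of_derivable; intros u; assert (H := one_plus_pow4_pos u).
auto_derive; repeat split; trivial.
apply Rgt_not_eq, sqrt_lt_R0, H.
Qed.

(** For p = 4 the primitive is itself a Gaussian integral, taken up to
    x^2 sqrt(1 + u^4); this is how sqrt PI enters the value of Gamma at 1/4. *)
Lemma int_exp_pow_quartic_sq (x : R) : 0 < x ->
  int_exp_pow 4 x ^ 2 = RInt (fun u => int_exp_pow 2 (x ^ 2 * sqrt (1 + u ^ 4)) / sqrt (1 + u ^ 4)) 0 1.
Proof.
intros Hx.
assert (Hs : forall u, 0 < sqrt (1 + u ^ 4)).
{ intros u; apply sqrt_lt_R0, one_plus_pow4_pos. }
rewrite (int_exp_pow_square 4 (fun x u => int_exp_pow 2 (x ^ 2 * sqrt (1 + u ^ 4)) / sqrt (1 + u ^ 4)) x); trivial.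
- rewrite (RInt_ext_R (fun u => int_exp_pow 2 (0 ^ 2 * sqrt (1 + u ^ 4)) / sqrt (1 + u ^ 4))
            (fun _ => 0)).
  + rewrite RInt_const_R; ring.
  + intros u _; rewrite pow_i, Rmult_0_l, int_exp_pow_0 by lia; unfold Rdiv; ring.
- intros y u.
  evar_last.
  + apply (is_derive_ext (fun x => / sqrt (1 + u ^ 4) * int_exp_pow 2 (x ^ 2 * sqrt (1 + u ^ 4)))).
    { intros t; unfold Rdiv; apply Rmult_comm. }
    apply is_derive_scal.
    apply (is_derive_comp (int_exp_pow 2) (fun x => x ^ 2 * sqrt (1 + u ^ 4))).
    * apply is_derive_int_exp_pow.
    * auto_derive; trivial; reflexivity.
  + unfold scal; simpl; unfold mult; simpl.
    replace (y * (y * 1) * sqrt (1 + u * (u * (u * (u * 1)))) *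
      (y * (y * 1) * sqrt (1 + u * (u * (u * (u * 1)))) * 1))
      with (y * (y * (y * (y * 1))) * (1 + u * (u * (u * (u * 1))))).
    * field; apply Rgt_not_eq, (Hs u).
    * rewrite <- (sqrt_sqrt (1 + u * (u * (u * (u * 1))))) at 1; [ring|].
      left; apply (one_plus_pow4_pos u).
- intros y u.
  apply (ex_derive_continuous (fun u => int_exp_pow 2 (y ^ 2 * sqrt (1 + u ^ 4)) / sqrt (1 + u ^ 4))).
  auto_derive; repeat split; try apply one_plus_pow4_pos; try apply Rgt_not_eq, Hs.
  eexists; apply is_derive_int_exp_pow.
Qed.

(** In the formula for the square, the upper bound x^2 sqrt(1 + u^4) lies
    between x^2 and infinity for every u, so the limit passes under the integral
    by squeezing. *)
Lemma is_lim_int_exp_pow_quartic : is_lim (int_exp_pow 4) p_infty (sqrt (sqrt (PI / 4) * lemniscate_int)).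
Proof.
assert (Hs : forall u, 1 <= sqrt (1 + u ^ 4)).
{ intros u; rewrite <- sqrt_1 at 1; apply sqrt_le_1_alt.
  replace (u ^ 4) with ((u ^ 2) ^ 2) by ring; assert (H := pow2_ge_0 (u ^ 2)); lra. }
assert (Hi : forall x, ex_RInt
  (fun u => int_exp_pow 2 (x ^ 2 * sqrt (1 + u ^ 4)) / sqrt (1 + u ^ 4)) 0 1).
{ intros x; apply ex_RInt_of_derivable; intros u; specialize (Hs u).
  assert (H := one_plus_pow4_pos u).
  auto_derive; repeat split; trivial; try (simpl in *; lra).
  eexists; apply is_derive_int_exp_pow. }
apply is_lim_sqrt_of_sq.
{ intros x Hx; apply int_exp_pow_ge_0; lra. }
apply (is_lim_le_le_loc (fun x => int_exp_pow 2 (x ^ 2) * lemniscate_int)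
        (fun _ => sqrt (PI / 4) * lemniscate_int)).
- exists 0; intros x Hx.
  rewrite int_exp_pow_quartic_sq by exact Hx.
  unfold lemniscate_int; rewrite <- !RInt_mult_l by apply ex_RInt_lemniscate.
  assert (Hc : forall c, ex_RInt (fun u => c * / sqrt (1 + u ^ 4)) 0 1).
  { intros c; apply (ex_RInt_scal (V := R_NormedModule)), ex_RInt_lemniscate. }
  assert (P2 : 0 < x ^ 2) by (apply pow_lt, Hx).
  split.
  + apply RInt_le; [lra | apply (Hc (int_exp_pow 2 (x ^ 2))) | apply Hi | intros u _].
    specialize (Hs u); apply Rmult_le_compat_r; [apply Rlt_le, Rinv_0_lt_compat; lra|].
    apply int_exp_pow_le; nra.
  + apply RInt_le; [lra | apply Hi | apply (Hc (sqrt (PI / 4))) | intros u _].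
    specialize (Hs u); apply Rmult_le_compat_r; [apply Rlt_le, Rinv_0_lt_compat; lra|].
    assert (P : 0 < x ^ 2 * sqrt (1 + u ^ 4)) by (apply Rmult_lt_0_compat; lra).
    rewrite <- (sqrt_pow2 (int_exp_pow 2 _)) by (apply int_exp_pow_ge_0; lra).
    apply sqrt_le_1_alt, int_exp_pow_gauss_bounds, P.
- apply (is_lim_scal_r (fun x => int_exp_pow 2 (x ^ 2)) lemniscate_int p_infty (sqrt (PI / 4))).
  apply (is_lim_comp (int_exp_pow 2) (fun x => x ^ 2) p_infty (sqrt (PI / 4)) p_infty).
  + apply is_lim_int_exp_pow_gauss.
  + apply (is_lim_le_p_loc (fun x => x)); [|apply is_lim_id].
    exists 1; intros x Hx; nra.
  + exists 0; intros; discriminate.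
- apply is_lim_const.
Qed.

(** Substitution t = x^4 in Euler's integral, carried out through the
    primitive 4 (integral of exp(-s^4) from 0 to t^(1/4)). *)
Lemma Gamma_quarter : Gamma (1 / 4) = 4 * sqrt (sqrt (PI / 4) * lemniscate_int).
Proof.
set (L := sqrt (sqrt (PI / 4) * lemniscate_int)).
unfold Gamma; apply (is_RInt_gen_unique (V := R_CompleteNormedModule)).
set (F := fun t => 4 * int_exp_pow 4 (Rpower t (1 / 4))).
assert (P4 : forall t, Rpower t (1 / 4) ^ 4 = Rpower t 1).
{ intros t; rewrite <- Rpower_pow by (apply exp_pos).
  rewrite Rpower_mult; f_equal; simpl; field. }
assert (F0 : filterlim F (at_right 0) (locally 0)).
{ apply filterlim_locally; intros [e He].
  exists (mkposreal ((e / 4) ^ 4) (pow_lt _ 4 (ltac:(lra) : 0 < e / 4))); intros t Ht Ht0.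
  change (Rabs (t - 0) < (e / 4) ^ 4) in Ht.
  change (Rabs (F t - 0) < e).
  rewrite Rminus_0_r in *.
  rewrite Rabs_pos_eq in Ht by lra.
  assert (Pt : 0 < Rpower t (1 / 4)) by apply exp_pos.
  assert (E4 : Rpower t (1 / 4) < e / 4).
  { apply Rnot_le_lt; intros C.
    assert (Q := pow_incr (e / 4) (Rpower t (1 / 4)) 4 (ltac:(lra))).
    rewrite P4, Rpower_1 in Q by exact Ht0; simpl in Q; lra. }
  assert (Ub : int_exp_pow 4 (Rpower t (1 / 4)) <= Rpower t (1 / 4)).
  { unfold int_exp_pow.
    apply Rle_trans with (RInt (fun _ => 1) 0 (Rpower t (1 / 4)));
      [|rewrite RInt_const_R; lra].
    apply RInt_le; [lra | apply ex_RInt_of_derivable; intros; auto_derive; trivial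
                   | apply ex_RInt_const | intros u _].
    rewrite <- exp_0; replace (u ^ 4) with ((u ^ 2) ^ 2) by ring.
    destruct (Req_dec ((u ^ 2) ^ 2) 0) as [-> | N]; [rewrite Ropp_0; lra|].
    apply Rlt_le, exp_increasing; assert (H := pow2_ge_0 (u ^ 2)); lra. }
  assert (Lb := int_exp_pow_ge_0 4 _ (Rlt_le _ _ Pt)).
  unfold F; rewrite Rabs_pos_eq; lra. }
assert (F1 : filterlim F (Rbar_locally p_infty) (locally (4 * L))).
{ apply (is_lim_scal_l (fun t => int_exp_pow 4 (Rpower t (1 / 4))) 4 p_infty L).
  apply (is_lim_comp (int_exp_pow 4) (fun t => Rpower t (1 / 4)) p_infty L p_infty).
  - apply is_lim_int_exp_pow_quartic.
  - apply (is_lim_comp exp (fun t => 1 / 4 * ln t) p_infty p_infty p_infty).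
    + apply is_lim_exp_p.
    + apply is_lim_ext with (f := fun t => 1 / 4 * ln t); [reflexivity|].
      evar_last.
      * apply is_lim_scal_l, is_lim_ln_p.
      * simpl; destruct (Rle_dec 0 (1 / 4)) as [H|H]; [|lra].
        destruct (Rle_lt_or_eq_dec 0 (1 / 4) H); [reflexivity | lra].
    + exists 0; intros; discriminate.
  - exists 0; intros; discriminate. }
assert (FD : forall t, 0 < t -> is_derive F t (Rpower t (1 / 4 - 1) * exp (- t))).
{ intros t Ht; unfold F.
  evar_last.
  - apply is_derive_scal.
    apply (is_derive_comp (int_exp_pow 4) (fun t => Rpower t (1 / 4))).
    + apply is_derive_int_exp_pow.
    + apply is_derive_Reals, derivable_pt_lim_power, Ht.
  - change (4 * (1 / 4 * Rpower t (1 / 4 - 1) * exp (- Rpower t (1 / 4) ^ 4))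
            = Rpower t (1 / 4 - 1) * exp (- t)).
    rewrite P4, Rpower_1 by exact Ht; field. }
intros P HP.
(* The integral from u to v is F v - F u; pass to the limit in u and v. *)
assert (FF : filterlim (fun ab => F (snd ab) - F (fst ab))
  (filter_prod (at_right 0) (Rbar_locally p_infty)) (locally (4 * L))).
{ replace (4 * L) with (plus (4 * L) (opp 0)) by (unfold plus, opp; simpl; ring).
  apply (filterlim_comp_2 (G := locally (4 * L)) (H := locally (opp 0))
           (fun ab : R * R => F (snd ab)) (fun ab : R * R => opp (F (fst ab))) plus).
  - exact (filterlim_comp _ _ _ snd F _ _ _ filterlim_snd F1).
  - apply (filterlim_comp _ _ _ (fun ab => F (fst ab)) opp _ (locally 0)).
    + exact (filterlim_comp _ _ _ fst F _ _ _ filterlim_fst F0).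
    + apply (filterlim_opp (V := R_NormedModule)).
  - apply (filterlim_plus (V := R_NormedModule)). }
specialize (FF P HP).
unfold filtermapi; unfold filtermap in FF.
assert (Pos : filter_prod (at_right 0) (Rbar_locally p_infty)
                (fun ab : R * R => 0 < fst ab /\ 0 < snd ab)).
{ exists (fun a => 0 < a) (fun b => 0 < b).
  - exists (mkposreal 1 Rlt_0_1); intros y _ Hy; exact Hy.
  - exists 0; trivial.
  - intros a b Ha Hb; split; assumption. }
generalize (filter_and _ _ FF Pos); apply filter_imp; intros [a b] [HF [Ha Hb]].
simpl in *; exists (F b - F a); split; [|exact HF].
assert (Hm : 0 < Rmin a b) by (apply Rmin_glb_lt; assumption).
apply (is_RInt_derive (V := R_CompleteNormedModule) F).
- intros t Ht; apply FD; lra.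
- intros t Ht.
  apply (ex_derive_continuous (fun t => Rpower t (1 / 4 - 1) * exp (- t))).
  unfold Rpower; auto_derive; lra.
Qed.

Lemma Gamma_quarter_sq : Gamma (1 / 4) ^ 2 = 8 * sqrt PI * lemniscate_int.
Proof.
assert (Hi : 0 <= lemniscate_int).
{ apply RInt_ge_0; [lra | apply ex_RInt_lemniscate | intros u _].
  apply Rlt_le, Rinv_0_lt_compat, sqrt_lt_R0, one_plus_pow4_pos. }
assert (Hs : sqrt (PI / 4) = sqrt PI / 2).
{ rewrite sqrt_div by (generalize PI_RGT_0; lra).
  replace 4 with (2 ^ 2) by ring; rewrite sqrt_pow2; lra. }
assert (Hp := sqrt_pos PI).
rewrite Gamma_quarter, Rpow_mult_distr, pow2_sqrt, Hs; [field|].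
rewrite Hs; apply Rmult_le_pos; lra.
Qed.

(** * Finite sums and limits of complex sequences *)

Fixpoint Csum (f : nat -> C) (N : nat) : C :=
  match N with
  | O => RtoC 0
  | S n => (Csum f n + f n)%C
  end.

Fixpoint Rsum (f : nat -> R) (N : nat) : R :=
  match N with
  | O => 0
  | S n => Rsum f n + f n
  end.

(** Convergence through moduli, which makes estimates direct; Clim_filterlim
    relates it to filters. *)
Definition Clim (u : nat -> C) (l : C) : Prop :=
  is_lim_seq (fun n => Cmod (u n - l)) 0.

Lemma Csum_ext (f g : nat -> C) (N : nat) :
  (forall n, (n < N)%nat -> f n = g n) -> Csum f N = Csum g N.
Proof.
induction N as [|N IHN]; intros H; simpl; trivial.
rewrite IHN, H; auto.
Qed.

Lemma Csum_plus (f g : nat -> C) (N : nat) :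
  Csum (fun n => (f n + g n)%C) N = (Csum f N + Csum g N)%C.
Proof. induction N as [|N IHN]; simpl; [|rewrite IHN]; ring. Qed.

Lemma Csum_scal (c : C) (f : nat -> C) (N : nat) :
  Csum (fun n => (c * f n)%C) N = (c * Csum f N)%C.
Proof. induction N as [|N IHN]; simpl; [|rewrite IHN]; ring. Qed.

Lemma Rsum_le (f g : nat -> R) (N : nat) :
  (forall n, f n <= g n) -> Rsum f N <= Rsum g N.
Proof. intros H; induction N as [|N IHN]; simpl; [lra|]. specialize (H N); lra. Qed.

Lemma Cmod_Csum_le (f : nat -> C) (g : nat -> R) (N : nat) :
  (forall n, Cmod (f n) <= g n) -> Cmod (Csum f N) <= Rsum g N.
Proof.
intros H; induction N as [|N IHN]; simpl.
- rewrite Cmod_0; lra.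
- eapply Rle_trans; [apply Cmod_triangle|]; specialize (H N); lra.
Qed.

Lemma Rsum_geom (M r : R) (N : nat) : r <> 1 ->
  Rsum (fun n => M * r ^ n) N = M * (1 - r ^ N) / (1 - r).
Proof.
intros Hr; induction N as [|N IHN]; simpl; [|rewrite IHN]; field; lra.
Qed.

Lemma Rsum_geom_le (M r : R) (N : nat) : 0 <= M -> 0 <= r < 1 ->
  Rsum (fun n => M * r ^ n) N <= M / (1 - r).
Proof.
intros HM Hr; rewrite Rsum_geom by lra.
apply Rmult_le_compat_r; [apply Rlt_le, Rinv_0_lt_compat; lra|].
assert (0 <= r ^ N) by (apply pow_le; lra); nra.
Qed.

Lemma Clim_filterlim (u : nat -> C) (l : C) :
  Clim u l <->
  filterlim u eventually (locally (l : C_CompleteNormedModule)).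
Proof.
assert (E : forall x y : C_NormedModule, norm (minus y x) = Cmod (y - x)).
{ reflexivity. }
split; intros H.
- apply (filterlim_locally_ball_norm (U := C_NormedModule)); intros eps.
  apply is_lim_seq_spec in H; destruct (H eps) as [N HN]; exists N; intros n Hn.
  specialize (HN n Hn); rewrite Rminus_0_r, Rabs_pos_eq in HN by apply Cmod_ge_0.
  unfold ball_norm; rewrite E; exact HN.
- apply is_lim_seq_spec; intros eps.
  destruct (proj1 (filterlim_locally_ball_norm (U := C_NormedModule) u l) H eps) as [N HN].
  exists N; intros n Hn.
  specialize (HN n Hn); unfold ball_norm in HN; rewrite E in HN.
  rewrite Rminus_0_r, Rabs_pos_eq by apply Cmod_ge_0; exact HN.
Qed.

Lemma Clim_squeeze (u : nat -> C) (l : C) (e : nat -> R) :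
  (forall n, Cmod (u n - l) <= e n) -> is_lim_seq e 0 -> Clim u l.
Proof.
intros H He.
apply is_lim_seq_le_le with (u := fun _ => 0) (w := e); trivial.
- intros n; split; [apply Cmod_ge_0 | apply H].
- apply is_lim_seq_const.
Qed.

Lemma Clim_ext (u v : nat -> C) (l : C) :
  (forall n, u n = v n) -> Clim u l -> Clim v l.
Proof. intros E; apply is_lim_seq_ext; intros n; rewrite E; reflexivity. Qed.

Lemma Clim_const (l : C) : Clim (fun _ => l) l.
Proof.
apply is_lim_seq_ext with (u := fun _ => 0); [|apply is_lim_seq_const].
intros n; replace (l - l)%C with (RtoC 0) by ring; rewrite Cmod_0; reflexivity.
Qed.

Lemma Clim_plus (u v : nat -> C) (l m : C) :
  Clim u l -> Clim v m -> Clim (fun n => (u n + v n)%C) (l + m)%C.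
Proof.
intros Hu Hv.
apply Clim_squeeze with (e := fun n => Cmod (u n - l) + Cmod (v n - m)).
- intros n; replace (u n + v n - (l + m))%C with ((u n - l) + (v n - m))%C by ring.
  apply Cmod_triangle.
- replace (Finite 0) with (Finite (0 + 0)) by (f_equal; ring).
  apply is_lim_seq_plus'; assumption.
Qed.

Lemma Clim_mult (u v : nat -> C) (l m : C) :
  Clim u l -> Clim v m -> Clim (fun n => (u n * v n)%C) (l * m)%C.
Proof.
intros Hu Hv.
apply Clim_squeeze with (e := fun n =>
  Cmod (u n - l) * Cmod (v n - m) + (Cmod (u n - l) * Cmod m + Cmod l * Cmod (v n - m))).
- intros n; rewrite <- !Cmod_mult.
  replace (u n * v n - l * m)%C
    with ((u n - l) * (v n - m) + ((u n - l) * m + l * (v n - m)))%C by ring.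
  eapply Rle_trans; [apply Cmod_triangle|].
  apply Rplus_le_compat_l, Cmod_triangle.
- replace (Finite 0) with (Finite (0 * 0 + (0 * Cmod m + Cmod l * 0))) by (f_equal; ring).
  apply is_lim_seq_plus'; [apply is_lim_seq_mult'; assumption|].
  apply is_lim_seq_plus'; apply is_lim_seq_mult'; trivial; apply is_lim_seq_const.
Qed.

Lemma Clim_scal (c : C) (u : nat -> C) (l : C) :
  Clim u l -> Clim (fun n => (c * u n)%C) (c * l)%C.
Proof. intros Hu; apply Clim_mult; [apply Clim_const | exact Hu]. Qed.

Lemma Clim_minus (u v : nat -> C) (l m : C) :
  Clim u l -> Clim v m -> Clim (fun n => (u n - v n)%C) (l - m)%C.
Proof.
intros Hu Hv; replace (l - m)%C with (l + (-(1)) * m)%C by ring.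
apply Clim_ext with (u := fun n => (u n + (-(1)) * v n)%C); [intros; ring|].
apply Clim_plus; [exact Hu | apply Clim_scal, Hv].
Qed.

Lemma Clim_Cmod_le (u : nat -> C) (l : C) (b : R) :
  Clim u l -> (forall n, Cmod (u n) <= b) -> Cmod l <= b.
Proof.
intros Hu Hb.
assert (H : Rbar_le (Cmod l - b) 0); [|simpl in H; lra].
apply (is_lim_seq_le (fun _ => Cmod l - b) (fun n => Cmod (u n - l)));
  [| apply is_lim_seq_const | exact Hu].
intros n; specialize (Hb n).
replace l with (u n + - (u n - l))%C at 1 by ring.
assert (T := Cmod_triangle (u n) (- (u n - l))); rewrite Cmod_opp in T; lra.
Qed.

Lemma Clim_unique (u : nat -> C) (l m : C) : Clim u l -> Clim u m -> l = m.
Proof.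
intros Hl Hm; apply Ceq_minus.
apply Cmod_eq_0, Rle_antisym; [|apply Cmod_ge_0].
apply (Clim_Cmod_le (fun n => u n - u n)%C); [apply Clim_minus; assumption|].
intros n; replace (u n - u n)%C with (RtoC 0) by ring; rewrite Cmod_0; lra.
Qed.

Lemma Clim_Cmod_ge (u : nat -> C) (l : C) (b : R) :
  Clim u l -> (forall n, b <= Cmod (u n)) -> b <= Cmod l.
Proof.
intros Hu Hb.
assert (H : Rbar_le (b - Cmod l) 0); [|simpl in H; lra].
apply (is_lim_seq_le (fun _ => b - Cmod l) (fun n => Cmod (u n - l)));
  [| apply is_lim_seq_const | exact Hu].
intros n; specialize (Hb n).
replace (u n) with (l + (u n - l))%C in Hb by ring.
assert (T := Cmod_triangle l (u n - l)); lra.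
Qed.

Lemma Rabs_Im_le_Cmod (c : C) : Rabs (Im c) <= Cmod c.
Proof. eapply Rle_trans; [apply Rmax_r | apply Rmax_Cmod]. Qed.

Lemma is_lim_seq_squeeze_Rabs (u e : nat -> R) (l : R) :
  (forall n, Rabs (u n - l) <= e n) -> is_lim_seq e 0 -> is_lim_seq u l.
Proof.
intros H He.
apply is_lim_seq_le_le with (u := fun n => l - e n) (w := fun n => l + e n).
- intros n; specialize (H n); apply Rabs_le_between in H; lra.
- replace (Finite l) with (Finite (l - 0)) by (f_equal; ring).
  apply is_lim_seq_minus'; [apply is_lim_seq_const | exact He].
- replace (Finite l) with (Finite (l + 0)) by (f_equal; ring).
  apply is_lim_seq_plus'; [apply is_lim_seq_const | exact He].
Qed.

Lemma Clim_Re (u : nat -> C) (l : C) : Clim u l -> is_lim_seq (fun n => Re (u n)) (Re l).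
Proof.
intros H; apply is_lim_seq_squeeze_Rabs with (e := fun n => Cmod (u n - l)); trivial.
intros n; exact (re_le_Cmod (u n - l)).
Qed.

Lemma Clim_geometric_steps (u : nat -> C) (M r : R) :
  0 <= r < 1 -> (forall n, Cmod (u (S n) - u n) <= M * r ^ n) -> exists l, Clim u l.
Proof.
intros Hr H.
destruct (ex_series_le (V := C_CompleteNormedModule)
            (fun n => u (S n) - u n)%C (fun n => M * r ^ n)) as [l Hl].
- intros n; change (norm (u (S n) - u n)%C) with (Cmod (u (S n) - u n)%C); apply H.
- apply (ex_series_scal (V := R_NormedModule) M), ex_series_geom.
  rewrite Rabs_pos_eq; lra.
- exists (l + u 0%nat)%C.
  assert (E : forall n, sum_n (G := C_AbelianMonoid) (fun n => u (S n) - u n)%C n = (u (S n) - u 0%nat)%C).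
  { induction n as [|n IHn]; [rewrite sum_O; reflexivity|].
    rewrite sum_Sn, IHn; unfold plus; simpl; ring. }
  assert (L : Clim (fun n => u (S n) - u 0%nat)%C l).
  { apply Clim_filterlim.
    apply filterlim_ext with (f := sum_n (G := C_AbelianMonoid) (fun n => u (S n) - u n)%C);
      [exact E | exact Hl]. }
  apply is_lim_seq_incr_1.
  apply is_lim_seq_ext with (u := fun n => Cmod (u (S n) - u 0%nat - l)%C); [|exact L].
  intros n; f_equal; ring.
Qed.

Lemma Csum_geometric_Clim (f : nat -> C) (M r : R) :
  0 <= r < 1 -> (forall n, Cmod (f n) <= M * r ^ n) -> exists l, Clim (Csum f) l.
Proof.
intros Hr H; apply (Clim_geometric_steps _ M r Hr); intros n; simpl.
replace (Csum f n + f n - Csum f n)%C with (f n) by ring; apply H.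
Qed.

(** * Infinite products and their logarithmic derivative *)

Lemma Cprod_ext (f g : nat -> C) (N : nat) :
  (forall n, f n = g n) -> Cprod f N = Cprod g N.
Proof. intros H; induction N as [|N IHN]; simpl; [|rewrite IHN, H]; reflexivity. Qed.

Lemma Cprod_mult (f g : nat -> C) (N : nat) :
  Cprod (fun n => (f n * g n)%C) N = (Cprod f N * Cprod g N)%C.
Proof. induction N as [|N IHN]; simpl; [|rewrite IHN]; ring. Qed.

(** The exponential bounds come from comparing the product with that of the
    1 + a_n, which is at most exp of the sum of the a_n. *)
Lemma Cmod_Cprod_expansion (e : nat -> C) (a : nat -> R) (N : nat) :
  (forall n, Cmod (e n) <= a n) ->
  Cmod (Cprod (fun n => 1 + e n)%C N - 1) <= exp (Rsum a N) - 1 /\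
  Cmod (Cprod (fun n => 1 + e n)%C N - 1 - Csum e N) <= exp (Rsum a N) - 1 - Rsum a N.
Proof.
intros He; induction N as [|N [IH1 IH2]]; simpl.
- rewrite exp_0.
  replace (1 - 1 - 0)%C with (RtoC 0) by ring.
  replace (1 - 1)%C with (RtoC 0) by ring.
  rewrite Cmod_0; lra.
- set (P := Cprod _ N) in *; set (S := Csum e N) in *; set (T := Rsum a N) in *.
  assert (Ha := He N); assert (H0 := Cmod_ge_0 (e N)).
  assert (E : exp T * (1 + a N) <= exp (T + a N)).
  { rewrite exp_plus; apply Rmult_le_compat_l; [apply Rlt_le, exp_pos | apply exp_ineq1_le]. }
  assert (PT := exp_pos T); assert (Q := Cmod_ge_0 (P - 1)).
  assert (B : Cmod ((P - 1) * e N) <= (exp T - 1) * a N).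
  { rewrite Cmod_mult; apply Rmult_le_compat; assumption. }
  split.
  + replace (P * (1 + e N) - 1)%C with ((P - 1) + ((P - 1) * e N + e N))%C by ring.
    eapply Rle_trans; [apply Cmod_triangle|].
    assert (T2 := Cmod_triangle ((P - 1) * e N) (e N)); lra.
  + replace (P * (1 + e N) - 1 - (S + e N))%C with ((P - 1 - S) + (P - 1) * e N)%C by ring.
    eapply Rle_trans; [apply Cmod_triangle|]; lra.
Qed.

Lemma exp_le_inv (x : R) : x < 1 -> exp x <= / (1 - x).
Proof.
intros Hx; rewrite <- (Ropp_involutive x) at 1; rewrite exp_Ropp.
apply Rinv_le_contravar; [lra|].
assert (H := exp_ineq1_le (- x)); lra.
Qed.

Lemma exp_quadratic (x : R) : Rabs x <= 1 / 2 -> 0 <= exp x - 1 - x <= 2 * x ^ 2.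
Proof.
intros Hx; apply Rabs_le_between in Hx; split.
- assert (H := exp_ineq1_le x); lra.
- assert (H := exp_le_inv x); specialize (H ltac:(lra)).
  assert (/ (1 - x) <= 1 + x + 2 * x ^ 2); [|lra].
  apply Rmult_le_reg_l with (1 - x); [lra|].
  rewrite Rinv_r by lra; nra.
Qed.

(** Weierstrass: a product of factors of modulus at least 1 - a_n is at least
    1 - (sum of the a_n) when that sum is at most 1. It keeps the infinite
    products away from 0. *)
Lemma Cprod_one_minus_lower (x : nat -> C) (M r : R) (N : nat) :
  0 <= M -> 0 <= r < 1 -> M / (1 - r) <= 1 ->
  (forall n, Cmod (x n) <= M * r ^ n) ->
  1 - M / (1 - r) <= Cmod (Cprod (fun n => 1 - x n)%C N).
Proof.
intros HM Hr Hs Hx.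
apply Rle_trans with (1 - Rsum (fun n => M * r ^ n) N).
{ assert (H := Rsum_geom_le M r N HM Hr); lra. }
assert (HM1 : M <= 1).
{ apply Rle_trans with (M / (1 - r)); trivial.
  apply Rle_div_r; nra. }
induction N as [|N IHN]; simpl.
- rewrite Cmod_1; lra.
- rewrite Cmod_mult.
  assert (T := Cmod_triangle (1 - x N) (x N)).
  replace (1 - x N + x N)%C with (RtoC 1) in T by ring; rewrite Cmod_1 in T.
  specialize (Hx N).
  assert (S0 : 0 <= Rsum (fun n => M * r ^ n) N <= 1).
  { split; [|assert (H := Rsum_geom_le M r N HM Hr); lra].
    rewrite Rsum_geom by lra.
    apply Rmult_le_pos; [|apply Rlt_le, Rinv_0_lt_compat; lra].
    apply Rmult_le_pos; [exact HM|].
    assert (r ^ N <= 1 ^ N) by (apply pow_incr; lra); rewrite pow1 in *; lra. }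
  assert (A0 : 0 <= M * r ^ N <= 1).
  { assert (P : 0 <= r ^ N) by (apply pow_le; lra).
    assert (r ^ N <= 1 ^ N) by (apply pow_incr; lra); rewrite pow1 in *; nra. }
  set (S := Rsum _ N) in *; set (a := M * r ^ N) in *; set (P := Cmod (Cprod _ N)) in *.
  assert (Q : 0 <= Cmod (1 - x N)) by apply Cmod_ge_0.
  apply Rle_trans with ((1 - S) * (1 - a)); [nra|].
  apply Rmult_le_compat; lra.
Qed.

Lemma Cmod_Cprod_upper (x : nat -> C) (M r : R) (N : nat) :
  0 <= M -> 0 <= r < 1 -> (forall n, Cmod (x n) <= M * r ^ n) ->
  Cmod (Cprod (fun n => 1 - x n)%C N) <= exp (M / (1 - r)).
Proof.
intros HM Hr Hx.
destruct (Cmod_Cprod_expansion (fun n => - x n)%C (fun n => M * r ^ n) N) as [H _].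
{ intros n; rewrite Cmod_opp; apply Hx. }
change (Cprod (fun n => 1 - x n)%C N) with (Cprod (fun n => 1 + - x n)%C N).
set (P := Cprod _ N) in *.
assert (T := Cmod_triangle (P - 1) 1); replace (P - 1 + 1)%C with P in T by ring.
rewrite Cmod_1 in T.
assert (E : exp (Rsum (fun n => M * r ^ n) N) <= exp (M / (1 - r))); [|lra].
destruct (Rsum_geom_le M r N HM Hr) as [L | L]; [apply Rlt_le, exp_increasing, L | rewrite L; lra].
Qed.

Lemma Cprod_one_minus_Clim (x : nat -> C) (M r : R) :
  0 <= M -> 0 <= r < 1 -> (forall n, Cmod (x n) <= M * r ^ n) ->
  Clim (Cprod (fun n => 1 - x n)%C) (Cprod_inf (fun n => 1 - x n)%C).
Proof.
intros HM Hr Hx.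
destruct (Clim_geometric_steps (Cprod (fun n => 1 - x n)%C) (exp (M / (1 - r)) * M) r Hr) as [l Hl].
- intros n; simpl.
  replace (_ - _)%C with (- (Cprod (fun n => 1 - x n)%C n * x n))%C by ring.
  rewrite Cmod_opp, Cmod_mult, Rmult_assoc.
  apply Rmult_le_compat; try apply Cmod_ge_0; [|apply Hx].
  apply Cmod_Cprod_upper; assumption.
- rewrite (Cprod_inf_unique _ l); [exact Hl | apply Clim_filterlim, Hl].
Qed.

Lemma is_derive_of_quadratic_error (f : C -> C) (z l : C) (d K : R) :
  0 < d ->
  (forall h, Cmod h <= d -> Cmod (f (z + h)%C - f z - h * l) <= K * Cmod h ^ 2) ->
  is_derive (K := C_AbsRing) (V := C_NormedModule) f z l.
Proof.
intros Hd H; split.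
- apply (is_linear_scal_l (K := C_AbsRing) (V := C_NormedModule)).
- intros y Hy.
  assert (E := is_filter_lim_locally_unique _ _ Hy); subst y.
  intros [eps Heps]; simpl.
  assert (HK : 0 < Rmax K 0 + 1) by (generalize (Rmax_r K 0); lra).
  assert (He : 0 < Rmin d (eps / (Rmax K 0 + 1))).
  { apply Rmin_glb_lt; [exact Hd | apply Rdiv_lt_0_compat; assumption]. }
  exists (mkposreal _ He); intros y Hy'; change C in y.
  change (Cmod (y - z)%C < Rmin d (eps / (Rmax K 0 + 1))) in Hy'.
  change (Cmod (f y - f z - (y - z) * l)%C <= eps * Cmod (y - z)%C).
  assert (L1 := Rmin_l d (eps / (Rmax K 0 + 1))).
  assert (L2 := Rmin_r d (eps / (Rmax K 0 + 1))).
  assert (H1 := H (y - z)%C ltac:(lra)).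
  replace (z + (y - z))%C with y in H1 by ring.
  eapply Rle_trans; [exact H1|].
  assert (P := Cmod_ge_0 (y - z)).
  set (h := Cmod (y - z)) in *.
  assert (Hh : (Rmax K 0 + 1) * h <= eps).
  { rewrite Rmult_comm; apply Rle_div_r; lra. }
  assert (K1 := Rmax_l K 0).
  simpl; nra.
Qed.

Definition qpoch_inf (p : R) (w : C) : C := Cprod_inf (fun n => 1 - w * RtoC (p ^ n))%C.

Lemma Cmod_geometric_term (p : R) (w : C) (n : nat) : 0 <= p ->
  Cmod (w * RtoC (p ^ n)) = Cmod w * p ^ n.
Proof.
intros Hp; rewrite Cmod_mult, Cmod_R, Rabs_pos_eq; [reflexivity | apply pow_le, Hp].
Qed.

Lemma qpoch_inf_Clim (p : R) (w : C) : 0 <= p < 1 ->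
  Clim (Cprod (fun n => 1 - w * RtoC (p ^ n))%C) (qpoch_inf p w).
Proof.
intros Hp; apply (Cprod_one_minus_Clim _ (Cmod w) p); trivial; [apply Cmod_ge_0|].
intros n; rewrite Cmod_geometric_term; lra.
Qed.

Lemma qpoch_inf_lower (p : R) (w : C) : 0 <= p <= 1 / 4 -> Cmod w <= 1 / 2 ->
  1 / 3 <= Cmod (qpoch_inf p w).
Proof.
intros Hp Hw; apply (Clim_Cmod_ge _ _ _ (qpoch_inf_Clim p w ltac:(lra))); intros N.
assert (B : 1 / 2 / (1 - p) <= 2 / 3).
{ apply Rle_div_l; lra. }
eapply Rle_trans; [|apply (Cprod_one_minus_lower _ (1 / 2) p N)]; try lra.
intros n; rewrite Cmod_geometric_term by lra.
apply Rmult_le_compat_r; [apply pow_le; lra | exact Hw].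
Qed.

Lemma one_minus_term_lower (p : R) (w : C) (n : nat) : 0 <= p <= 1 -> Cmod w <= 1 / 2 ->
  1 / 2 <= Cmod (1 - w * RtoC (p ^ n)).
Proof.
intros Hp Hw.
assert (T := Cmod_triangle (1 - w * RtoC (p ^ n)) (w * RtoC (p ^ n))).
replace (1 - w * RtoC (p ^ n) + w * RtoC (p ^ n))%C with (RtoC 1) in T by ring.
rewrite Cmod_1, Cmod_geometric_term in T by lra.
assert (P0 : 0 <= p ^ n) by (apply pow_le; lra).
assert (P1 : p ^ n <= 1 ^ n) by (apply pow_incr; lra); rewrite pow1 in P1.
assert (0 <= Cmod w) by apply Cmod_ge_0; nra.
Qed.

Lemma Cmod_inv_le (x : C) (b : R) : 0 < b -> b <= Cmod x -> Cmod (/ x) <= / b.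
Proof.
intros Hb Hx; rewrite Cmod_inv; [apply Rinv_le_contravar; assumption|].
apply Cmod_gt_0; lra.
Qed.

(** Logarithmic differentiation without a logarithm: the ratio of the products
    at w and w + h is the product of the 1 + e_n with
    e_n = h p^n / (1 - (w + h) p^n), and Cmod_Cprod_expansion reduces it to
    1 + h L up to a quadratic error. The inverse is treated because Gamma_q has
    the product in its denominator. *)
Lemma is_derive_qpoch_inv (p : R) (w L : C) :
  0 <= p <= 1 / 4 -> Cmod w < 1 / 2 ->
  Clim (Csum (fun n => RtoC (p ^ n) / (1 - w * RtoC (p ^ n)))%C) L ->
  is_derive (K := C_AbsRing) (V := C_NormedModule)
    (fun w => / qpoch_inf p w)%C w (L / qpoch_inf p w)%C.
Proof.
intros Hp Hw HL.
set (d := Rmin (1 / 8) (1 / 2 - Cmod w)).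
assert (d1 : d <= 1 / 8) by apply Rmin_l.
assert (d2 : d <= 1 / 2 - Cmod w) by apply Rmin_r.
apply (is_derive_of_quadratic_error _ _ _ d 540).
{ apply Rmin_glb_lt; lra. }
intros h Hh.
assert (Hh0 := Cmod_ge_0 h).
assert (Hw' : Cmod (w + h) <= 1 / 2).
{ eapply Rle_trans; [apply Cmod_triangle | lra]. }
assert (A := fun n => one_minus_term_lower p w n ltac:(lra) ltac:(lra)).
assert (A' := fun n => one_minus_term_lower p (w + h) n ltac:(lra) Hw').
assert (N : forall n, (1 - w * RtoC (p ^ n))%C <> RtoC 0).
{ intros n; apply Cmod_gt_0; specialize (A n); lra. }
assert (N' : forall n, (1 - (w + h) * RtoC (p ^ n))%C <> RtoC 0).
{ intros n; apply Cmod_gt_0; specialize (A' n); lra. }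
assert (Pn : forall n, 0 <= p ^ n <= 1).
{ intros n; split; [apply pow_le; lra|]; rewrite <- (pow1 n); apply pow_incr; lra. }
assert (I : forall n, Cmod (/ (1 - w * RtoC (p ^ n))) <= 2).
{ intros n; replace 2 with (/ (1 / 2)) by field; apply Cmod_inv_le; [lra | apply A]. }
assert (I' : forall n, Cmod (/ (1 - (w + h) * RtoC (p ^ n))) <= 2).
{ intros n; replace 2 with (/ (1 / 2)) by field; apply Cmod_inv_le; [lra | apply A']. }
set (e := fun n => (h * RtoC (p ^ n) * / (1 - (w + h) * RtoC (p ^ n)))%C).
set (lam := fun n => (RtoC (p ^ n) / (1 - w * RtoC (p ^ n)))%C) in *.
assert (He : forall n, Cmod (e n) <= (2 * Cmod h) * p ^ n).
{ intros n; unfold e; rewrite Cmod_mult, Cmod_geometric_term by lra.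
  assert (Q : 0 <= Cmod h * p ^ n) by (apply Rmult_le_pos; [exact Hh0 | apply Pn]).
  specialize (I' n); nra. }
assert (He2 : forall n, Cmod (e n - h * lam n) <= (4 * Cmod h ^ 2) * p ^ n).
{ intros n; unfold e, lam.
  replace (_ - _)%C with ((h * RtoC (p ^ n)) * (h * RtoC (p ^ n))
    * (/ (1 - (w + h) * RtoC (p ^ n)) * / (1 - w * RtoC (p ^ n))))%C.
  2: { field; split; [apply N | apply N']. }
  rewrite !Cmod_mult, !Cmod_R, !Rabs_pos_eq by apply Pn.
  assert (J : Cmod (/ (1 - (w + h) * RtoC (p ^ n))) * Cmod (/ (1 - w * RtoC (p ^ n))) <= 2 * 2).
  { apply Rmult_le_compat; try apply Cmod_ge_0; [apply I' | apply I]. }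
  apply Rle_trans with (Cmod h * p ^ n * (Cmod h * p ^ n) * (2 * 2)).
  - apply Rmult_le_compat_l; [apply Rle_0_sqr | exact J].
  - assert (P := Pn n); assert (0 <= Cmod h ^ 2) by apply pow2_ge_0.
    replace (Cmod h * p ^ n * (Cmod h * p ^ n) * (2 * 2))
      with (4 * Cmod h ^ 2 * (p ^ n * p ^ n)) by ring.
    apply Rmult_le_compat_l; nra. }
assert (G : forall c N, 0 <= c -> 0 <= Rsum (fun n => c * p ^ n) N <= 4 / 3 * c).
{ intros c n Hc; split.
  - replace 0 with (Rsum (fun _ => 0) n) by (induction n as [|n IHn]; simpl; lra).
    apply Rsum_le; intros k; apply Rmult_le_pos; [exact Hc | apply Pn].
  - eapply Rle_trans; [apply Rsum_geom_le; lra|].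
    apply Rle_div_l; [lra | nra]. }
set (g := qpoch_inf p w); set (g' := qpoch_inf p (w + h)).
assert (Lg := qpoch_inf_Clim p w ltac:(lra)); fold g in Lg.
assert (Lg' := qpoch_inf_Clim p (w + h) ltac:(lra)); fold g' in Lg'.
set (P := Cprod (fun n => 1 - w * RtoC (p ^ n))%C) in *.
set (P' := Cprod (fun n => 1 - (w + h) * RtoC (p ^ n))%C) in *.
(* First the multiplicative form g = g' (1 + h L) + error, in which no limit
   is inverted: 60 = 3 * 20, with 3 a bound for the finite products and 20 for
   the errors of Cmod_Cprod_expansion and of the linearization of e. *)
assert (F : Cmod (g - g' * (1 + h * L)) <= 60 * Cmod h ^ 2).
{ apply (Clim_Cmod_le (fun n => P n - P' n * (1 + h * Csum lam n))%C).
  { apply Clim_minus; [exact Lg|]; apply Clim_mult; [exact Lg'|].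
    apply Clim_plus; [apply Clim_const | apply Clim_scal, HL]. }
  intros n.
  assert (E : P n = (P' n * Cprod (fun n => 1 + e n)%C n)%C).
  { unfold P, P'; rewrite <- Cprod_mult; apply Cprod_ext; intros k; unfold e.
    field; apply N'. }
  rewrite E.
  replace (P' n * Cprod (fun n => 1 + e n)%C n - P' n * (1 + h * Csum lam n))%C
    with (P' n * ((Cprod (fun n => 1 + e n)%C n - 1 - Csum e n)
                  + (Csum e n - h * Csum lam n)))%C by ring.
  rewrite Cmod_mult.
  assert (B1 : Cmod (P' n) <= 3).
  { eapply Rle_trans; [apply (Cmod_Cprod_upper _ (1 / 2) p); try lra|].
    - intros k; rewrite Cmod_geometric_term by lra.
      apply Rmult_le_compat_r; [apply Pn | exact Hw'].
    - apply Rle_trans with (exp 1); [|apply exp_le_3].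
      apply Rlt_le, exp_increasing, Rlt_div_l; lra. }
  destruct (Cmod_Cprod_expansion e _ n He) as [_ B2].
  assert (B3 : Cmod (Csum e n - h * Csum lam n) <= 4 / 3 * (4 * Cmod h ^ 2)).
  { replace (Csum e n - h * Csum lam n)%C with (Csum (fun n => e n - h * lam n)%C n).
    - eapply Rle_trans; [apply (Cmod_Csum_le _ _ _ He2) | apply G].
      apply Rmult_le_pos; [lra | apply pow2_ge_0].
    - rewrite <- Csum_scal.
      rewrite (Csum_ext (fun n => e n - h * lam n)%C (fun n => e n + (-(1)) * (h * lam n))%C)
        by (intros; ring).
      rewrite Csum_plus, (Csum_scal (-(1))); ring. }
  set (T := Rsum (fun n => 2 * Cmod h * p ^ n) n) in *.
  assert (T0 : 0 <= T <= 4 / 3 * (2 * Cmod h)) by (apply G; lra).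
  destruct (exp_quadratic T) as [_ B4]; [rewrite Rabs_pos_eq; lra|].
  assert (T2 : T ^ 2 <= (4 / 3 * (2 * Cmod h)) ^ 2) by (apply pow_incr; lra).
  assert (B5 : Cmod (Cprod (fun n => 1 + e n)%C n - 1 - Csum e n + (Csum e n - h * Csum lam n))
               <= 20 * Cmod h ^ 2).
  { eapply Rle_trans; [apply Cmod_triangle|]; nra. }
  apply Rle_trans with (3 * (20 * Cmod h ^ 2)); [|lra].
  apply Rmult_le_compat; try apply Cmod_ge_0; assumption. }
assert (G0 := qpoch_inf_lower p w Hp ltac:(lra)); fold g in G0.
assert (G0' := qpoch_inf_lower p (w + h) Hp Hw'); fold g' in G0'.
(* Dividing by g g', each of modulus at least 1/3, multiplies the error by 9. *)
assert (Z : g <> RtoC 0) by (apply Cmod_gt_0; lra).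
assert (Z' : g' <> RtoC 0) by (apply Cmod_gt_0; lra).
replace (/ g' - / g - h * (L / g))%C with ((g - g' * (1 + h * L)) * (/ g * / g'))%C
  by (field; split; assumption).
rewrite !Cmod_mult.
assert (J : Cmod (/ g) * Cmod (/ g') <= 3 * 3).
{ apply Rmult_le_compat; try apply Cmod_ge_0;
    replace 3 with (/ (1 / 3)) by field; apply Cmod_inv_le; lra. }
apply Rle_trans with (60 * Cmod h ^ 2 * (3 * 3)); [|lra].
apply Rmult_le_compat; trivial; try apply Cmod_ge_0.
apply Rmult_le_pos; apply Cmod_ge_0.
Qed.

(** * The complex exponential and the q-digamma series *)

Lemma C_eq (a b : C) : Re a = Re b -> Im a = Im b -> a = b.
Proof. destruct a, b; simpl; intros -> ->; reflexivity. Qed.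

Lemma Cexp_plus (u v : C) : Cexp (u + v) = (Cexp u * Cexp v)%C.
Proof.
destruct u as [a b], v as [c d]; unfold Cexp; apply C_eq; simpl;
  rewrite exp_plus, ?cos_plus, ?sin_plus; ring.
Qed.

Lemma Cexp_RtoC (x : R) : Cexp (RtoC x) = RtoC (exp x).
Proof. unfold Cexp; apply C_eq; simpl; rewrite ?cos_0, ?sin_0; ring. Qed.

Lemma Cmod_Cexp (w : C) : Cmod (Cexp w) = exp (Re w).
Proof.
unfold Cexp, Cmod; simpl.
replace (_ + _) with (exp (Re w) ^ 2 * (Rsqr (sin (Im w)) + Rsqr (cos (Im w))))
  by (unfold Rsqr; ring).
rewrite sin2_cos2, Rmult_1_r; apply sqrt_pow2, Rlt_le, exp_pos.
Qed.

Lemma Cexp_neq_0 (w : C) : Cexp w <> RtoC 0.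
Proof. apply Cmod_gt_0; rewrite Cmod_Cexp; apply exp_pos. Qed.

Lemma Cmod_le_abs (c : C) : Cmod c <= Rabs (Re c) + Rabs (Im c).
Proof.
replace c with (RtoC (Re c) + Ci * RtoC (Im c))%C at 1
  by (apply C_eq; simpl; ring).
eapply Rle_trans; [apply Cmod_triangle|].
rewrite Cmod_mult, !Cmod_R, Cmod_Ci; lra.
Qed.

Lemma sin_abs_le (x : R) : Rabs (sin x) <= Rabs x.
Proof.
destruct (MVT_gen sin 0 x cos) as [c [_ Hc]].
- intros t _; apply is_derive_Reals, derivable_pt_lim_sin.
- intros t _; apply derivable_continuous_pt, derivable_pt_sin.
- rewrite sin_0, !Rminus_0_r in Hc; rewrite Hc, Rabs_mult.
  assert (Rabs (cos c) <= 1) by apply Rabs_le, COS_bound.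
  assert (Hp := Rabs_pos x); nra.
Qed.

Lemma cos_quadratic (x : R) : Rabs (cos x - 1) <= x ^ 2.
Proof.
replace (cos x - 1) with (- (2 * (sin (x / 2) * sin (x / 2)))).
- rewrite Rabs_Ropp, !Rabs_mult, (Rabs_pos_eq 2) by lra.
  assert (H := sin_abs_le (x / 2)).
  assert (E : Rabs (x / 2) ^ 2 = x ^ 2 / 4) by (rewrite pow2_abs; field).
  assert (P := Rabs_pos (sin (x / 2))); nra.
- replace x with (2 * (x / 2)) at 3 by field; rewrite cos_2a_sin; ring.
Qed.

Lemma sin_quadratic (x : R) : Rabs x <= 1 -> Rabs (sin x - x) <= x ^ 2.
Proof.
intros Hx.
destruct (MVT_gen (fun x => sin x - x) 0 x (fun x => cos x - 1)) as [c [Hc E]].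
- intros t _; auto_derive; trivial; ring.
- intros t _; apply derivable_continuous_pt; reg.
- rewrite sin_0, !Rminus_0_r in E; rewrite E, Rabs_mult.
  assert (Hcx : Rabs c <= Rabs x).
  { unfold Rmin, Rmax in Hc; destruct (Rle_dec 0 x); unfold Rabs;
      destruct (Rcase_abs c); destruct (Rcase_abs x); lra. }
  assert (H := cos_quadratic c); rewrite <- pow2_abs in H.
  rewrite <- (pow2_abs x).
  assert (P := Rabs_pos x); assert (P' := Rabs_pos c).
  assert (Rabs (cos c - 1) <= Rabs x) by nra.
  nra.
Qed.

Lemma is_derive_Cexp (w : C) :
  is_derive (K := C_AbsRing) (V := C_NormedModule) Cexp w (Cexp w).
Proof.
apply (is_derive_of_quadratic_error _ _ _ (1 / 2) (Cmod (Cexp w) * 8)); [lra|].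
intros h Hh.
replace (Cexp (w + h) - Cexp w - h * Cexp w)%C with (Cexp w * (Cexp h - 1 - h))%C
  by (rewrite Cexp_plus; ring).
rewrite Cmod_mult, Rmult_assoc; apply Rmult_le_compat_l; [apply Cmod_ge_0|].
assert (Ha := re_le_Cmod h); assert (Hb := Rabs_Im_le_Cmod h).
eapply Rle_trans; [apply Cmod_le_abs|].
destruct h as [a b]; unfold Cexp; simpl in Ha, Hb |- *.
set (m := Cmod (a, b)) in *.
assert (E := exp_quadratic a ltac:(lra)).
assert (C1 := cos_quadratic b); assert (S1 := sin_quadratic b ltac:(lra)).
assert (S0 := sin_abs_le b).
rewrite <- (pow2_abs b) in *; rewrite <- (pow2_abs a) in *.
assert (A0 := Rabs_pos a); assert (B0 := Rabs_pos b).
assert (A2 : Rabs a ^ 2 <= m ^ 2) by (apply pow_incr; lra).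
assert (B2 : Rabs b ^ 2 <= m ^ 2) by (apply pow_incr; lra).
assert (E1 : Rabs (exp a - 1) <= 2 * Rabs a).
{ replace (exp a - 1) with ((exp a - 1 - a) + a) by ring.
  eapply Rle_trans; [apply Rabs_triang|]; rewrite Rabs_pos_eq by lra; nra. }
assert (E2 : Rabs (exp a) <= 2).
{ replace (exp a) with ((exp a - 1) + 1) by ring.
  eapply Rle_trans; [apply Rabs_triang|]; rewrite Rabs_R1; lra. }
(* Each component of exp h - 1 - h splits into second-order terms. *)
replace (exp a * cos b + - (1) + - a) with ((exp a - 1 - a) + exp a * (cos b - 1)) by ring.
replace (exp a * sin b + - 0 + - b) with ((exp a - 1) * sin b + (sin b - b)) by ring.
assert (T1 := Rabs_triang (exp a - 1 - a) (exp a * (cos b - 1))).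
assert (T2 := Rabs_triang ((exp a - 1) * sin b) (sin b - b)).
rewrite Rabs_mult in T1, T2; rewrite (Rabs_pos_eq (exp a - 1 - a)) in T1 by lra.
assert (Q1 : Rabs (exp a) * Rabs (cos b - 1) <= 2 * m ^ 2).
{ apply Rmult_le_compat; try apply Rabs_pos; lra. }
assert (Q2 : Rabs (exp a - 1) * Rabs (sin b) <= (2 * m) * m).
{ apply Rmult_le_compat; try apply Rabs_pos; lra. }
simpl in *; lra.
Qed.

(** C carries two normed-module structures over itself, with the same norm; the
    product rule is available for the second one, C_derive uses the first. *)
Lemma is_derive_C_AbsRing (f : C -> C) (z l : C) :
  is_derive (K := C_AbsRing) (V := C_NormedModule) f z l <->
  is_derive (K := C_AbsRing) (V := AbsRing_NormedModule C_AbsRing) f z l.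
Proof.
split; intros [H1 H2]; (split; [split; [| |destruct H1 as [_ _ [M HM]]; exists M; exact HM]|exact H2]);
  intros; [apply (linear_plus _ H1) | apply (linear_scal _ H1)
          | apply (linear_plus _ H1) | apply (linear_scal _ H1)].
Qed.

Lemma is_derive_Cmult (f g : C -> C) (z df dg : C) :
  is_derive (K := C_AbsRing) (V := C_NormedModule) f z df ->
  is_derive (K := C_AbsRing) (V := C_NormedModule) g z dg ->
  is_derive (K := C_AbsRing) (V := C_NormedModule) (fun z => f z * g z)%C z
    (df * g z + f z * dg)%C.
Proof.
intros Hf Hg; apply is_derive_C_AbsRing.
apply (is_derive_mult (K := C_AbsRing) f g); [apply is_derive_C_AbsRing, Hf | apply is_derive_C_AbsRing, Hg |].
intros n m; apply Cmult_comm.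
Qed.

Lemma is_derive_Ccomp (f g : C -> C) (z df dg : C) :
  is_derive (K := C_AbsRing) (V := C_NormedModule) f (g z) df ->
  is_derive (K := C_AbsRing) (V := C_NormedModule) g z dg ->
  is_derive (K := C_AbsRing) (V := C_NormedModule) (fun z => f (g z)) z (dg * df)%C.
Proof.
intros Hf Hg.
apply (is_derive_comp (K := C_AbsRing) (V := C_NormedModule) f g); [exact Hf|].
apply is_derive_C_AbsRing, Hg.
Qed.

(** The z-dependent product depends on z only through w = q^(-z), so that it can
    be differentiated in w and composed with the exponential. *)
Lemma qGamma_eq (z : C) :
  qGamma (exp PI) z =
  (qpoch_inf (exp (- PI)) (RtoC (exp (- PI)))
   * / qpoch_inf (exp (- PI)) (Cexp (- z * RtoC PI))
   * Cexp ((1 - z) * RtoC (ln (exp PI - 1)))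
   * Cexp (z * (z - 1) / 2 * RtoC PI))%C.
Proof.
assert (E : forall n z, Rcpow (exp PI) (- RtoC (INR n) - z)
             = (Cexp (- z * RtoC PI) * RtoC (exp (- PI) ^ n))%C).
{ intros n w; unfold Rcpow; rewrite ln_exp.
  replace ((- RtoC (INR n) - w) * RtoC PI)%C
    with (- w * RtoC PI + RtoC (INR n * - PI))%C
    by (rewrite RtoC_mult, RtoC_opp; ring).
  rewrite Cexp_plus, Cexp_RtoC; f_equal; f_equal.
  rewrite <- Rpower_pow by apply exp_pos; unfold Rpower; rewrite ln_exp; reflexivity. }
assert (F1 : (fun n => RtoC 1 - Rcpow (exp PI) (- RtoC (INR n) - RtoC 1))%C
           = (fun n => RtoC 1 - RtoC (exp (- PI)) * RtoC (exp (- PI) ^ n))%C).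
{ apply functional_extensionality; intros n; rewrite E.
  replace (- RtoC 1 * RtoC PI)%C with (RtoC (- PI)) by (rewrite RtoC_opp; ring).
  rewrite Cexp_RtoC; reflexivity. }
assert (F2 : (fun n => RtoC 1 - Rcpow (exp PI) (- RtoC (INR n) - z))%C
           = (fun n => RtoC 1 - Cexp (- z * RtoC PI) * RtoC (exp (- PI) ^ n))%C).
{ apply functional_extensionality; intros n; rewrite E; reflexivity. }
unfold qGamma; rewrite F1, F2; unfold Rcpow; rewrite ln_exp; reflexivity.
Qed.

Lemma exp_ge_pow (x : R) (n : nat) : 0 <= 1 + x / INR (S n) -> (1 + x / INR (S n)) ^ S n <= exp x.
Proof.
intros H.
replace (exp x) with (exp (x / INR (S n)) ^ S n).
- apply pow_incr; split; [exact H | apply exp_ineq1_le].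
- rewrite <- Rpower_pow by apply exp_pos; unfold Rpower; rewrite ln_exp; f_equal.
  field; apply not_0_INR; discriminate.
Qed.

Lemma PI_gt_3 : 3 < PI.
Proof. generalize PI2_3_2; lra. Qed.

Lemma exp_PI_ge_16 : 16 <= exp PI.
Proof.
apply Rle_trans with (exp 3); [|apply Rlt_le, exp_increasing, PI_gt_3].
(* (1 + 3/32)^32 is about 17.6. *)
assert (H := exp_ge_pow 3 31).
replace (INR 32) with 32 in H by (rewrite INR_IZR_INZ; reflexivity).
specialize (H ltac:(lra)).
eapply Rle_trans; [|exact H].
replace (1 + 3 / 32) with (35 / 32) by field; lra.
Qed.

Lemma exp_opp_PI_le : 0 <= exp (- PI) <= 1 / 16.
Proof.
split; [apply Rlt_le, exp_pos|].
rewrite exp_Ropp; replace (1 / 16) with (/ 16) by field.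
apply Rinv_le_contravar; [lra | apply exp_PI_ge_16].
Qed.

Lemma qdigamma_series (z L : C) :
  1 / 2 <= Re z ->
  Clim (Csum (fun n => RtoC (exp (- PI) ^ n)
          / (1 - Cexp (- z * RtoC PI) * RtoC (exp (- PI) ^ n)))%C) L ->
  qdigamma (exp PI) z =
  (- RtoC (ln (exp PI - 1)) + RtoC PI * (z - 1 / 2 - Cexp (- z * RtoC PI) * L))%C.
Proof.
intros Hz HL.
assert (Hp := exp_opp_PI_le).
assert (Hw : Cmod (Cexp (- z * RtoC PI)) < 1 / 2).
{ rewrite Cmod_Cexp.
  replace (Re (- z * RtoC PI)) with (- (Re z * PI)) by (destruct z; simpl; ring).
  rewrite exp_Ropp; replace (1 / 2) with (/ 2) by field.
  apply Rinv_lt_contravar; [apply Rmult_lt_0_compat; [lra | apply exp_pos]|].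
  assert (H := exp_ineq1_le (Re z * PI)); assert (P3 := PI_gt_3); nra. }
set (w0 := Cexp (- z * RtoC PI)) in *.
set (p := exp (- PI)) in *.
set (c := RtoC (ln (exp PI - 1))).
assert (G0 : qpoch_inf p w0 <> RtoC 0).
{ apply Cmod_gt_0; assert (H := qpoch_inf_lower p w0 ltac:(lra) ltac:(lra)); lra. }
assert (K0 : qpoch_inf p (RtoC p) <> RtoC 0).
{ apply Cmod_gt_0; assert (H := qpoch_inf_lower p (RtoC p) ltac:(lra)).
  rewrite Cmod_R, Rabs_pos_eq in H by lra; specialize (H ltac:(lra)); lra. }
assert (D1 := is_derive_qpoch_inv p w0 L ltac:(lra) Hw HL).
assert (Dsq : is_derive (K := C_AbsRing) (V := C_NormedModule)
                 (fun z => z * (z - 1) / 2 * RtoC PI)%C z ((z - 1 / 2) * RtoC PI)%C).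
{ apply (is_derive_of_quadratic_error _ _ _ 1 (Cmod (RtoC PI / 2))); [lra|]; intros h _; cbv beta; cbv beta.
  right.
  replace (_ - _)%C with (RtoC PI / 2 * (h * h))%C by field.
  rewrite !Cmod_mult; ring. }
assert (Dw : is_derive (K := C_AbsRing) (V := C_NormedModule)
                (fun z => Cexp (- z * RtoC PI)) z (- RtoC PI * w0)%C).
{ apply (is_derive_Ccomp Cexp (fun z => - z * RtoC PI)%C).
  - apply is_derive_Cexp.
  - apply (is_derive_of_quadratic_error _ _ _ 1 0); [lra|]; intros h _; cbv beta.
    replace (_ - _)%C with (RtoC 0) by ring; rewrite Cmod_0; lra. }
assert (Dc : is_derive (K := C_AbsRing) (V := C_NormedModule)
                (fun z => Cexp ((1 - z) * c)) z (- c * Cexp ((1 - z) * c))%C).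
{ apply (is_derive_Ccomp Cexp (fun z => (1 - z) * c)%C).
  - apply is_derive_Cexp.
  - apply (is_derive_of_quadratic_error _ _ _ 1 0); [lra|]; intros h _; cbv beta.
    replace (_ - _)%C with (RtoC 0) by ring; rewrite Cmod_0; lra. }
assert (Dq : is_derive (K := C_AbsRing) (V := C_NormedModule)
                (fun z => Cexp (z * (z - 1) / 2 * RtoC PI)) z
                ((z - 1 / 2) * RtoC PI * Cexp (z * (z - 1) / 2 * RtoC PI))%C).
{ apply (is_derive_Ccomp Cexp
            (fun z => z * (z - 1) / 2 * RtoC PI)%C).
  - apply is_derive_Cexp.
  - exact Dsq. }
assert (Dg : is_derive (K := C_AbsRing) (V := C_NormedModule)
                (fun z => / qpoch_inf p (Cexp (- z * RtoC PI)))%C z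
                (- RtoC PI * w0 * (L / qpoch_inf p w0))%C).
{ apply (is_derive_Ccomp
            (fun w => / qpoch_inf p w)%C (fun z => Cexp (- z * RtoC PI))).
  - exact D1.
  - exact Dw. }
assert (Dk : is_derive (K := C_AbsRing) (V := C_NormedModule)
                (fun _ => qpoch_inf p (RtoC p)) z (RtoC 0)).
{ apply (is_derive_const (K := C_AbsRing) (V := C_NormedModule)). }
assert (DD := is_derive_Cmult _ _ _ _ _ (is_derive_Cmult _ _ _ _ _
                (is_derive_Cmult _ _ _ _ _ Dk Dg) Dc) Dq).
unfold qdigamma.
replace (qGamma (exp PI)) with (fun z =>
  (qpoch_inf p (RtoC p) * / qpoch_inf p (Cexp (- z * RtoC PI))
   * Cexp ((1 - z) * c) * Cexp (z * (z - 1) / 2 * RtoC PI))%C)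
  by (apply functional_extensionality; intros w; symmetry; apply qGamma_eq).
etransitivity;
  [apply (f_equal2 Cdiv); [apply (is_C_derive_unique _ _ _ DD) | reflexivity]|].
cbv beta.
change (Cexp (- z * RtoC PI)) with w0.
assert (E1 := Cexp_neq_0 ((1 - z) * c)).
assert (E2 := Cexp_neq_0 (z * (z - 1) / 2 * RtoC PI)).
unfold w0; fold w0.
set (g := qpoch_inf p w0) in *; set (k := qpoch_inf p (RtoC p)) in *.
set (e1 := Cexp ((1 - z) * c)) in *; set (e2 := Cexp (z * (z - 1) / 2 * RtoC PI)) in *.
field; repeat split; assumption.
Qed.

Lemma Cexp_half_i (s : R) (z : C) : z = ((1 - RtoC s * Ci) / 2)%C -> s = 1 \/ s = -1 ->
  Cexp (- z * RtoC PI) = (RtoC s * Ci * RtoC (exp (- (PI / 2))))%C.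
Proof.
intros -> Hs; unfold Cexp; apply C_eq; simpl; destruct Hs as [-> | ->].
all: match goal with |- context [cos ?x] =>
       first [replace x with (PI / 2) by field | replace x with (- (PI / 2)) by field]
     | |- context [sin ?x] =>
       first [replace x with (PI / 2) by field | replace x with (- (PI / 2)) by field] end.
all: rewrite ?cos_neg, ?sin_neg, ?cos_PI2, ?sin_PI2; try ring.
all: match goal with |- context [exp ?x] => replace x with (- (PI / 2)) by field end; ring.
Qed.

(** * The two q-digamma values *)

(** With s = e^(-pi/2), the values of q^(-z) at the two points are i s and - i s,
    and i a / (1 - i a) + i a / (1 + i a) = 2 i a / (1 + a^2). *)
Lemma qdigamma_difference (sigma : C) :
  Clim (Csum (fun n => RtoC (/ cosh (PI * (INR n + 1 / 2))))) sigma ->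
  (qdigamma (exp PI) ((RtoC 1 - Ci) / RtoC 2) - qdigamma (exp PI) ((RtoC 1 + Ci) / RtoC 2)
   = - (Ci * RtoC PI) - Ci * (RtoC PI * sigma))%C.
Proof.
intros Hs.
assert (Hp := exp_opp_PI_le).
set (p := exp (- PI)) in *.
set (s := exp (- (PI / 2))).
assert (S0 : 0 < s) by apply exp_pos.
assert (Es : forall n, s * p ^ n = exp (- (PI * (INR n + 1 / 2)))).
{ intros n; unfold p, s; rewrite <- Rpower_pow by apply exp_pos.
  unfold Rpower; rewrite ln_exp, <- exp_plus; f_equal; field. }
(* s is the square root of exp (- PI), which is at most 1 / 16. *)
assert (Hs1 : s <= 1 / 2).
{ apply Rnot_lt_le; intros C.
  assert (E : s * s = p) by (unfold s, p; rewrite <- exp_plus; f_equal; field); nra. }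
assert (Z1 : Cexp (- ((RtoC 1 - Ci) / RtoC 2) * RtoC PI) = (Ci * RtoC s)%C).
{ rewrite (Cexp_half_i 1); [unfold s; ring | unfold Cdiv; ring | left; reflexivity]. }
assert (Z2 : Cexp (- ((RtoC 1 + Ci) / RtoC 2) * RtoC PI) = (- Ci * RtoC s)%C).
{ rewrite (Cexp_half_i (-1)); [unfold s; ring | unfold Cdiv; ring | right; reflexivity]. }
assert (Ex : forall w, Cmod w <= 1 / 2 ->
  exists L, Clim (Csum (fun n => RtoC (p ^ n) / (1 - w * RtoC (p ^ n)))%C) L).
{ intros w Hw; apply (Csum_geometric_Clim _ 2 p); [lra|]; intros n.
  unfold Cdiv; rewrite Cmod_mult, Cmod_R, Rabs_pos_eq by (apply pow_le; lra).
  rewrite Rmult_comm; apply Rmult_le_compat_r; [apply pow_le; lra|].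
  replace 2 with (/ (1 / 2)) by field; apply Cmod_inv_le; [lra|].
  apply one_minus_term_lower; lra. }
assert (M1 : Cmod (Ci * RtoC s) <= 1 / 2).
{ rewrite Cmod_mult, Cmod_Ci, Cmod_R, Rabs_pos_eq; lra. }
assert (M2 : Cmod (- Ci * RtoC s) <= 1 / 2).
{ rewrite Cmod_mult, Cmod_opp, Cmod_Ci, Cmod_R, Rabs_pos_eq; lra. }
destruct (Ex _ M1) as [L1 H1]; destruct (Ex _ M2) as [L2 H2].
rewrite (qdigamma_series ((RtoC 1 - Ci) / RtoC 2) L1), (qdigamma_series ((RtoC 1 + Ci) / RtoC 2) L2).
- rewrite Z1, Z2.
  assert (E : (Ci * sigma = Ci * RtoC s * L1 - - Ci * RtoC s * L2)%C).
  { apply (Clim_unique (fun N => Ci * Csum (fun n => RtoC (/ cosh (PI * (INR n + 1 / 2)))) N)%C).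
    - apply Clim_scal, Hs.
    - eapply Clim_ext;
        [|apply Clim_minus; [apply Clim_scal, H1 | apply Clim_scal, H2]].
      intros N; cbv beta.
      replace (_ - _)%C with (Ci * RtoC s * Csum (fun n => RtoC (p ^ n) / (1 - Ci * RtoC s * RtoC (p ^ n)))%C N
        + Ci * RtoC s * Csum (fun n => RtoC (p ^ n) / (1 - - Ci * RtoC s * RtoC (p ^ n)))%C N)%C by ring.
      rewrite <- !Csum_scal, <- Csum_plus.
      apply Csum_ext; intros n _.
      assert (A := Es n); set (a := p ^ n) in *.
      assert (A0 : 0 < s * a) by (rewrite A; apply exp_pos).
      assert (HC : / cosh (PI * (INR n + 1 / 2)) = 2 * (s * a) / (1 + (s * a) * (s * a))).
      { unfold cosh; rewrite <- A.
        replace (exp (PI * (INR n + 1 / 2))) with (/ (s * a))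
          by (rewrite A, exp_Ropp, Rinv_inv; reflexivity).
        field; split; [nra|]; split; nra. }
      rewrite HC.
      assert (N0 : (1 + (s * a) * (s * a)) <> 0) by nra.
      rewrite RtoC_div, !RtoC_mult, RtoC_plus, !RtoC_mult by exact N0.
      assert (N0' : (1 + RtoC s * RtoC a * (RtoC s * RtoC a))%C <> RtoC 0).
      { rewrite <- !RtoC_mult, <- RtoC_plus; intros C; apply N0, RtoC_inj, C. }
      assert (II : (Ci * Ci = -(1))%C) by (apply C_eq; simpl; ring).
      assert (FF : ((1 - Ci * RtoC s * RtoC a) * (1 - - Ci * RtoC s * RtoC a)
                   = 1 + RtoC s * RtoC a * (RtoC s * RtoC a))%C).
      { transitivity (1 - (Ci * Ci) * (RtoC s * RtoC a * (RtoC s * RtoC a)))%C; [ring|].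
        rewrite II; ring. }
      assert (N1 : (1 - Ci * RtoC s * RtoC a)%C <> RtoC 0).
      { intros C; apply N0'; rewrite <- FF, C; ring. }
      assert (N2 : (1 - - Ci * RtoC s * RtoC a)%C <> RtoC 0).
      { intros C; apply N0'; rewrite <- FF, C; ring. }
      rewrite <- FF; field; split; assumption. }
  replace (Ci * (RtoC PI * sigma))%C with (RtoC PI * (Ci * sigma))%C by ring.
  rewrite E; field.
- simpl; lra.
- rewrite Z2; exact H2.
- simpl; lra.
- rewrite Z1; exact H1.
Qed.

(** * Two-sided sums and convolution kernels *)

(** Summation over Z is by symmetric ranges: the odd kernel csch then has
    partial sums equal to 0, and finite double sums can be reordered
    freely. *)
Definition zsum (f : Z -> C) (N : nat) : C :=
  (f 0%Z + Csum (fun k => f (Z.of_nat (S k)) + f (- Z.of_nat (S k))%Z)%C N)%C.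

Definition zpow (r : R) (n : Z) : R := r ^ Z.abs_nat n.

Lemma zsum_S (f : Z -> C) (N : nat) :
  zsum f (S N) = (zsum f N + (f (Z.of_nat (S N)) + f (- Z.of_nat (S N))%Z))%C.
Proof. unfold zsum; cbn [Csum]; ring. Qed.

Lemma zsum_ext_range (f g : Z -> C) (N : nat) :
  (forall n, (Z.abs n <= Z.of_nat N)%Z -> f n = g n) -> zsum f N = zsum g N.
Proof.
intros H; unfold zsum; rewrite H by lia; f_equal; apply Csum_ext; intros k Hk.
rewrite !H by lia; reflexivity.
Qed.

Lemma zsum_ext (f g : Z -> C) (N : nat) : (forall n, f n = g n) -> zsum f N = zsum g N.
Proof. intros H; apply zsum_ext_range; intros; apply H. Qed.

Lemma zsum_plus (f g : Z -> C) (N : nat) :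
  zsum (fun n => (f n + g n)%C) N = (zsum f N + zsum g N)%C.
Proof. induction N as [|N IHN]; [unfold zsum; simpl | rewrite !zsum_S, IHN]; ring. Qed.

Lemma zsum_scal (c : C) (f : Z -> C) (N : nat) :
  zsum (fun n => (c * f n)%C) N = (c * zsum f N)%C.
Proof. induction N as [|N IHN]; [unfold zsum; simpl | rewrite !zsum_S, IHN]; ring. Qed.

Lemma zsum_minus (f g : Z -> C) (N : nat) :
  zsum (fun n => (f n - g n)%C) N = (zsum f N - zsum g N)%C.
Proof. induction N as [|N IHN]; [unfold zsum; simpl | rewrite !zsum_S, IHN]; ring. Qed.

Lemma zsum_swap (F : Z -> Z -> C) (M N : nat) :
  zsum (fun m => zsum (F m) N) M = zsum (fun n => zsum (fun m => F m n) M) N.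
Proof.
induction M as [|M IHM].
- unfold zsum at 1; simpl.
  rewrite Cplus_0_r; apply zsum_ext; intros n; unfold zsum; simpl; ring.
- rewrite zsum_S, IHM, <- !zsum_plus.
  apply zsum_ext; intros n; rewrite zsum_S; reflexivity.
Qed.

Lemma zsum_neg (f : Z -> C) (N : nat) : zsum (fun n => f (- n)%Z) N = zsum f N.
Proof.
induction N as [|N IHN]; [reflexivity|].
rewrite !zsum_S, IHN, Z.opp_involutive; ring.
Qed.

Lemma zsum_shift (f : Z -> C) (N : nat) :
  zsum (fun n => f (n - 1)%Z) N = (zsum f N + f (- Z.of_nat N - 1)%Z - f (Z.of_nat N))%C.
Proof.
induction N as [|N IHN].
- unfold zsum; simpl; ring.
- rewrite !zsum_S, IHN.
  replace (Z.of_nat (S N) - 1)%Z with (Z.of_nat N) by lia.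
  replace (- Z.of_nat N - 1)%Z with (- Z.of_nat (S N))%Z by lia.
  ring.
Qed.

Lemma zsum_single (m : Z) (x : C) (N : nat) :
  zsum (fun n => if Z.eqb n m then x else RtoC 0) N
  = if Z.leb (Z.abs m) (Z.of_nat N) then x else RtoC 0.
Proof.
induction N as [|N IHN].
- unfold zsum; cbn [Csum]; change (Z.of_nat 0) with 0%Z.
  destruct (Z.eqb_spec 0 m), (Z.leb_spec (Z.abs m) 0); try lia; ring.
- rewrite zsum_S, IHN.
  destruct (Z.eqb_spec (Z.of_nat (S N)) m), (Z.eqb_spec (- Z.of_nat (S N)) m),
    (Z.leb_spec (Z.abs m) (Z.of_nat N)), (Z.leb_spec (Z.abs m) (Z.of_nat (S N)));
    try lia; ring.
Qed.

Lemma zpow_nonneg (r : R) (n : Z) : 0 <= r -> 0 <= zpow r n.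
Proof. intros H; apply pow_le, H. Qed.

Lemma zpow_of_nat (r : R) (n : nat) : zpow r (Z.of_nat n) = r ^ n.
Proof. unfold zpow; f_equal; lia. Qed.

Lemma zpow_opp (r : R) (n : Z) : zpow r (- n) = zpow r n.
Proof. unfold zpow; f_equal; lia. Qed.

Lemma zpow_le (r s : R) (n : Z) : 0 <= r <= s -> zpow r n <= zpow s n.
Proof. intros H; apply pow_incr, H. Qed.

Lemma Cmod_zsum_le (f : Z -> C) (M : R) (N : nat) :
  0 <= M -> (forall n, Cmod (f n) <= M * zpow (1 / 2) n) -> Cmod (zsum f N) <= 3 * M.
Proof.
intros HM Hf; unfold zsum.
eapply Rle_trans; [apply Cmod_triangle|].
assert (H0 := Hf 0%Z); unfold zpow in H0; simpl in H0.
assert (H1 : Cmod (Csum (fun k => f (Z.of_nat (S k)) + f (- Z.of_nat (S k))%Z)%C N) <= M / (1 - 1 / 2)).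
{ eapply Rle_trans; [|apply (Rsum_geom_le M (1 / 2) N HM); lra].
  apply Cmod_Csum_le; intros k.
  eapply Rle_trans; [apply Cmod_triangle|].
  assert (A := Hf (Z.of_nat (S k))); assert (B := Hf (- Z.of_nat (S k))%Z).
  rewrite zpow_opp in B; rewrite zpow_of_nat in A, B.
  simpl pow in A, B; lra. }
lra.
Qed.

Lemma zsum_Clim (f : Z -> C) (M : R) :
  (forall n, Cmod (f n) <= M * zpow (1 / 2) n) -> exists l, Clim (zsum f) l.
Proof.
intros Hf.
apply (Clim_geometric_steps _ M (1 / 2)); [lra|]; intros N.
rewrite zsum_S.
replace (_ - _)%C with (f (Z.of_nat (S N)) + f (- Z.of_nat (S N))%Z)%C by ring.
eapply Rle_trans; [apply Cmod_triangle|].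
assert (A := Hf (Z.of_nat (S N))); assert (B := Hf (- Z.of_nat (S N))%Z).
rewrite zpow_opp in B; rewrite zpow_of_nat in A, B.
simpl pow in A, B; lra.
Qed.

Lemma is_lim_seq_geom_scal (M : R) : is_lim_seq (fun n => M * (1 / 2) ^ n) 0.
Proof.
replace (Finite 0) with (Finite (M * 0)) by (f_equal; ring).
apply is_lim_seq_mult'; [apply is_lim_seq_const|].
apply is_lim_seq_geom; rewrite Rabs_pos_eq; lra.
Qed.

(** Symmetric ranges are not preserved by n -> 1 - n, but the defect
    consists of two boundary terms that tend to 0. *)
Lemma zsum_reflect_Clim (f : Z -> C) (M : R) (l : C) :
  (forall n, Cmod (f n) <= M * zpow (1 / 2) n) ->
  Clim (zsum f) l -> Clim (zsum (fun n => f (1 - n)%Z)) l.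
Proof.
intros Hf Hl.
assert (E : Clim (fun N => zsum (fun n => f (1 - n)%Z) N - zsum f N)%C 0).
{ apply Clim_squeeze with (e := fun N => (3 * M) * (1 / 2) ^ N); [|apply is_lim_seq_geom_scal].
  intros N.
  rewrite (zsum_ext (fun n => f (1 - n)%Z) (fun n => (fun k => f (- k)%Z) (n - 1)%Z))
    by (intros n; f_equal; lia).
  rewrite (zsum_shift (fun k => f (- k)%Z)), zsum_neg.
  replace (_ - 0)%C with (f (- (- Z.of_nat N - 1))%Z + - f (- Z.of_nat N)%Z)%C by ring.
  eapply Rle_trans; [apply Cmod_triangle|]; rewrite Cmod_opp.
  replace (- (- Z.of_nat N - 1))%Z with (Z.of_nat (S N)) by lia.
  assert (A := Hf (Z.of_nat (S N))); assert (B := Hf (- Z.of_nat N)%Z).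
  rewrite zpow_opp in B; rewrite zpow_of_nat in A, B.
  assert (A' := Cmod_ge_0 (f (Z.of_nat (S N)))).
  assert (B' := Cmod_ge_0 (f (- Z.of_nat N)%Z)).
  simpl pow in A; lra. }
replace l with (0 + l)%C by ring.
apply Clim_ext with (u := fun N => ((zsum (fun n => f (1 - n)%Z) N - zsum f N) + zsum f N)%C).
- intros N; ring.
- apply Clim_plus; assumption.
Qed.

(** Increasing k by 1 changes the sum only by two boundary terms, at distance
    about N - k from the origin of the kernel. *)
Lemma zsum_kernel_nat (ker : Z -> C) (K : R) (N k : nat) :
  0 <= K -> (forall d, Cmod (ker d) <= K * zpow (1 / 2) d) ->
  Cmod (zsum (fun n => ker (Z.of_nat k - n)%Z) N - zsum ker N) <= 4 * K * 2 ^ k * (1 / 2) ^ N.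
Proof.
intros HK Hk.
assert (PN : 0 <= (1 / 2) ^ N) by (apply pow_le; lra).
induction k as [|k IHk].
- rewrite (zsum_ext _ (fun n => ker (- n)%Z)) by (intros; f_equal; lia).
  rewrite zsum_neg; replace (_ - _)%C with (RtoC 0) by ring; rewrite Cmod_0.
  simpl; nra.
- rewrite (zsum_ext _ (fun n => (fun j => ker (Z.of_nat k - j)%Z) (n - 1)%Z))
    by (intros; f_equal; lia).
  rewrite (zsum_shift (fun j => ker (Z.of_nat k - j)%Z)).
  set (s := zsum (fun n => ker (Z.of_nat k - n)%Z) N) in *.
  replace (_ - _)%C with ((s - zsum ker N) + (ker (Z.of_nat k - (- Z.of_nat N - 1))%Z
    + - ker (Z.of_nat k - Z.of_nat N)%Z))%C by ring.
  eapply Rle_trans; [apply Cmod_triangle|].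
  assert (T := Cmod_triangle (ker (Z.of_nat k - (- Z.of_nat N - 1))%Z)
                 (- ker (Z.of_nat k - Z.of_nat N)%Z)).
  rewrite Cmod_opp in T.
  assert (P2 : 1 <= 2 ^ k) by (apply pow_R1_Rle; lra).
  assert (A := Hk (Z.of_nat k - (- Z.of_nat N - 1))%Z).
  assert (B := Hk (Z.of_nat k - Z.of_nat N)%Z).
  (* The new boundary terms are at most K 2^k / 2^N each, and the bound grows
     by 4 K 2^k / 2^N from k to k + 1. *)
  assert (A1 : zpow (1 / 2) (Z.of_nat k - (- Z.of_nat N - 1))%Z <= (1 / 2) ^ N).
  { unfold zpow.
    replace (Z.abs_nat (Z.of_nat k - (- Z.of_nat N - 1))) with (N + (k + 1))%nat by lia.
    rewrite pow_add.
    assert ((1 / 2) ^ (k + 1) <= 1 ^ (k + 1)) by (apply pow_incr; lra).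
    rewrite pow1 in *; nra. }
  assert (B1 : zpow (1 / 2) (Z.of_nat k - Z.of_nat N)%Z <= 2 ^ k * (1 / 2) ^ N).
  { unfold zpow; set (j := Z.abs_nat _).
    assert (Ej : exists i, (N + i = k + j)%nat) by (exists (k + j - N)%nat; unfold j; lia).
    destruct Ej as [i Ei].
    assert (Q : 2 ^ k * (1 / 2) ^ k = 1).
    { rewrite <- Rpow_mult_distr; replace (2 * (1 / 2)) with 1 by field; apply pow1. }
    assert (Q' : (1 / 2) ^ N * (1 / 2) ^ i = (1 / 2) ^ k * (1 / 2) ^ j).
    { rewrite <- !pow_add, Ei; reflexivity. }
    assert (I1 : (1 / 2) ^ i <= 1 ^ i) by (apply pow_incr; lra); rewrite pow1 in I1.
    replace ((1 / 2) ^ j) with (2 ^ k * ((1 / 2) ^ k * (1 / 2) ^ j)) by (rewrite <- Rmult_assoc, Q; ring).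
    rewrite <- Q'; apply Rmult_le_compat_l; [lra | nra]. }
  assert (A2 : K * zpow (1 / 2) (Z.of_nat k - (- Z.of_nat N - 1))%Z <= K * (2 ^ k * (1 / 2) ^ N)).
  { apply Rmult_le_compat_l; [exact HK | nra]. }
  assert (B2 : K * zpow (1 / 2) (Z.of_nat k - Z.of_nat N)%Z <= K * (2 ^ k * (1 / 2) ^ N)).
  { apply Rmult_le_compat_l; assumption. }
  simpl pow; assert (0 <= K * (2 ^ k * (1 / 2) ^ N)).
  { apply Rmult_le_pos; [exact HK | apply Rmult_le_pos; lra]. }
  lra.
Qed.

Lemma zsum_kernel (ker : Z -> C) (K : R) (N : nat) (m : Z) :
  0 <= K -> (forall d, Cmod (ker d) <= K * zpow (1 / 2) d) ->
  Cmod (zsum (fun n => ker (m - n)%Z) N - zsum ker N) <= 4 * K * zpow 2 m * (1 / 2) ^ N.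
Proof.
intros HK Hk; destruct (Z.le_ge_cases 0 m) as [Hm | Hm].
- rewrite <- (Z2Nat.id m) by exact Hm.
  rewrite zpow_of_nat; apply zsum_kernel_nat; assumption.
- rewrite <- (zsum_neg ker), <- (zsum_neg (fun n => ker (m - n)%Z)).
  set (k := Z.to_nat (- m)).
  rewrite (zsum_ext _ (fun n => (fun d => ker (- d)%Z) (Z.of_nat k - n)%Z))
    by (intros n; f_equal; unfold k; lia).
  unfold zpow; replace (Z.abs_nat m) with k by (unfold k; lia).
  apply (zsum_kernel_nat (fun d => ker (- d)%Z)); [exact HK|]; intros d.
  eapply Rle_trans; [apply Hk|]; rewrite zpow_opp; lra.
Qed.

(** The factor 2^|m| lost in zsum_kernel is absorbed by the faster decay
    8^(-|m|) of g. *)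
Lemma zsum_convolution_error (g ker : Z -> C) (M K : R) (N : nat) :
  0 <= K -> 0 <= M -> (forall d, Cmod (ker d) <= K * zpow (1 / 2) d) ->
  (forall n, Cmod (g n) <= M * zpow (1 / 8) n) ->
  Cmod (zsum (fun m => g m * zsum (fun n => ker (m - n)%Z) N)%C N - zsum ker N * zsum g N)
  <= 12 * K * M * (1 / 2) ^ N.
Proof.
intros HK HM Hk Hg.
rewrite <- zsum_scal, <- zsum_minus.
assert (PN : 0 <= (1 / 2) ^ N) by (apply pow_le; lra).
replace (12 * K * M * (1 / 2) ^ N) with (3 * (4 * K * M * (1 / 2) ^ N)) by ring.
apply Cmod_zsum_le.
{ repeat apply Rmult_le_pos; lra. }
intros m.
replace (_ - _)%C with (g m * (zsum (fun n => ker (m - n)%Z) N - zsum ker N))%C by ring.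
rewrite Cmod_mult.
assert (A := zsum_kernel ker K N m HK Hk).
apply Rle_trans with ((M * zpow (1 / 8) m) * (4 * K * zpow 2 m * (1 / 2) ^ N)).
{ apply Rmult_le_compat; try apply Cmod_ge_0; [apply Hg | exact A]. }
replace (M * zpow (1 / 8) m * (4 * K * zpow 2 m * (1 / 2) ^ N))
  with (4 * K * M * (1 / 2) ^ N * (zpow (1 / 8) m * zpow 2 m)) by ring.
apply Rmult_le_compat_l; [repeat apply Rmult_le_pos; lra|].
unfold zpow; rewrite <- Rpow_mult_distr; apply pow_incr; lra.
Qed.

(** * Partial fractions for products of hyperbolic secants *)

Definition Csech (w : C) : C := (2 / (Cexp w + / Cexp w))%C.
Definition Ctanh (w : C) : C := ((Cexp w - / Cexp w) / (Cexp w + / Cexp w))%C.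

Definition translate (z : C) (n : Z) : C := (z - RtoC (PI * IZR n))%C.

(** The point z is not a pole of the lattice sum, and the terms decay
    geometrically. The rate 1/8 leaves room for the factor 2^|m| of the
    kernel estimates. *)
Definition sech_summable (z : C) (M : R) : Prop :=
  forall n, (Cexp (translate z n) + / Cexp (translate z n))%C <> RtoC 0 /\
            Cmod (Csech (translate z n)) <= M * zpow (1 / 8) n.

(** The kernels take the value 0 at 0, as the inverse of 0 is 0; so the diagonal of
    the double sums contributes nothing through them. *)
Definition csch_ker (d : Z) : C := RtoC (/ sinh (PI * IZR d)).
Definition csch2_ker (d : Z) : C := RtoC (/ sinh (PI * IZR d) ^ 2).
Definition coth_csch_ker (d : Z) : C := RtoC (cosh (PI * IZR d) / sinh (PI * IZR d) ^ 2).

Lemma exp_IZR_abs (d : Z) : exp (PI * IZR (Z.abs d)) = exp PI ^ Z.abs_nat d.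
Proof.
rewrite <- Rpower_pow by apply exp_pos; unfold Rpower; rewrite ln_exp; f_equal.
rewrite INR_IZR_INZ, Rmult_comm; do 2 f_equal; lia.
Qed.

Lemma inv_exp_abs_le (d : Z) : / exp (PI * IZR (Z.abs d)) <= zpow (1 / 16) d.
Proof.
rewrite exp_IZR_abs; unfold zpow.
replace (1 / 16) with (/ 16) by field; rewrite pow_inv.
apply Rinv_le_contravar; [apply pow_lt; lra | apply pow_incr].
assert (H := exp_PI_ge_16); lra.
Qed.

Lemma csch_bounds (d : Z) : d <> 0%Z ->
  let Y := exp (PI * IZR (Z.abs d)) in
  16 <= Y /\ Y / 4 <= Rabs (sinh (PI * IZR d)) /\ cosh (PI * IZR d) <= Y.
Proof.
intros Hd Y.
assert (HY : 16 <= Y).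
{ unfold Y; rewrite exp_IZR_abs.
  assert (E := exp_PI_ge_16).
  replace (Z.abs_nat d) with (S (Z.abs_nat d - 1)) by lia.
  simpl; assert (P := pow_R1_Rle (exp PI) (Z.abs_nat d - 1) ltac:(lra)); nra. }
assert (IY : / Y <= 1 / 16).
{ replace (1 / 16) with (/ 16) by field; apply Rinv_le_contravar; lra. }
assert (IY0 : 0 < / Y) by (apply Rinv_0_lt_compat; lra).
split; [exact HY|].
destruct (Z.le_ge_cases 0 d) as [H | H].
- assert (EY : exp (PI * IZR d) = Y) by (unfold Y; rewrite Z.abs_eq by exact H; reflexivity).
  unfold sinh, cosh; rewrite exp_Ropp, EY; rewrite Rabs_pos_eq by lra; lra.
- assert (EY : exp (- (PI * IZR d)) = Y).
  { unfold Y; rewrite Z.abs_neq, opp_IZR by exact H; f_equal; ring. }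
  assert (EY' : exp (PI * IZR d) = / Y).
  { rewrite <- EY, exp_Ropp, Rinv_inv; reflexivity. }
  unfold sinh, cosh; rewrite EY, EY'; rewrite Rabs_left by lra; lra.
Qed.

Lemma ker_zpow_bound (y : R) (d : Z) :
  y <= 16 / exp (PI * IZR (Z.abs d)) -> y <= 16 * zpow (1 / 2) d.
Proof.
intros H; eapply Rle_trans; [exact H|].
apply Rmult_le_compat_l; [lra|].
eapply Rle_trans; [apply inv_exp_abs_le|]; apply zpow_le; lra.
Qed.

Lemma ker_bound_nonneg (d : Z) : 0 <= 16 * zpow (1 / 2) d.
Proof. apply Rmult_le_pos; [lra | apply zpow_nonneg; lra]. Qed.

Lemma csch_ker_bound (d : Z) : Cmod (csch_ker d) <= 16 * zpow (1 / 2) d.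
Proof.
unfold csch_ker; rewrite Cmod_R.
destruct (Z.eq_dec d 0) as [-> | Hd].
{ rewrite Rmult_0_r, sinh_0, Rinv_0, Rabs_R0; apply ker_bound_nonneg. }
destruct (csch_bounds d Hd) as [H1 [H2 _]]; apply ker_zpow_bound.
set (Y := exp _) in *; rewrite Rabs_inv.
apply Rle_trans with (/ (Y / 4)).
- apply Rinv_le_contravar; lra.
- replace (/ (Y / 4)) with (4 * / Y) by (field; lra).
  apply Rmult_le_compat_r; [apply Rlt_le, Rinv_0_lt_compat|]; lra.
Qed.

Lemma inv_sinh_sq_bounds (d : Z) : d <> 0%Z ->
  let Y := exp (PI * IZR (Z.abs d)) in
  0 < / sinh (PI * IZR d) ^ 2 <= 16 / Y ^ 2.
Proof.
intros Hd Y; destruct (csch_bounds d Hd) as [H1 [H2 _]]; fold Y in H1, H2.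
rewrite <- pow2_abs.
assert (P : (Y / 4) ^ 2 <= Rabs (sinh (PI * IZR d)) ^ 2) by (apply pow_incr; lra).
assert (P0 : 0 < (Y / 4) ^ 2) by (apply pow_lt; lra).
split; [apply Rinv_0_lt_compat; lra|].
replace (16 / Y ^ 2) with (/ (Y / 4) ^ 2) by (field; lra).
apply Rinv_le_contravar; assumption.
Qed.

Lemma csch2_ker_bound (d : Z) : Cmod (csch2_ker d) <= 16 * zpow (1 / 2) d.
Proof.
unfold csch2_ker; rewrite Cmod_R.
destruct (Z.eq_dec d 0) as [-> | Hd].
{ rewrite Rmult_0_r, sinh_0, pow_i, Rinv_0, Rabs_R0 by lia; apply ker_bound_nonneg. }
destruct (csch_bounds d Hd) as [H1 _]; destruct (inv_sinh_sq_bounds d Hd) as [A B].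
rewrite Rabs_pos_eq by lra; apply ker_zpow_bound.
set (Y := exp _) in *; eapply Rle_trans; [exact B|].
apply Rmult_le_compat_l; [lra|]; apply Rinv_le_contravar; [lra | nra].
Qed.

Lemma coth_csch_ker_bound (d : Z) : Cmod (coth_csch_ker d) <= 16 * zpow (1 / 2) d.
Proof.
unfold coth_csch_ker; rewrite Cmod_R.
destruct (Z.eq_dec d 0) as [-> | Hd].
{ rewrite Rmult_0_r, sinh_0, pow_i by lia; unfold Rdiv; rewrite Rinv_0, Rmult_0_r, Rabs_R0.
  apply ker_bound_nonneg. }
destruct (csch_bounds d Hd) as [H1 [_ H3]]; destruct (inv_sinh_sq_bounds d Hd) as [A B].
assert (CP : 0 < cosh (PI * IZR d)).
{ unfold cosh; assert (P := exp_pos (PI * IZR d)); assert (P' := exp_pos (- (PI * IZR d))); lra. }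
unfold Rdiv; rewrite Rabs_pos_eq by (apply Rmult_le_pos; lra).
apply ker_zpow_bound.
set (Y := exp _) in *.
apply Rle_trans with (Y * (16 / Y ^ 2)).
- apply Rmult_le_compat; lra.
- right; field; lra.
Qed.

Lemma csch_ker_opp (d : Z) : csch_ker (- d) = (- csch_ker d)%C.
Proof.
unfold csch_ker; rewrite opp_IZR, <- RtoC_opp, <- Rinv_opp; do 2 f_equal.
unfold sinh; replace (PI * - IZR d) with (- (PI * IZR d)) by ring; rewrite Ropp_involutive; field.
Qed.

Lemma csch2_ker_opp (d : Z) : csch2_ker (- d) = csch2_ker d.
Proof.
unfold csch2_ker; do 2 f_equal; rewrite opp_IZR.
unfold sinh; replace (PI * - IZR d) with (- (PI * IZR d)) by ring; rewrite Ropp_involutive; field.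
Qed.

Lemma ker_as_exp (d : Z) : d <> 0%Z ->
  let E := RtoC (exp (PI * IZR d)) in
  E <> RtoC 0 /\ (E * E - 1)%C <> RtoC 0 /\
  csch_ker d = (2 / (E - / E))%C /\
  csch2_ker d = (2 / (E - / E) * (2 / (E - / E)))%C /\
  coth_csch_ker d = ((E + / E) / 2 * (2 / (E - / E) * (2 / (E - / E))))%C.
Proof.
intros Hd E.
set (x := PI * IZR d).
assert (Hx : x <> 0).
{ unfold x; apply Rmult_integral_contrapositive; split;
    [generalize PI_RGT_0; lra | apply not_0_IZR, Hd]. }
assert (P := exp_pos x).
assert (N1 : exp x * exp x - 1 <> 0).
{ rewrite <- exp_plus; intros H.
  assert (H' : exp (x + x) = exp 0) by (rewrite exp_0; lra).
  apply exp_inv in H'; lra. }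
assert (E0 : E <> RtoC 0) by (intros H; apply RtoC_inj in H; fold x in H; lra).
assert (E1 : (E * E - 1)%C <> RtoC 0).
{ unfold E; rewrite <- RtoC_mult, <- RtoC_minus; intros H; apply RtoC_inj in H; auto. }
assert (S : sinh x = (exp x - / exp x) / 2) by (unfold sinh; rewrite exp_Ropp; reflexivity).
assert (S0 : sinh x <> 0).
{ rewrite S; replace ((exp x - / exp x) / 2) with ((exp x * exp x - 1) * / (2 * exp x)) by (field; lra).
  apply Rmult_integral_contrapositive; split; [exact N1 | apply Rinv_neq_0_compat; lra]. }
assert (K1 : csch_ker d = (2 / (E - / E))%C).
{ unfold csch_ker; fold x; rewrite RtoC_inv by exact S0.
  rewrite S, RtoC_div, RtoC_minus, RtoC_inv by lra; fold x in E; fold E.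
  field; split; assumption. }
assert (K2 : csch2_ker d = (csch_ker d * csch_ker d)%C).
{ unfold csch_ker, csch2_ker; rewrite <- RtoC_mult; f_equal; fold x; field; exact S0. }
assert (K3 : coth_csch_ker d = ((E + / E) / 2 * (csch_ker d * csch_ker d))%C).
{ rewrite <- K2; unfold coth_csch_ker, csch2_ker; fold x; unfold Rdiv.
  rewrite RtoC_mult; f_equal.
  unfold cosh; rewrite exp_Ropp, RtoC_div, RtoC_plus, RtoC_inv by lra; reflexivity. }
rewrite K3, K2, K1; repeat split; trivial.
Qed.

Lemma Cexp_translate (z : C) (m n : Z) :
  Cexp (translate z n) = (Cexp (translate z m) * RtoC (exp (PI * IZR (m - n))))%C.
Proof.
rewrite <- Cexp_RtoC, <- Cexp_plus; f_equal; unfold translate.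
rewrite minus_IZR, Rmult_minus_distr_l, RtoC_minus; ring.
Qed.

Lemma plus_inv_neq_0 (X : C) : X <> RtoC 0 -> (X + / X)%C <> RtoC 0 -> (X * X + 1)%C <> RtoC 0.
Proof.
intros H0 H1 H; apply H1.
replace (X + / X)%C with ((X * X + 1) / X)%C by (field; exact H0).
rewrite H; unfold Cdiv; ring.
Qed.

(** The addition formula for sinh (u - v), divided by cosh u cosh v. *)
Lemma sech_sech (z : C) (M : R) (m n : Z) : sech_summable z M -> m <> n ->
  (Csech (translate z n) * Csech (translate z m)
   = (Ctanh (translate z n) - Ctanh (translate z m)) * csch_ker (m - n))%C.
Proof.
intros Hz Hmn.
destruct (ker_as_exp (m - n) ltac:(lia)) as [E0 [E1 [-> _]]].
destruct (Hz m) as [Hm _]; destruct (Hz n) as [Hn _].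
unfold Csech, Ctanh; rewrite (Cexp_translate z m n) in *.
set (Y := Cexp (translate z m)) in *; set (E := RtoC _) in *.
assert (Y0 : Y <> RtoC 0) by apply Cexp_neq_0.
apply plus_inv_neq_0 in Hm; [|exact Y0].
apply plus_inv_neq_0 in Hn; [|apply Cmult_neq_0; assumption].
field; repeat split; assumption.
Qed.

(** The partial fraction of sech u sech^2 v, which has a simple pole in u and a
    double pole in v: its coefficients are functions of u - v alone. *)
Lemma sech_sech2 (z : C) (M : R) (m n : Z) : sech_summable z M -> m <> n ->
  (Csech (translate z n) * Csech (translate z m) ^ 2
   = Csech (translate z m) * coth_csch_ker (m - n) - Csech (translate z n) * csch2_ker (m - n)
     - Csech (translate z m) * Ctanh (translate z m) * csch_ker (m - n))%C.
Proof.
intros Hz Hmn.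
destruct (ker_as_exp (m - n) ltac:(lia)) as [E0 [E1 [-> [-> ->]]]].
destruct (Hz m) as [Hm _]; destruct (Hz n) as [Hn _].
unfold Csech, Ctanh; rewrite (Cexp_translate z m n) in *.
set (Y := Cexp (translate z m)) in *; set (E := RtoC _) in *.
assert (Y0 : Y <> RtoC 0) by apply Cexp_neq_0.
apply plus_inv_neq_0 in Hm; [|exact Y0].
apply plus_inv_neq_0 in Hn; [|apply Cmult_neq_0; assumption].
field; repeat split; assumption.
Qed.

(** * The differential equation of the sum of translated secants *)

Definition ker_sum (ker : Z -> C) (N : nat) (m : Z) : C := zsum (fun n => ker (m - n)%Z) N.

Lemma csch_ker_0 : csch_ker 0 = RtoC 0.
Proof. unfold csch_ker; rewrite Rmult_0_r, sinh_0, Rinv_0; reflexivity. Qed.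

Lemma csch2_ker_0 : csch2_ker 0 = RtoC 0.
Proof. unfold csch2_ker; rewrite Rmult_0_r, sinh_0, pow_i, Rinv_0 by lia; reflexivity. Qed.

Lemma coth_csch_ker_0 : coth_csch_ker 0 = RtoC 0.
Proof.
unfold coth_csch_ker, Rdiv; rewrite Rmult_0_r, sinh_0, pow_i, Rinv_0, Rmult_0_r by lia.
reflexivity.
Qed.

Lemma zsum_mult_zsum (f g : Z -> C) (N : nat) :
  (zsum f N * zsum g N)%C = zsum (fun m => zsum (fun n => f n * g m)%C N) N.
Proof.
rewrite <- zsum_scal; apply zsum_ext; intros m.
rewrite (zsum_ext (fun n => f n * g m)%C (fun n => g m * f n)%C) by (intros; ring).
rewrite zsum_scal; ring.
Qed.

Lemma zsum_diagonal (f : Z -> C) (N : nat) :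
  zsum (fun m => zsum (fun n => if Z.eqb n m then f m else RtoC 0) N) N = zsum f N.
Proof.
apply zsum_ext_range; intros m Hm; rewrite zsum_single.
apply Z.leb_le in Hm; rewrite Hm; reflexivity.
Qed.

(** For an odd or even kernel, a factor in the first variable can be moved to
    the second at the cost of a sign. *)
Lemma zsum_left_kernel (f ker : Z -> C) (s : C) (N : nat) :
  (forall d, ker (- d)%Z = s * ker d)%C ->
  zsum (fun m => zsum (fun n => f n * ker (m - n)%Z)%C N) N
  = zsum (fun m => s * (f m * ker_sum ker N m))%C N.
Proof.
intros Hs; rewrite zsum_swap; apply zsum_ext; intros n.
unfold ker_sum; rewrite zsum_scal.
rewrite (zsum_ext (fun m => ker (m - n)%Z) (fun m => s * ker (n - m)%Z)%C).
- rewrite zsum_scal; ring.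
- intros m; rewrite <- Hs; f_equal; lia.
Qed.

(** Sum sech_sech over all pairs of distinct indices; the diagonal gives the
    squares. *)
Lemma zsum_sech_squared (z : C) (M : R) (N : nat) : sech_summable z M ->
  (zsum (fun n => Csech (translate z n)) N ^ 2
   = zsum (fun n => Csech (translate z n) ^ 2) N
     - 2 * zsum (fun m => Ctanh (translate z m) * ker_sum csch_ker N m) N)%C.
Proof.
intros Hz.
set (S := fun n => Csech (translate z n)); set (T := fun n => Ctanh (translate z n)).
replace (zsum S N ^ 2)%C with (zsum S N * zsum S N)%C by ring.
rewrite zsum_mult_zsum.
transitivity (zsum (fun m => zsum (fun n => T n * csch_ker (m - n))%C N
   + (- (1)) * (T m * ker_sum csch_ker N m)
   + zsum (fun n => if Z.eqb n m then S m ^ 2 else RtoC 0) N)%C N).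
- apply zsum_ext; intros m.
  unfold ker_sum; rewrite <- !zsum_scal, <- !zsum_plus.
  apply zsum_ext; intros n; destruct (Z.eqb_spec n m) as [-> | H].
  + rewrite Z.sub_diag, csch_ker_0; ring.
  + unfold S, T; rewrite (sech_sech z M m n) by auto; ring.
- rewrite !zsum_plus, zsum_diagonal.
  rewrite (zsum_left_kernel T csch_ker (- (1)))
    by (intros d; rewrite csch_ker_opp; ring).
  rewrite !zsum_scal; unfold S, T; ring.
Qed.

Lemma zsum_sech_sech2 (z : C) (M : R) (N : nat) : sech_summable z M ->
  (zsum (fun n => Csech (translate z n)) N * zsum (fun n => Csech (translate z n) ^ 2) N
   = zsum (fun n => Csech (translate z n) ^ 3) N
     + zsum (fun m => Csech (translate z m) * ker_sum coth_csch_ker N m) N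
     - zsum (fun m => Csech (translate z m) * ker_sum csch2_ker N m) N
     - zsum (fun m => Csech (translate z m) * Ctanh (translate z m) * ker_sum csch_ker N m) N)%C.
Proof.
intros Hz.
set (S := fun n => Csech (translate z n)); set (T := fun n => Ctanh (translate z n)).
rewrite (zsum_mult_zsum S).
transitivity (zsum (fun m =>
     zsum (fun n => if Z.eqb n m then S m ^ 3 else RtoC 0) N
   + S m * ker_sum coth_csch_ker N m
   + (- (1)) * zsum (fun n => S n * csch2_ker (m - n))%C N
   + (- (1)) * (S m * T m * ker_sum csch_ker N m))%C N).
- apply zsum_ext; intros m.
  unfold ker_sum; rewrite <- !zsum_scal, <- !zsum_plus.
  apply zsum_ext; intros n; destruct (Z.eqb_spec n m) as [-> | H].
  + rewrite Z.sub_diag, csch_ker_0, csch2_ker_0, coth_csch_ker_0; unfold S; ring.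
  + unfold S, T; rewrite (sech_sech2 z M m n) by auto; ring.
- rewrite !zsum_plus, zsum_diagonal, !zsum_scal.
  rewrite (zsum_left_kernel S csch2_ker 1)
    by (intros d; rewrite csch2_ker_opp; ring).
  rewrite (zsum_ext (fun m => 1 * (S m * ker_sum csch2_ker N m))%C
             (fun m => S m * ker_sum csch2_ker N m)%C) by (intros; ring).
  unfold S, T; ring.
Qed.

Lemma zsum_convolution_Clim (g ker : Z -> C) (M K : R) (k l : C) :
  0 <= K -> 0 <= M -> (forall d, Cmod (ker d) <= K * zpow (1 / 2) d) ->
  (forall n, Cmod (g n) <= M * zpow (1 / 8) n) ->
  Clim (zsum ker) k -> Clim (zsum g) l ->
  Clim (fun N => zsum (fun m => g m * ker_sum ker N m)%C N) (k * l)%C.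
Proof.
intros HK HM Hk Hg Lk Lg.
apply Clim_ext with (u := fun N =>
  ((zsum (fun m => g m * ker_sum ker N m)%C N - zsum ker N * zsum g N) + zsum ker N * zsum g N)%C).
{ intros N; ring. }
replace (k * l)%C with (0 + k * l)%C by ring.
apply Clim_plus; [|apply Clim_mult; assumption].
apply Clim_squeeze with (e := fun N => 12 * K * M * (1 / 2) ^ N); [|apply is_lim_seq_geom_scal].
intros N; replace (_ - 0)%C with
  (zsum (fun m => g m * ker_sum ker N m)%C N - zsum ker N * zsum g N)%C by ring.
apply zsum_convolution_error; assumption.
Qed.

Lemma csch_ker_Clim : Clim (zsum csch_ker) 0.
Proof.
apply Clim_ext with (u := fun _ => RtoC 0); [|apply Clim_const].
intros N; assert (E := zsum_neg csch_ker N).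
rewrite (zsum_ext _ (fun n => (-(1)) * csch_ker n)%C) in E
  by (intros; rewrite csch_ker_opp; ring).
rewrite zsum_scal in E.
transitivity (1 / 2 * (zsum csch_ker N + - (1) * zsum csch_ker N))%C; [ring|].
rewrite E; field.
Qed.

Lemma sech_summable_ge_0 (z : C) (M : R) : sech_summable z M -> 0 <= M.
Proof.
intros H; destruct (H 0%Z) as [_ B].
unfold zpow in B; simpl in B; rewrite Rmult_1_r in B.
eapply Rle_trans; [apply Cmod_ge_0 | exact B].
Qed.

Lemma zpow_eighth_le (M : R) (n : Z) : 0 <= M -> M * zpow (1 / 8) n <= M * zpow (1 / 2) n.
Proof. intros HM; apply Rmult_le_compat_l; [exact HM | apply zpow_le; lra]. Qed.

Lemma zpow_le_1 (r : R) (n : Z) : 0 <= r <= 1 -> zpow r n <= 1.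
Proof.
intros H; unfold zpow; rewrite <- (pow1 (Z.abs_nat n)); apply pow_incr, H.
Qed.

Lemma Csech_bounded (z : C) (M : R) (n : Z) : sech_summable z M -> Cmod (Csech (translate z n)) <= M.
Proof.
intros H; assert (HM := sech_summable_ge_0 z M H); destruct (H n) as [_ B].
assert (zpow (1 / 8) n <= 1) by (apply zpow_le_1; lra); nra.
Qed.

Lemma Csech_pow_bound (z : C) (M : R) (k : nat) (n : Z) : sech_summable z M ->
  Cmod (Csech (translate z n) ^ S k) <= M ^ S k * zpow (1 / 8) n.
Proof.
intros H; assert (HM := sech_summable_ge_0 z M H).
assert (B := proj2 (H n)); assert (B' := Csech_bounded z M n H).
rewrite Cmod_pow; simpl.
assert (P : Cmod (Csech (translate z n)) ^ k <= M ^ k) by (apply pow_incr; split; [apply Cmod_ge_0 | exact B']).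
assert (P0 : 0 <= Cmod (Csech (translate z n)) ^ k) by apply pow_le, Cmod_ge_0.
assert (S0 := Cmod_ge_0 (Csech (translate z n))).
replace (M * M ^ k * zpow (1 / 8) n) with ((M * zpow (1 / 8) n) * M ^ k) by ring.
apply Rmult_le_compat; assumption.
Qed.

Lemma Ctanh_sq (w : C) : (Cexp w + / Cexp w)%C <> RtoC 0 ->
  (Ctanh w * Ctanh w = 1 - Csech w * Csech w)%C.
Proof.
intros H; unfold Ctanh, Csech; assert (X0 := Cexp_neq_0 w).
apply plus_inv_neq_0 in H; [|exact X0].
field; split; assumption.
Qed.

Lemma Ctanh_bounded (z : C) (M : R) (n : Z) : sech_summable z M ->
  Cmod (Ctanh (translate z n)) <= 1 + M.
Proof.
intros H; assert (HM := sech_summable_ge_0 z M H).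
assert (E := Ctanh_sq (translate z n) (proj1 (H n))).
assert (B := Csech_bounded z M n H); assert (B0 := Cmod_ge_0 (Csech (translate z n))).
assert (T := Cmod_triangle 1 (- (Csech (translate z n) * Csech (translate z n)))).
rewrite Cmod_opp, Cmod_1 in T.
assert (E' : Cmod (Ctanh (translate z n)) * Cmod (Ctanh (translate z n))
             <= 1 + Cmod (Csech (translate z n)) * Cmod (Csech (translate z n))).
{ rewrite <- !Cmod_mult, E; exact T. }
apply Rnot_lt_le; intros C; nra.
Qed.

(** The terms tanh do not tend to 0, but their differences between two points
    decay like sech^2; this makes independence of z provable although the
    constant itself is not computed. *)
Lemma Ctanh_minus (z z' : C) (M M' : R) (n : Z) :
  sech_summable z M -> sech_summable z' M' ->
  (Ctanh (translate z n) - Ctanh (translate z' n)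
   = (Cexp (z - z') - / Cexp (z - z')) / 2 * (Csech (translate z n) * Csech (translate z' n)))%C.
Proof.
intros H H'.
destruct (H n) as [N1 _]; destruct (H' n) as [N2 _].
assert (E : Cexp (translate z n) = (Cexp (translate z' n) * Cexp (z - z'))%C).
{ rewrite <- Cexp_plus; f_equal; unfold translate; ring. }
unfold Ctanh, Csech; rewrite E in *.
set (Y := Cexp (translate z' n)) in *; set (X := Cexp (z - z')) in *.
assert (Y0 : Y <> RtoC 0) by apply Cexp_neq_0.
assert (X0 : X <> RtoC 0) by apply Cexp_neq_0.
apply plus_inv_neq_0 in N1; [|apply Cmult_neq_0; assumption].
apply plus_inv_neq_0 in N2; [|exact Y0].
field; repeat split; assumption.
Qed.

(** The error terms at z and z' differ by a convolution of a summable sequence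
    with the odd kernel csch, whose total sum is 0. *)
Lemma sech_sum_square_minus (z z' D D' P P' : C) (M M' : R) :
  sech_summable z M -> sech_summable z' M' ->
  Clim (zsum (fun n => Csech (translate z n))) D ->
  Clim (zsum (fun n => Csech (translate z' n))) D' ->
  Clim (zsum (fun n => Csech (translate z n) ^ 2)%C) P ->
  Clim (zsum (fun n => Csech (translate z' n) ^ 2)%C) P' ->
  (D ^ 2 - P = D' ^ 2 - P')%C.
Proof.
intros H H' HD HD' HP HP'.
set (s := ((Cexp (z - z') - / Cexp (z - z')) / 2)%C).
set (g := fun n => (s * (Csech (translate z n) * Csech (translate z' n)))%C).
assert (HM := sech_summable_ge_0 z M H); assert (HM' := sech_summable_ge_0 z' M' H').
assert (Hs := Cmod_ge_0 s).
assert (Hg : forall n, Cmod (g n) <= (Cmod s * (M * M')) * zpow (1 / 8) n).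
{ intros n; unfold g; rewrite !Cmod_mult, Rmult_assoc; apply Rmult_le_compat_l; [exact Hs|].
  replace (M * M' * zpow (1 / 8) n) with ((M * zpow (1 / 8) n) * M') by ring.
  apply Rmult_le_compat; try apply Cmod_ge_0; [apply H | apply (Csech_bounded z' M' n H')]. }
assert (HG0 : 0 <= Cmod s * (M * M')) by (repeat apply Rmult_le_pos; assumption).
destruct (zsum_Clim g (Cmod s * (M * M'))) as [l Hl].
{ intros n; eapply Rle_trans; [apply Hg | apply zpow_eighth_le, HG0]. }
assert (L := zsum_convolution_Clim g csch_ker _ 16 0 l ltac:(lra) HG0
               csch_ker_bound Hg csch_ker_Clim Hl).
(* The finite identities of zsum_sech_squared at z and z', subtracted. *)
assert (K : ((D * D - P) - (D' * D' - P') = - (2) * (0 * l))%C).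
{ apply (Clim_unique (fun N =>
    ((zsum (fun n => Csech (translate z n)) N * zsum (fun n => Csech (translate z n)) N
      - zsum (fun n => Csech (translate z n) ^ 2)%C N)
     - (zsum (fun n => Csech (translate z' n)) N * zsum (fun n => Csech (translate z' n)) N
      - zsum (fun n => Csech (translate z' n) ^ 2)%C N))%C)).
  - repeat (apply Clim_minus || apply Clim_mult); assumption.
  - eapply Clim_ext; [|apply Clim_scal, L]; intros N; cbv beta.
    assert (E1 := zsum_sech_squared z M N H); assert (E2 := zsum_sech_squared z' M' N H').
    set (A := zsum (fun n => Csech (translate z n)) N) in *.
    set (B := zsum (fun n => Csech (translate z' n)) N) in *.
    replace (A * A)%C with (A ^ 2)%C by ring; replace (B * B)%C with (B ^ 2)%C by ring.
    rewrite E1, E2.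
    rewrite (zsum_ext (fun m => g m * ker_sum csch_ker N m)%C
      (fun m => Ctanh (translate z m) * ker_sum csch_ker N m
                - Ctanh (translate z' m) * ker_sum csch_ker N m)%C).
    + rewrite zsum_minus; ring.
    + intros m; unfold g, s; rewrite <- (Ctanh_minus z z' M M' m H H'); ring. }
replace (D ^ 2 - P)%C with ((D * D - P) - (D' * D' - P') + (D' ^ 2 - P'))%C by ring.
rewrite K; ring.
Qed.

(** Here Q is the sum of the sech^3, so that D - 2 Q is the sum of the second
    derivatives sech - 2 sech^3. The constant is
    1 + 2 (A - B) + 2 (D0^2 - P0): A - B comes from the product of D by the sum
    P of the sech^2, and D0^2 - P0 from D^2 - P. *)
Lemma lattice_sech_ode (z0 : C) (M0 : R) : sech_summable z0 M0 ->
  exists c : C, forall (z D Q : C) (M : R), sech_summable z M ->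
  Clim (zsum (fun n => Csech (translate z n))) D ->
  Clim (zsum (fun n => Csech (translate z n) ^ 3)%C) Q ->
  (D - 2 * Q = c * D - 2 * D ^ 3)%C.
Proof.
intros H0.
assert (Sq : forall z M, sech_summable z M -> forall k, exists P,
         Clim (zsum (fun n => Csech (translate z n) ^ S k)%C) P).
{ intros z M H k; apply (zsum_Clim _ (M ^ S k)); intros n.
  eapply Rle_trans; [apply (Csech_pow_bound z M k n H) | apply zpow_eighth_le].
  apply pow_le, (sech_summable_ge_0 z M H). }
destruct (zsum_Clim coth_csch_ker 16 coth_csch_ker_bound) as [A HA].
destruct (zsum_Clim csch2_ker 16 csch2_ker_bound) as [B HB].
destruct (Sq z0 M0 H0 0%nat) as [D0 HD0]; destruct (Sq z0 M0 H0 1%nat) as [P0 HP0].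
assert (HD0' : Clim (zsum (fun n => Csech (translate z0 n))) D0).
{ eapply Clim_ext; [|exact HD0]; intros N; apply zsum_ext; intros n; ring. }
exists (1 + 2 * (A - B) + 2 * (D0 ^ 2 - P0))%C.
intros z D Q M H HD HQ.
assert (HM := sech_summable_ge_0 z M H).
destruct (Sq z M H 1%nat) as [P HP].
assert (EP := sech_sum_square_minus z z0 D D0 P P0 M M0 H H0 HD HD0' HP HP0).
assert (HS : forall n, Cmod (Csech (translate z n)) <= M * zpow (1 / 8) n) by (intros n; apply H).
assert (L1 := zsum_convolution_Clim _ _ M 16 A D ltac:(lra) HM coth_csch_ker_bound HS HA HD).
assert (L2 := zsum_convolution_Clim _ _ M 16 B D ltac:(lra) HM csch2_ker_bound HS HB HD).
set (g := fun n => (Csech (translate z n) * Ctanh (translate z n))%C).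
assert (HG0 : 0 <= M * (1 + M)) by nra.
assert (Hg : forall n, Cmod (g n) <= (M * (1 + M)) * zpow (1 / 8) n).
{ intros n; unfold g; rewrite Cmod_mult.
  replace (M * (1 + M) * zpow (1 / 8) n) with ((M * zpow (1 / 8) n) * (1 + M)) by ring.
  apply Rmult_le_compat; try apply Cmod_ge_0; [apply H | apply (Ctanh_bounded z M n H)]. }
destruct (zsum_Clim g (M * (1 + M))) as [l Hl].
{ intros n; eapply Rle_trans; [apply Hg | apply zpow_eighth_le, HG0]. }
assert (L3 := zsum_convolution_Clim g csch_ker _ 16 0 l ltac:(lra) HG0
               csch_ker_bound Hg csch_ker_Clim Hl).
assert (E : (D * P = Q + A * D - B * D - 0 * l)%C).
{ apply (Clim_unique (fun N => zsum (fun n => Csech (translate z n)) N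
           * zsum (fun n => Csech (translate z n) ^ 2)%C N)%C).
  - apply Clim_mult; assumption.
  - eapply Clim_ext; [intros N; symmetry; apply (zsum_sech_sech2 z M N H)|].
    apply Clim_minus; [|exact L3]; apply Clim_minus; [|exact L2].
    apply Clim_plus; assumption. }
replace (D ^ 3)%C with (D * (D ^ 2 - P) + D * P)%C by ring.
rewrite E, EP; ring.
Qed.

(** * Two-sided real series and the function dn *)

Fixpoint zsumR (f : Z -> R) (N : nat) : R :=
  match N with
  | O => f 0%Z
  | S k => zsumR f k + (f (Z.of_nat (S k)) + f (- Z.of_nat (S k))%Z)
  end.

Definition zseries (f : Z -> R) : R := real (Lim_seq (zsumR f)).

Lemma zsum_Re (f : Z -> C) (N : nat) : Re (zsum f N) = zsumR (fun n => Re (f n)) N.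
Proof.
induction N as [|N IHN]; [unfold zsum; cbn [Csum zsumR]; rewrite Cplus_0_r; reflexivity|].
rewrite zsum_S; cbn [zsumR]; rewrite <- IHN; reflexivity.
Qed.

Lemma zsumR_ext (f g : Z -> R) (N : nat) : (forall n, f n = g n) -> zsumR f N = zsumR g N.
Proof. intros H; induction N as [|N IHN]; cbn [zsumR]; [|rewrite IHN, !H]; auto. Qed.

Lemma zseries_ext (f g : Z -> R) : (forall n, f n = g n) -> zseries f = zseries g.
Proof. intros H; unfold zseries; f_equal; apply Lim_seq_ext; intros N; apply zsumR_ext, H. Qed.

Lemma zsumR_lin (a b : R) (f g : Z -> R) (N : nat) :
  zsumR (fun n => a * f n + b * g n) N = a * zsumR f N + b * zsumR g N.
Proof. induction N as [|N IHN]; cbn [zsumR]; [|rewrite IHN]; ring. Qed.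

Lemma zseries_correct (f : Z -> R) (M : R) :
  (forall n, Rabs (f n) <= M * zpow (1 / 2) n) -> is_lim_seq (zsumR f) (zseries f).
Proof.
intros Hf.
destruct (zsum_Clim (fun n => RtoC (f n)) M) as [l Hl].
{ intros n; rewrite Cmod_R; apply Hf. }
apply Clim_Re in Hl.
assert (L : is_lim_seq (zsumR f) (Re l)).
{ eapply is_lim_seq_ext; [|exact Hl]; intros N; cbv beta; rewrite zsum_Re; reflexivity. }
unfold zseries; rewrite (is_lim_seq_unique _ _ L); exact L.
Qed.

Lemma zseries_unique (f : Z -> R) (l : R) : is_lim_seq (zsumR f) l -> zseries f = l.
Proof. intros H; unfold zseries; rewrite (is_lim_seq_unique _ _ H); reflexivity. Qed.

Lemma zseries_lin (a b M M' : R) (f g : Z -> R) :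
  (forall n, Rabs (f n) <= M * zpow (1 / 2) n) ->
  (forall n, Rabs (g n) <= M' * zpow (1 / 2) n) ->
  zseries (fun n => a * f n + b * g n) = a * zseries f + b * zseries g.
Proof.
intros Hf Hg; apply zseries_unique.
eapply is_lim_seq_ext; [intros N; symmetry; apply zsumR_lin|].
apply is_lim_seq_plus'; apply is_lim_seq_mult'; try apply is_lim_seq_const;
  eapply zseries_correct; eassumption.
Qed.

Lemma zsumR_tail (f : Z -> R) (M : R) (N : nat) :
  (forall n, Rabs (f n) <= M * zpow (1 / 2) n) ->
  Rabs (zseries f - zsumR f N) <= 2 * M * (1 / 2) ^ N.
Proof.
intros Hf.
assert (HM : 0 <= M).
{ assert (H := Hf 0%Z); unfold zpow in H; simpl in H.
  assert (H' := Rabs_pos (f 0%Z)); lra. }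
assert (T : forall k, Rabs (zsumR f (k + N) - zsumR f N)
                      <= 2 * M * ((1 / 2) ^ N - (1 / 2) ^ (k + N))).
{ induction k as [|k IHk].
  - simpl plus; rewrite !Rminus_diag, Rabs_R0; lra.
  - change (S k + N)%nat with (S (k + N)); cbn [zsumR].
    set (K := (k + N)%nat) in *.
    replace (zsumR f K + (f (Z.of_nat (S K)) + f (- Z.of_nat (S K))%Z) - zsumR f N)
      with ((zsumR f K - zsumR f N)
      + (f (Z.of_nat (S K)) + f (- Z.of_nat (S K))%Z)) by ring.
    eapply Rle_trans; [apply Rabs_triang|].
    assert (B := Rabs_triang (f (Z.of_nat (S K))) (f (- Z.of_nat (S K))%Z)).
    assert (B1 := Hf (Z.of_nat (S K))); assert (B2 := Hf (- Z.of_nat (S K))%Z).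
    rewrite zpow_opp in B2; rewrite zpow_of_nat in B1, B2.
    simpl pow in *; lra. }
assert (L := zseries_correct f M Hf).
apply (is_lim_seq_incr_n _ N) in L.
assert (L' : is_lim_seq (fun k => Rabs (zsumR f (k + N) - zsumR f N)) (Rabs (zseries f - zsumR f N))).
{ apply (is_lim_seq_abs _ (Finite (zseries f - zsumR f N))).
  apply is_lim_seq_minus'; [exact L | apply is_lim_seq_const]. }
apply (is_lim_seq_le (fun k => Rabs (zsumR f (k + N) - zsumR f N))
         (fun _ => 2 * M * (1 / 2) ^ N) (Rabs (zseries f - zsumR f N)) (2 * M * (1 / 2) ^ N));
  [| exact L' | apply is_lim_seq_const].
intros k; eapply Rle_trans; [apply T|].
assert (P : 0 <= (1 / 2) ^ (k + N)) by (apply pow_le; lra); nra.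
Qed.

(** Termwise differentiation: geometric bounds uniform on a neighbourhood give
    uniform convergence of the derived series. *)
Lemma is_derive_zseries (f f' : Z -> R -> R) (c M : R) :
  (forall n y, is_derive (f n) y (f' n y)) ->
  (forall n y, continuity_pt (f' n) y) ->
  (forall n y, Rabs (y - c) < 1 -> Rabs (f n y) <= M * zpow (1 / 2) n) ->
  (forall n y, Rabs (y - c) < 1 -> Rabs (f' n y) <= M * zpow (1 / 2) n) ->
  is_derive (fun y => zseries (fun n => f n y)) c (zseries (fun n => f' n c)).
Proof.
intros Hd Hc Hf Hf'.
set (r := mkposreal 1 Rlt_0_1).
assert (U : CVU (fun N y => zsumR (fun n => f' n y) N) (fun y => zseries (fun n => f' n y)) c r).
{ intros eps Heps.
  assert (L := is_lim_seq_geom_scal (2 * M)).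
  apply is_lim_seq_spec in L; destruct (L (mkposreal eps Heps)) as [N0 HN0].
  exists N0; intros N y HN Hy.
  eapply Rle_lt_trans; [apply (zsumR_tail _ M); intros n; apply Hf', Hy|].
  specialize (HN0 N HN); rewrite Rminus_0_r in HN0.
  eapply Rle_lt_trans; [apply Rle_abs | exact HN0]. }
apply is_derive_Reals.
apply (derivable_pt_lim_CVU (fun N y => zsumR (fun n => f n y) N)
  (fun N y => zsumR (fun n => f' n y) N) _ (fun y => zseries (fun n => f' n y)) c c r).
- unfold Boule; rewrite Rminus_diag, Rabs_R0; apply Rlt_0_1.
- intros y N _; apply is_derive_Reals.
  induction N as [|N IHN]; cbn [zsumR]; [apply Hd|].
  apply (is_derive_plus (K := R_AbsRing) (V := R_NormedModule) (fun y => zsumR (fun n => f n y) N)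
     (fun y => f (Z.of_nat (S N)) y + f (- Z.of_nat (S N))%Z y)); [exact IHN|].
  apply (is_derive_plus (K := R_AbsRing) (V := R_NormedModule) (f (Z.of_nat (S N)))
     (f (- Z.of_nat (S N))%Z)); apply Hd.
- intros y Hy; apply is_lim_seq_Reals.
  apply (zseries_correct _ M); intros n; apply Hf, Hy.
- exact U.
- intros y Hy.
  apply (CVU_continuity (fun N y => zsumR (fun n => f' n y) N) _ c r U); [|exact Hy].
  intros N z _; induction N as [|N IHN]; cbn [zsumR]; [apply Hc|].
  apply (continuity_pt_plus (fun y => zsumR (fun n => f' n y) N)
     (fun y => f' (Z.of_nat (S N)) y + f' (- Z.of_nat (S N))%Z y)); [exact IHN|].
  apply (continuity_pt_plus (f' (Z.of_nat (S N))) (f' (- Z.of_nat (S N))%Z)); apply Hc.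
Qed.

Lemma cosh_sq (x : R) : cosh x * cosh x = 1 + sinh x * sinh x.
Proof. unfold cosh, sinh; rewrite exp_Ropp; field; apply Rgt_not_eq, exp_pos. Qed.

Lemma cosh_ge_1 (x : R) : 1 <= cosh x.
Proof.
assert (H : 0 < cosh x).
{ unfold cosh; assert (P := exp_pos x); assert (P' := exp_pos (- x)); lra. }
assert (E := cosh_sq x); apply Rnot_lt_le; intros C; nra.
Qed.

Lemma sinh_abs_le_cosh (x : R) : Rabs (sinh x) <= cosh x.
Proof.
unfold cosh, sinh; assert (P := exp_pos x); assert (P' := exp_pos (- x)).
apply Rabs_le; lra.
Qed.

Lemma cosh_ge_exp_abs (x : R) : exp (Rabs x) / 2 <= cosh x.
Proof.
unfold cosh; assert (P := exp_pos x); assert (P' := exp_pos (- x)).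
unfold Rabs; destruct (Rcase_abs x); lra.
Qed.

Lemma exp_le (x y : R) : x <= y -> exp x <= exp y.
Proof. intros [H | ->]; [apply Rlt_le, exp_increasing, H | lra]. Qed.

Lemma exp_opp_abs_translate (x b : R) (n : Z) :
  Rabs x <= b -> / exp (Rabs (x - PI * IZR n)) <= exp b * zpow (1 / 16) n.
Proof.
intros Hx.
assert (PP := PI_RGT_0).
assert (T : PI * IZR (Z.abs n) - b <= Rabs (x - PI * IZR n)).
{ rewrite abs_IZR.
  replace (PI * Rabs (IZR n)) with (Rabs (PI * IZR n)) by (rewrite Rabs_mult, (Rabs_pos_eq PI); lra).
  assert (Q := Rabs_triang (x - PI * IZR n) (- x)); rewrite Rabs_Ropp in Q.
  replace (x - PI * IZR n + - x) with (- (PI * IZR n)) in Q by ring.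
  rewrite Rabs_Ropp in Q; lra. }
rewrite <- exp_Ropp.
apply Rle_trans with (exp (b + - (PI * IZR (Z.abs n)))); [apply exp_le; lra|].
rewrite exp_plus; apply Rmult_le_compat_l; [apply Rlt_le, exp_pos|].
rewrite exp_Ropp; apply inv_exp_abs_le.
Qed.

Lemma inv_cosh_translate_le (x b : R) (n : Z) : Rabs x <= b ->
  / cosh (x - PI * IZR n) <= 2 * exp b * zpow (1 / 16) n.
Proof.
intros Hx; assert (P := exp_pos (Rabs (x - PI * IZR n))).
apply Rle_trans with (/ (exp (Rabs (x - PI * IZR n)) / 2)).
- apply Rinv_le_contravar; [lra | apply cosh_ge_exp_abs].
- replace (/ (exp (Rabs (x - PI * IZR n)) / 2)) with (2 * / exp (Rabs (x - PI * IZR n))) by (field; lra).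
  rewrite Rmult_assoc; apply Rmult_le_compat_l; [lra | apply exp_opp_abs_translate, Hx].
Qed.

Definition dn_term (n : Z) (x : R) : R := / cosh (x - PI * IZR n).
Definition dn_term' (n : Z) (x : R) : R := - (sinh (x - PI * IZR n) / cosh (x - PI * IZR n) ^ 2).
(** Written as a linear combination so that zseries_lin applies to it. *)
Definition dn_term'' (n : Z) (x : R) : R := 1 * dn_term n x + (-2) * dn_term n x ^ 3.

(** Jacobi's dn for a square lattice, up to scaling: the sum of the translates of
    sech by the multiples of PI. *)
Definition dn (x : R) : R := zseries (fun n => dn_term n x).
Definition dn' (x : R) : R := zseries (fun n => dn_term' n x).

Lemma is_derive_cosh (x : R) : is_derive cosh x (sinh x).
Proof. apply is_derive_Reals, derivable_pt_lim_cosh. Qed.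

Lemma is_derive_sinh (x : R) : is_derive sinh x (cosh x).
Proof. apply is_derive_Reals, derivable_pt_lim_sinh. Qed.

Lemma is_derive_dn_term (n : Z) (x : R) : is_derive (dn_term n) x (dn_term' n x).
Proof.
unfold dn_term, dn_term', cosh, sinh.
assert (P := exp_pos (x - PI * IZR n)); assert (P' := exp_pos (- (x - PI * IZR n))).
auto_derive; [unfold Rminus in *; lra|].
unfold Rminus in *; field; lra.
Qed.

Lemma is_derive_dn_term' (n : Z) (x : R) : is_derive (dn_term' n) x (dn_term'' n x).
Proof.
assert (C1 := cosh_ge_1 (x - PI * IZR n)); assert (S2 := cosh_sq (x - PI * IZR n)).
unfold dn_term', dn_term'', dn_term.
evar_last.
- apply (is_derive_opp (K := R_AbsRing) (V := R_NormedModule)).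
  apply is_derive_div.
  + apply (is_derive_comp (K := R_AbsRing) (V := R_NormedModule) sinh (fun x => x - PI * IZR n));
      [apply is_derive_sinh|]. auto_derive; [trivial | reflexivity].
  + apply is_derive_pow.
    apply (is_derive_comp (K := R_AbsRing) (V := R_NormedModule) cosh (fun x => x - PI * IZR n));
      [apply is_derive_cosh|]. auto_derive; [trivial | reflexivity].
  + apply pow_nonzero; lra.
- unfold scal, opp; simpl; unfold mult; simpl.
  set (C := cosh (x - PI * IZR n)) in *; set (T := sinh (x - PI * IZR n)) in *.
  assert (E : T * T = C * C - 1) by lra.
  transitivity ((- (C * C) + 2 * (T * T)) / C ^ 3); [field; lra|].
  rewrite E; field; lra.
Qed.

Lemma dn_term_range (n : Z) (x : R) : 0 < dn_term n x <= 1.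
Proof.
assert (C1 := cosh_ge_1 (x - PI * IZR n)); unfold dn_term; split.
- apply Rinv_0_lt_compat; lra.
- rewrite <- Rinv_1; apply Rinv_le_contravar; lra.
Qed.

Lemma dn_term_bound (n : Z) (x b : R) : Rabs x <= b ->
  dn_term n x <= 2 * exp b * zpow (1 / 2) n.
Proof.
intros Hx; eapply Rle_trans; [apply (inv_cosh_translate_le x b n Hx)|].
apply Rmult_le_compat_l; [|apply zpow_le; lra].
assert (P := exp_pos b); lra.
Qed.

Lemma dn_term'_abs (n : Z) (x : R) : Rabs (dn_term' n x) <= dn_term n x.
Proof.
assert (C1 := cosh_ge_1 (x - PI * IZR n)); assert (S1 := sinh_abs_le_cosh (x - PI * IZR n)).
unfold dn_term', dn_term.
rewrite Rabs_Ropp; unfold Rdiv; rewrite Rabs_mult, Rabs_inv, (Rabs_pos_eq (_ ^ 2)) by (apply pow_le; lra).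
set (C := cosh _) in *.
apply Rle_trans with (C * / C ^ 2); [|right; field; lra].
apply Rmult_le_compat_r; [apply Rlt_le, Rinv_0_lt_compat, pow_lt; lra | exact S1].
Qed.

Lemma dn_term''_abs (n : Z) (x : R) : Rabs (dn_term'' n x) <= 3 * dn_term n x.
Proof.
assert (H := dn_term_range n x); unfold dn_term''; set (s := dn_term n x) in *.
assert (0 <= s ^ 3 <= s) by (simpl; split; nra).
apply Rabs_le; lra.
Qed.

Lemma near_abs_le (x y : R) : Rabs (y - x) < 1 -> Rabs y <= Rabs x + 1.
Proof.
intros H; assert (T := Rabs_triang (y - x) x); replace (y - x + x) with y in T by ring; lra.
Qed.

Lemma continuity_pt_of_derive (f : R -> R) (x l : R) : is_derive f x l -> continuity_pt f x.
Proof.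
intros H; apply derivable_continuous_pt; exists l; apply is_derive_Reals, H.
Qed.

Lemma is_derive_dn (x : R) : is_derive dn x (dn' x).
Proof.
apply (is_derive_zseries dn_term dn_term' x (2 * exp (Rabs x + 1))).
- apply is_derive_dn_term.
- intros n y; eapply continuity_pt_of_derive, is_derive_dn_term'.
- intros n y Hy; rewrite Rabs_pos_eq by (apply Rlt_le, dn_term_range).
  apply dn_term_bound, near_abs_le, Hy.
- intros n y Hy; eapply Rle_trans; [apply dn_term'_abs|].
  apply dn_term_bound, near_abs_le, Hy.
Qed.

Lemma is_derive_dn'_series (x : R) : is_derive dn' x (zseries (fun n => dn_term'' n x)).
Proof.
apply (is_derive_zseries dn_term' dn_term'' x (3 * (2 * exp (Rabs x + 1)))).
- apply is_derive_dn_term'.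
- intros n y; unfold dn_term''.
  eapply continuity_pt_of_derive.
  apply (is_derive_plus (K := R_AbsRing) (V := R_NormedModule) (fun y => 1 * dn_term n y)
           (fun y => -2 * dn_term n y ^ 3)).
  + apply is_derive_scal, is_derive_dn_term.
  + apply is_derive_scal, is_derive_pow, is_derive_dn_term.
- intros n y Hy; eapply Rle_trans; [apply dn_term'_abs|].
  assert (B := dn_term_bound n y _ (near_abs_le _ _ Hy)).
  assert (R0 := dn_term_range n y); lra.
- intros n y Hy; eapply Rle_trans; [apply dn_term''_abs|].
  assert (B := dn_term_bound n y _ (near_abs_le _ _ Hy)); lra.
Qed.

(** * The function cd and the line of real part pi/2 *)

(** The real part of the n-th argument on the line of real part PI / 2. *)
Definition half_node (n : Z) : R := PI / 2 - PI * IZR n.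

Definition cd_den (n : Z) (y : R) : R := sinh (half_node n) ^ 2 + cos y ^ 2.
(** The real part of sech at half_node n + i y. *)
Definition cd_term (n : Z) (y : R) : R := cosh (half_node n) * cos y / cd_den n y.
Definition cd_term' (n : Z) (y : R) : R :=
  cosh (half_node n) * sin y * (cos y ^ 2 - sinh (half_node n) ^ 2) / cd_den n y ^ 2.
(** The real part of sech^3 at half_node n + i y. *)
Definition cd_cube (n : Z) (y : R) : R :=
  ((cosh (half_node n) * cos y) ^ 3
   - 3 * (cosh (half_node n) * cos y) * (sinh (half_node n) * sin y) ^ 2) / cd_den n y ^ 3.
Definition cd_term'' (n : Z) (y : R) : R := (-1) * cd_term n y + 2 * cd_cube n y.

(** The sum of the translated secants at PI / 2 + i y, where it is real. By the
    imaginary transformation of dn it is Jacobi's cd, up to scaling. *)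
Definition cd (y : R) : R := zseries (fun n => cd_term n y).
Definition cd' (y : R) : R := zseries (fun n => cd_term' n y).

Lemma half_node_abs_ge (n : Z) : PI / 2 <= Rabs (half_node n).
Proof.
assert (PP := PI_RGT_0); unfold half_node.
destruct (Z.le_gt_cases n 0) as [H | H].
- apply IZR_le in H; rewrite Rabs_pos_eq; nra.
- assert (H' : (1 <= n)%Z) by lia; apply IZR_le in H'; rewrite Rabs_left1; nra.
Qed.

Lemma exp_half_PI_ge_4 : 4 <= exp (PI / 2).
Proof.
assert (H := exp_PI_ge_16); assert (P := exp_pos (PI / 2)).
replace PI with (PI / 2 + PI / 2) in H by field; rewrite exp_plus in H; nra.
Qed.

Lemma half_node_bounds (n : Z) :
  let Y := exp (Rabs (half_node n)) in
  4 <= Y /\ Y / 4 <= Rabs (sinh (half_node n)) /\ 15 / 8 <= Rabs (sinh (half_node n))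
  /\ cosh (half_node n) <= Y.
Proof.
intros Y.
assert (HY : 4 <= Y).
{ eapply Rle_trans; [apply exp_half_PI_ge_4 | apply exp_le, half_node_abs_ge]. }
assert (IY : / Y <= 1 / 4).
{ replace (1 / 4) with (/ 4) by field; apply Rinv_le_contravar; lra. }
assert (IY0 : 0 < / Y) by (apply Rinv_0_lt_compat; lra).
split; [exact HY|].
unfold Y, sinh, cosh, Rabs in *; destruct (Rcase_abs (half_node n)) as [H | H].
- rewrite exp_Ropp in IY, IY0; rewrite Rinv_inv in IY, IY0.
  assert (P := exp_pos (half_node n)); assert (P' := exp_pos (- half_node n)).
  destruct (Rcase_abs ((exp (half_node n) - exp (- half_node n)) / 2)); lra.
- rewrite <- exp_Ropp in IY, IY0.
  destruct (Rcase_abs ((exp (half_node n) - exp (- half_node n)) / 2)); lra.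
Qed.

Lemma sinh_half_node_sq (n : Z) : 225 / 64 <= sinh (half_node n) ^ 2.
Proof.
destruct (half_node_bounds n) as [_ [_ [H _]]].
rewrite <- pow2_abs.
apply Rle_trans with ((15 / 8) ^ 2); [lra | apply pow_incr; lra].
Qed.

Lemma cd_den_pos (n : Z) (y : R) : 3 <= cd_den n y.
Proof.
assert (H := sinh_half_node_sq n); assert (H' := pow2_ge_0 (cos y)); unfold cd_den; lra.
Qed.

Lemma sin_sq (y : R) : sin y * sin y = 1 - cos y * cos y.
Proof. assert (H := sin2_cos2 y); unfold Rsqr in H; lra. Qed.

Lemma cd_den_alt (n : Z) (y : R) :
  cd_den n y = (cosh (half_node n) * cos y) ^ 2 + (sinh (half_node n) * sin y) ^ 2.
Proof.
unfold cd_den; assert (E := cosh_sq (half_node n)); assert (S2 := sin_sq y).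
transitivity ((cosh (half_node n) * cosh (half_node n)) * (cos y) ^ 2
  + (sinh (half_node n)) ^ 2 * (sin y * sin y)); [rewrite E, S2; ring | ring].
Qed.

Lemma is_derive_cd_term (n : Z) (y : R) : is_derive (cd_term n) y (cd_term' n y).
Proof.
assert (D := cd_den_pos n y); assert (S2 := sin_sq y).
unfold cd_term, cd_term', cd_den in *.
set (C := cosh (half_node n)) in *; set (s := sinh (half_node n)) in *.
auto_derive; [simpl in D; lra|].
assert (N : s ^ 2 + cos y ^ 2 <> 0) by lra.
transitivity (C * sin y * (- (s ^ 2 + cos y ^ 2) + 2 * cos y ^ 2) / (s ^ 2 + cos y ^ 2) ^ 2).
- field; simpl in N; trivial.
- f_equal; ring.
Qed.

Lemma is_derive_cd_term' (n : Z) (y : R) : is_derive (cd_term' n) y (cd_term'' n y).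
Proof.
assert (D := cd_den_pos n y); assert (S2 := sin_sq y); assert (C2 := cosh_sq (half_node n)).
unfold cd_term'', cd_term, cd_term', cd_cube, cd_den in *.
set (C := cosh (half_node n)) in *; set (s := sinh (half_node n)) in *.
assert (N : s ^ 2 + cos y ^ 2 <> 0) by lra.
auto_derive; [apply (pow_nonzero (s ^ 2 + cos y ^ 2) 2), N|].
set (c := cos y) in *; set (t := sin y) in *.
transitivity ((C * (c * (c ^ 2 - s ^ 2) - 2 * (t * t) * c) * (s ^ 2 + c ^ 2)
   + 4 * C * (t * t) * c * (c ^ 2 - s ^ 2)) / (s ^ 2 + c ^ 2) ^ 3).
- field; simpl in N; trivial.
- transitivity ((- C * c * (s ^ 2 + c ^ 2) ^ 2
    + 2 * (C * c * ((C * C) * c ^ 2 - 3 * s ^ 2 * (t * t)))) / (s ^ 2 + c ^ 2) ^ 3).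
  + rewrite S2, C2; f_equal; ring.
  + field; exact N.
Qed.

(** All three are rational in cos y and sin y over a denominator of size
    sinh^2, so they are of the order of 1 / sinh at the node. *)
Lemma cd_terms_le (n : Z) (y : R) :
  let Y := exp (Rabs (half_node n)) in
  Rabs (cd_term n y) <= 16 / Y /\ Rabs (cd_term' n y) <= 16 / Y /\ Rabs (cd_cube n y) <= 16 / Y.
Proof.
intros Y.
destruct (half_node_bounds n) as [HY [H1 [H2 H3]]]; fold Y in HY, H1, H3.
assert (E := cd_den_alt n y); assert (D := cd_den_pos n y).
unfold cd_term, cd_term', cd_cube, cd_den in *.
assert (C1 := cosh_ge_1 (half_node n)).
set (C := cosh (half_node n)) in *; set (s := sinh (half_node n)) in *.
rewrite <- (pow2_abs s) in D, E |- *.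
set (S := Rabs s) in *.
assert (c1 : Rabs (cos y) <= 1) by (apply Rabs_le, COS_bound).
assert (t1 : Rabs (sin y) <= 1) by (apply Rabs_le, SIN_bound).
rewrite <- (pow2_abs (cos y)) in D, E |- *.
assert (c0 := Rabs_pos (cos y)); assert (t0 := Rabs_pos (sin y)).
(* S >= Y / 4 turns a numerator at most Y over S^2 into 16 / Y. *)
assert (Em : forall a b, S ^ 2 <= a -> 0 < a -> 0 <= b <= Y -> b / a <= 16 / Y).
{ intros a b Ha Ha0 Hb.
  apply Rle_div_l; [exact Ha0|].
  assert (Q : Y ^ 2 / 16 <= a).
  { apply Rle_trans with (S ^ 2); [|exact Ha].
    replace (Y ^ 2 / 16) with ((Y / 4) ^ 2) by field; apply pow_incr; lra. }
  apply Rle_trans with (16 / Y * (Y ^ 2 / 16)).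
  - replace (16 / Y * (Y ^ 2 / 16)) with Y by (field; lra); lra.
  - apply Rmult_le_compat_l; [|exact Q].
    apply Rlt_le, Rdiv_lt_0_compat; lra. }
set (m := S ^ 2 + Rabs (cos y) ^ 2) in *.
assert (c2 := pow2_ge_0 (Rabs (cos y))).
assert (mS : S ^ 2 <= m) by (unfold m; lra).
assert (p0 : 0 <= C * Rabs (cos y) <= Y) by nra.
split; [|split].
- unfold Rdiv; rewrite !Rabs_mult, Rabs_inv, (Rabs_pos_eq C), (Rabs_pos_eq m) by lra.
  apply Em; lra.
- unfold Rdiv; rewrite !Rabs_mult, Rabs_inv, (Rabs_pos_eq C), (Rabs_pos_eq (m ^ 2))
    by (try apply pow2_ge_0; lra).
  assert (B : Rabs (Rabs (cos y) ^ 2 - S ^ 2) <= m).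
  { unfold m; assert (S2 := pow2_ge_0 S); apply Rabs_le; lra. }
  apply Rle_trans with ((C * Rabs (sin y)) / m).
  + unfold Rdiv; replace (/ m) with (m * / m ^ 2) by (field; lra).
    rewrite <- Rmult_assoc; apply Rmult_le_compat_r.
    * apply Rlt_le, Rinv_0_lt_compat, pow_lt; lra.
    * apply Rmult_le_compat_l; [nra | exact B].
  + apply Em; [exact mS | lra | nra].
- replace ((C * cos y) ^ 3 - 3 * (C * cos y) * (s * sin y) ^ 2)
    with ((C * cos y) * ((C * cos y) ^ 2 - 3 * (s * sin y) ^ 2)) by ring.
  unfold Rdiv; rewrite !Rabs_mult, Rabs_inv, (Rabs_pos_eq C), (Rabs_pos_eq (m ^ 3))
    by (try apply pow_le; lra).
  assert (B : Rabs ((C * cos y) ^ 2 - 3 * (s * sin y) ^ 2) <= 3 * m).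
  { rewrite E; assert (Q1 := pow2_ge_0 (C * cos y)); assert (Q2 := pow2_ge_0 (s * sin y)).
    apply Rabs_le; lra. }
  apply Rle_trans with ((C * Rabs (cos y)) / m).
  + unfold Rdiv; replace (/ m) with (m ^ 2 * / m ^ 3) by (field; lra).
    rewrite <- Rmult_assoc; apply Rmult_le_compat_r.
    * apply Rlt_le, Rinv_0_lt_compat, pow_lt; lra.
    * apply Rmult_le_compat_l; [lra|]. nra.
  + apply Em; lra.
Qed.

Definition cd_bound_const : R := 16 * exp (PI / 2).

Lemma cd_terms_zpow (n : Z) (v : R) :
  v <= 16 / exp (Rabs (half_node n)) -> v <= cd_bound_const * zpow (1 / 16) n.
Proof.
intros H; eapply Rle_trans; [exact H|]; unfold cd_bound_const.
rewrite Rmult_assoc; apply Rmult_le_compat_l; [lra|].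
apply exp_opp_abs_translate; rewrite Rabs_pos_eq; generalize PI_RGT_0; lra.
Qed.

Lemma cd_bound_const_pos : 0 < cd_bound_const.
Proof. unfold cd_bound_const; assert (P := exp_pos (PI / 2)); lra. Qed.

Lemma zpow_sixteenth_le (K : R) (n : Z) : 0 <= K -> K * zpow (1 / 16) n <= K * zpow (1 / 2) n.
Proof. intros H; apply Rmult_le_compat_l; [exact H | apply zpow_le; lra]. Qed.

Lemma cd_bounds (n : Z) (y : R) :
  Rabs (cd_term n y) <= cd_bound_const * zpow (1 / 2) n /\
  Rabs (cd_term' n y) <= cd_bound_const * zpow (1 / 2) n /\
  Rabs (cd_cube n y) <= cd_bound_const * zpow (1 / 2) n.
Proof.
destruct (cd_terms_le n y) as [A [B D]]; assert (HK := cd_bound_const_pos).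
repeat split; (eapply Rle_trans; [apply cd_terms_zpow; eassumption | apply zpow_sixteenth_le; lra]).
Qed.

Lemma cd_term''_bound (n : Z) (y : R) :
  Rabs (cd_term'' n y) <= (3 * cd_bound_const) * zpow (1 / 2) n.
Proof.
destruct (cd_bounds n y) as [A [_ B]]; unfold cd_term''.
eapply Rle_trans; [apply Rabs_triang|].
rewrite !Rabs_mult, (Rabs_left (-1)), (Rabs_pos_eq 2) by lra; lra.
Qed.

Lemma is_derive_cd (y : R) : is_derive cd y (cd' y).
Proof.
apply (is_derive_zseries cd_term cd_term' y cd_bound_const).
- apply is_derive_cd_term.
- intros n x; eapply continuity_pt_of_derive, is_derive_cd_term'.
- intros n x _; apply cd_bounds.
- intros n x _; apply cd_bounds.
Qed.

Lemma continuity_pt_cd_term'' (n : Z) (y : R) : continuity_pt (cd_term'' n) y.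
Proof.
assert (H : ex_derive (cd_term'' n) y).
{ assert (D := cd_den_pos n y); unfold cd_term'', cd_term, cd_cube, cd_den in *.
  auto_derive; split; [simpl in D; lra|].
  split; [|trivial].
  apply (pow_nonzero (sinh (half_node n) ^ 2 + cos y ^ 2) 3); lra. }
destruct H as [l H]; exact (continuity_pt_of_derive _ _ _ H).
Qed.

Lemma is_derive_cd'_series (y : R) : is_derive cd' y (zseries (fun n => cd_term'' n y)).
Proof.
apply (is_derive_zseries cd_term' cd_term'' y (3 * cd_bound_const)).
- apply is_derive_cd_term'.
- apply continuity_pt_cd_term''.
- intros n x _; destruct (cd_bounds n x) as [_ [B _]]; eapply Rle_trans; [exact B|].
  assert (HK := cd_bound_const_pos); apply Rmult_le_compat_r; [apply zpow_nonneg|]; lra.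
- intros n x _; apply cd_term''_bound.
Qed.

Lemma Csech_real (x : R) (n : Z) :
  (Cexp (translate (RtoC x) n) + / Cexp (translate (RtoC x) n))%C = RtoC (2 * cosh (x - PI * IZR n)).
Proof.
unfold translate; rewrite <- RtoC_minus, Cexp_RtoC.
rewrite <- RtoC_inv by (apply Rgt_not_eq, exp_pos).
rewrite <- RtoC_plus; f_equal; unfold cosh; rewrite exp_Ropp; field.
apply Rgt_not_eq, exp_pos.
Qed.

Lemma Csech_real_eq (x : R) (n : Z) : Csech (translate (RtoC x) n) = RtoC (dn_term n x).
Proof.
assert (C1 := cosh_ge_1 (x - PI * IZR n)).
unfold Csech; rewrite Csech_real, <- RtoC_div by lra; f_equal; unfold dn_term; field; lra.
Qed.

Lemma sech_summable_real (x : R) : sech_summable (RtoC x) (2 * exp (Rabs x)).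
Proof.
intros n; split.
- rewrite Csech_real; intros H; apply RtoC_inj in H.
  assert (C1 := cosh_ge_1 (x - PI * IZR n)); lra.
- rewrite Csech_real_eq, Cmod_R, Rabs_pos_eq by (apply Rlt_le, dn_term_range).
  eapply Rle_trans; [apply (inv_cosh_translate_le x (Rabs x) n); lra|].
  assert (P := exp_pos (Rabs x)); apply Rmult_le_compat_l; [lra | apply zpow_le; lra].
Qed.

Definition half_period_line (y : R) : C := (RtoC (PI / 2) + Ci * RtoC y)%C.

Lemma Cexp_half_period_line (y : R) (n : Z) :
  (Cexp (translate (half_period_line y) n) + / Cexp (translate (half_period_line y) n))%C
  = (2 * (RtoC (cosh (half_node n) * cos y) + Ci * RtoC (sinh (half_node n) * sin y)))%C.
Proof.
assert (E : translate (half_period_line y) n = (half_node n, y)).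
{ unfold translate, half_period_line, half_node; apply C_eq; simpl; ring. }
assert (I : forall w, (/ Cexp w)%C = Cexp (- w)).
{ intros w; assert (X := Cexp_neq_0 w).
  replace (/ Cexp w)%C with (/ Cexp w * Cexp (w + - w))%C.
  - rewrite Cexp_plus; field; exact X.
  - replace (w + - w)%C with (RtoC 0) by ring; rewrite Cexp_RtoC, exp_0; ring. }
rewrite I, E; unfold Cexp; apply C_eq; simpl; unfold cosh, sinh;
  rewrite ?cos_neg, ?sin_neg; field.
Qed.

Lemma Csech_half_period_line (y : R) (n : Z) :
  Csech (translate (half_period_line y) n)
  = (cd_term n y, - (sinh (half_node n) * sin y / cd_den n y)).
Proof.
assert (D := cd_den_pos n y); assert (E := cd_den_alt n y).
unfold Csech; rewrite Cexp_half_period_line.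
set (p := cosh (half_node n) * cos y) in *; set (q := sinh (half_node n) * sin y) in *.
assert (N : (RtoC p + Ci * RtoC q)%C <> RtoC 0).
{ intros H; assert (H1 := f_equal Re H); assert (H2 := f_equal Im H); simpl in H1, H2.
  ring_simplify in H1; ring_simplify in H2; rewrite H1, H2 in E; simpl in E; lra. }
replace (2 / (2 * (RtoC p + Ci * RtoC q)))%C with (/ (RtoC p + Ci * RtoC q))%C
  by (field; exact N).
replace (RtoC p + Ci * RtoC q)%C with (p, q) by (apply C_eq; simpl; ring).
unfold Cinv, cd_term; fold p; simpl; rewrite E; simpl.
apply C_eq; simpl; [reflexivity | unfold Rdiv; ring].
Qed.

Lemma Re_Csech_cube (y : R) (n : Z) :
  Re (Csech (translate (half_period_line y) n) ^ 3)%C = cd_cube n y.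
Proof.
assert (D := cd_den_pos n y); rewrite Csech_half_period_line; unfold cd_cube, cd_term.
simpl; field; lra.
Qed.

Lemma Cmod_Csech_half_period_line (y : R) (n : Z) :
  Cmod (Csech (translate (half_period_line y) n)) <= 2 * cd_bound_const * zpow (1 / 8) n.
Proof.
assert (H0 : Cmod (Csech (translate (half_period_line y) n)) <= 32 / exp (Rabs (half_node n))).
{ rewrite Csech_half_period_line; eapply Rle_trans; [apply Cmod_le_abs|]; simpl.
  destruct (cd_terms_le n y) as [A _].
  destruct (half_node_bounds n) as [HY [H1 [H2 H3]]].
  set (Y := exp _) in *.
  assert (B : Rabs (- (sinh (half_node n) * sin y / cd_den n y)) <= 4 / Y).
  { assert (D := cd_den_pos n y).
    rewrite Rabs_Ropp; unfold Rdiv; rewrite !Rabs_mult, Rabs_inv, (Rabs_pos_eq (cd_den n y)) by lra.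
    assert (t1 : Rabs (sin y) <= 1) by (apply Rabs_le, SIN_bound).
    assert (t0 := Rabs_pos (sin y)).
    apply Rle_div_l; [lra|].
    assert (Dn : Rabs (sinh (half_node n)) ^ 2 <= cd_den n y).
    { unfold cd_den; rewrite pow2_abs; assert (Q := pow2_ge_0 (cos y)); lra. }
    set (S := Rabs (sinh (half_node n))) in *.
    apply Rle_trans with (4 / Y * S ^ 2).
    - replace (4 / Y * S ^ 2) with (S * (S / (Y / 4))) by (field; lra).
      apply Rmult_le_compat_l; [lra|].
      apply Rle_trans with 1; [exact t1|]; apply Rle_div_r; lra.
    - apply Rmult_le_compat_l; [apply Rlt_le, Rdiv_lt_0_compat; lra | exact Dn]. }
  assert (P : 0 < / Y) by (apply Rinv_0_lt_compat; lra).
  unfold Rdiv in *; lra. }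
assert (H1 : Cmod (Csech (translate (half_period_line y) n)) / 2 <= cd_bound_const * zpow (1 / 16) n).
{ apply cd_terms_zpow.
  replace (16 / exp (Rabs (half_node n))) with (32 / exp (Rabs (half_node n)) / 2)
    by (field; apply Rgt_not_eq, exp_pos).
  lra. }
assert (H2 : cd_bound_const * zpow (1 / 16) n <= cd_bound_const * zpow (1 / 8) n).
{ apply Rmult_le_compat_l; [apply Rlt_le, cd_bound_const_pos | apply zpow_le; lra]. }
lra.
Qed.

Lemma sech_summable_half_period_line (y : R) : sech_summable (half_period_line y) (2 * cd_bound_const).
Proof.
intros n; split; [|apply Cmod_Csech_half_period_line].
rewrite Cexp_half_period_line; intros H.
assert (D := cd_den_pos n y); assert (E := cd_den_alt n y).
set (p := cosh (half_node n) * cos y) in *; set (q := sinh (half_node n) * sin y) in *.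
assert (H1 := f_equal Re H); assert (H2 := f_equal Im H); simpl in H1, H2.
assert (p = 0) by lra; assert (q = 0) by lra.
rewrite H0, H3 in E; simpl in E; lra.
Qed.

Lemma half_node_reflect (n : Z) : half_node (1 - n) = - half_node n.
Proof. unfold half_node; rewrite minus_IZR; field. Qed.

Lemma sinh_opp (x : R) : sinh (- x) = - sinh x.
Proof. unfold sinh; rewrite Ropp_involutive; field. Qed.

Lemma cosh_opp (x : R) : cosh (- x) = cosh x.
Proof. unfold cosh; rewrite Ropp_involutive; field. Qed.

Lemma Csech_half_period_line_reflect (y : R) (n : Z) :
  Csech (translate (half_period_line y) (1 - n)) = Cconj (Csech (translate (half_period_line y) n)).
Proof.
rewrite !Csech_half_period_line; unfold cd_term, cd_den; rewrite half_node_reflect, sinh_opp, cosh_opp.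
unfold Cconj; simpl; apply C_eq; simpl; unfold Rdiv; [|ring_simplify];
  replace (- sinh (half_node n) * (- sinh (half_node n) * 1)) with (sinh (half_node n) * (sinh (half_node n) * 1)) by ring; ring.
Qed.

Lemma Clim_conj (u : nat -> C) (l : C) : Clim u l -> Clim (fun n => Cconj (u n)) (Cconj l).
Proof.
intros H; eapply is_lim_seq_ext; [|exact H]; intros n; cbv beta.
rewrite <- Cmod_conj; f_equal; apply C_eq; simpl; ring.
Qed.

Lemma zsum_conj (f : Z -> C) (N : nat) : zsum (fun n => Cconj (f n)) N = Cconj (zsum f N).
Proof.
induction N as [|N IHN].
- unfold zsum; cbn [Csum]; rewrite !Cplus_0_r; reflexivity.
- rewrite !zsum_S, IHN; apply C_eq; simpl; ring.
Qed.

(** The reflection n -> 1 - n exchanges the nodes with opposite signs and hence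
    conjugates the terms. *)
Lemma zsum_real_limit (f : Z -> C) (M : R) (l : C) :
  (forall n, Cmod (f n) <= M * zpow (1 / 2) n) ->
  (forall n, f (1 - n)%Z = Cconj (f n)) ->
  Clim (zsum f) l -> l = RtoC (zseries (fun n => Re (f n))).
Proof.
intros Hf Hr Hl.
assert (E : l = Cconj l).
{ apply (Clim_unique (zsum (fun n => f (1 - n)%Z))).
  - apply (zsum_reflect_Clim f M); assumption.
  - eapply Clim_ext; [|apply Clim_conj, Hl]; intros N; cbv beta.
    rewrite <- zsum_conj; apply zsum_ext; intros n; symmetry; apply Hr. }
apply C_eq.
- simpl; symmetry; apply zseries_unique.
  eapply is_lim_seq_ext; [|apply (Clim_Re _ _ Hl)]; intros N; apply zsum_Re.
- apply (f_equal Im) in E; unfold Im in *; simpl in *; lra.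
Qed.

(** * Differential equations and special values of dn and cd *)

Lemma Clim_RtoC (u : nat -> R) (l : R) :
  is_lim_seq u l -> Clim (fun n => RtoC (u n)) (RtoC l).
Proof.
intros H.
apply is_lim_seq_ext with (u := fun n => Rabs (u n - l)).
{ intros n; rewrite <- RtoC_minus, Cmod_R; reflexivity. }
apply (proj1 (is_lim_seq_abs_0 (fun n => u n - l))).
replace (Finite 0) with (Finite (l - l)) by (f_equal; ring).
apply is_lim_seq_minus'; [exact H | apply is_lim_seq_const].
Qed.

Lemma zsum_RtoC (f : Z -> R) (N : nat) : zsum (fun n => RtoC (f n)) N = RtoC (zsumR f N).
Proof.
induction N as [|N IHN].
- unfold zsum; cbn [Csum zsumR]; rewrite Cplus_0_r; reflexivity.
- rewrite zsum_S, IHN; cbn [zsumR]; rewrite !RtoC_plus; reflexivity.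
Qed.

Lemma zsum_RtoC_Clim (f : Z -> R) (M : R) :
  (forall n, Rabs (f n) <= M * zpow (1 / 2) n) ->
  Clim (zsum (fun n => RtoC (f n))) (RtoC (zseries f)).
Proof.
intros Hf; apply Clim_ext with (u := fun N => RtoC (zsumR f N)).
- intros N; symmetry; apply zsum_RtoC.
- apply Clim_RtoC, (zseries_correct f M Hf).
Qed.

Lemma dn_term_abs_bound (n : Z) (x : R) :
  Rabs (dn_term n x) <= (2 * exp (Rabs x)) * zpow (1 / 2) n.
Proof.
rewrite Rabs_pos_eq by (apply Rlt_le, dn_term_range); apply dn_term_bound; lra.
Qed.

Lemma dn_term'_abs_bound (n : Z) (x : R) :
  Rabs (dn_term' n x) <= (2 * exp (Rabs x)) * zpow (1 / 2) n.
Proof. eapply Rle_trans; [apply dn_term'_abs | apply dn_term_bound; lra]. Qed.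

(** Both equations are lattice_sech_ode, on two lines; on the second one
    d/dy = i d/dz reverses the sign of the second derivative. The values are
    real, so taking real parts makes the constant real. *)
Lemma dn_cd_ode : exists g : R,
  (forall x, is_derive dn' x (g * dn x - 2 * dn x ^ 3)) /\
  (forall y, is_derive cd' y (2 * cd y ^ 3 - g * cd y)).
Proof.
destruct (lattice_sech_ode 0 _ (sech_summable_real 0)) as [c Hc].
exists (Re c); split.
- intros x.
  assert (B3 : forall n, Rabs (dn_term n x ^ 3) <= (2 * exp (Rabs x)) * zpow (1 / 2) n).
  { intros n; assert (R0 := dn_term_range n x).
    eapply Rle_trans; [|apply (dn_term_bound n x (Rabs x)); lra].
    assert (0 <= dn_term n x ^ 3 <= dn_term n x) by (simpl; split; nra).
    rewrite Rabs_pos_eq; lra. }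
  assert (E := Hc (RtoC x) (RtoC (dn x)) (RtoC (zseries (fun n => dn_term n x ^ 3))) _
                 (sech_summable_real x)).
  evar_last; [apply is_derive_dn'_series|].
  unfold dn_term''.
  rewrite (zseries_lin 1 (-2) _ _ _ (fun n => dn_term n x ^ 3) (fun n => dn_term_abs_bound n x) B3).
  fold (dn x).
  match type of E with _ -> _ -> ?H => assert (E' : H) end.
  { apply E.
    - eapply Clim_ext; [|apply (zsum_RtoC_Clim _ _ (fun n => dn_term_abs_bound n x))].
      intros N; apply zsum_ext; intros n; rewrite Csech_real_eq; reflexivity.
    - eapply Clim_ext; [|apply (zsum_RtoC_Clim _ _ B3)].
      intros N; apply zsum_ext; intros n; rewrite Csech_real_eq, RtoC_pow; reflexivity. }
  rewrite <- RtoC_pow in E'.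
  apply (f_equal Re) in E'; destruct c as [c1 c2]; simpl in E' |- *; lra.
- intros y.
  assert (HS := sech_summable_half_period_line y).
  assert (HK := cd_bound_const_pos).
  assert (HM := sech_summable_ge_0 _ _ HS).
  destruct (zsum_Clim (fun n => Csech (translate (half_period_line y) n)) (2 * cd_bound_const)) as [D HD].
  { intros n; eapply Rle_trans; [apply HS | apply zpow_eighth_le, HM]. }
  assert (B3 : forall n, Cmod (Csech (translate (half_period_line y) n) ^ 3)
                         <= (2 * cd_bound_const) ^ 3 * zpow (1 / 2) n).
  { intros n; eapply Rle_trans; [apply (Csech_pow_bound _ _ 2 n HS)|].
    apply zpow_eighth_le, pow_le, HM. }
  destruct (zsum_Clim (fun n => Csech (translate (half_period_line y) n) ^ 3)%C ((2 * cd_bound_const) ^ 3) B3)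
    as [Q HQ].
  assert (E := Hc (half_period_line y) D Q _ HS HD HQ).
  assert (ED : D = RtoC (cd y)).
  { etransitivity; [refine (zsum_real_limit _ (2 * cd_bound_const) D _ _ HD)|].
    - intros n; eapply Rle_trans; [apply HS | apply zpow_eighth_le, HM].
    - apply Csech_half_period_line_reflect.
    - unfold cd; f_equal; apply zseries_ext; intros n; rewrite Csech_half_period_line; reflexivity. }
  assert (EQ : Q = RtoC (zseries (fun n => cd_cube n y))).
  { etransitivity; [refine (zsum_real_limit _ ((2 * cd_bound_const) ^ 3) Q B3 _ HQ)|].
    - intros n; rewrite Csech_half_period_line_reflect; apply C_eq; simpl; ring.
    - f_equal; apply zseries_ext; intros n; apply Re_Csech_cube. }
  evar_last; [apply is_derive_cd'_series|].
  unfold cd_term''.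
  rewrite (zseries_lin (-1) 2 cd_bound_const cd_bound_const (fun n => cd_term n y) (fun n => cd_cube n y))
    by (intros n; apply cd_bounds).
  fold (cd y).
  rewrite ED, EQ, <- RtoC_pow in E.
  apply (f_equal Re) in E; destruct c as [c1 c2]; simpl in E |- *; lra.
Qed.

Lemma zseries_reflect (f : Z -> R) (M : R) :
  (forall n, Rabs (f n) <= M * zpow (1 / 2) n) -> zseries (fun n => f (1 - n)%Z) = zseries f.
Proof.
intros Hf.
assert (L := zsum_RtoC_Clim f M Hf).
apply (zsum_reflect_Clim _ M) in L.
- apply Clim_Re in L; apply zseries_unique.
  eapply is_lim_seq_ext; [|exact L]; intros N; cbv beta; rewrite zsum_Re; reflexivity.
- intros n; rewrite Cmod_R; apply Hf.
Qed.

Lemma zseries_le_const (f : Z -> R) (M l : R) :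
  (forall n, Rabs (f n) <= M * zpow (1 / 2) n) ->
  (forall N, zsumR f N <= l) -> zseries f <= l.
Proof.
intros Hf H.
apply (is_lim_seq_le (zsumR f) (fun _ => l) (zseries f) l H);
  [apply (zseries_correct f M Hf) | apply is_lim_seq_const].
Qed.

Lemma zseries_nonpos_le_term (f : Z -> R) (M : R) :
  (forall n, Rabs (f n) <= M * zpow (1 / 2) n) ->
  (forall n, f n <= 0) -> zseries f <= f 0%Z.
Proof.
intros Hf H; apply (zseries_le_const f M); [exact Hf|].
induction N as [|N IHN]; cbn [zsumR]; [lra|].
assert (A := H (Z.of_nat (S N))); assert (B := H (- Z.of_nat (S N))%Z); lra.
Qed.

Lemma zseries_zero (f : Z -> R) : (forall n, f n = 0) -> zseries f = 0.
Proof.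
intros H; apply zseries_unique.
apply is_lim_seq_ext with (u := fun _ => 0); [|apply is_lim_seq_const].
induction n as [|n IHn]; cbn [zsumR]; rewrite ?H; lra.
Qed.

Lemma dn_pos (x : R) : 0 < dn x.
Proof.
assert (H := zseries_nonpos_le_term (fun n => (-1) * dn_term n x + 0 * dn_term n x) (2 * exp (Rabs x))).
rewrite (zseries_lin (-1) 0 _ _ _ _ (fun n => dn_term_abs_bound n x) (fun n => dn_term_abs_bound n x)) in H.
fold (dn x) in H; assert (R0 := dn_term_range 0 x).
assert (-1 * dn x + 0 * dn x <= -1 * dn_term 0 x + 0 * dn_term 0 x); [apply H | lra].
- intros n; replace (_ + _) with (- dn_term n x) by ring; rewrite Rabs_Ropp.
  apply dn_term_abs_bound.
- intros n; assert (R1 := dn_term_range n x); lra.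
Qed.

Lemma dn_half_PI : dn (PI / 2) = cd 0.
Proof.
apply zseries_ext; intros n; unfold dn_term, cd_term, cd_den; fold (half_node n).
rewrite cos_0; assert (E := cosh_sq (half_node n)); assert (C1 := cosh_ge_1 (half_node n)).
replace (sinh (half_node n) ^ 2 + 1 ^ 2) with (cosh (half_node n) * cosh (half_node n)) by lra.
field; lra.
Qed.

Lemma cd_half_PI : cd (PI / 2) = 0.
Proof. apply zseries_zero; intros n; unfold cd_term; rewrite cos_PI2; unfold Rdiv; ring. Qed.

Lemma cd'_0 : cd' 0 = 0.
Proof. apply zseries_zero; intros n; unfold cd_term'; rewrite sin_0; unfold Rdiv; ring. Qed.

Lemma dn'_0 : dn' 0 = 0.
Proof.
apply zseries_unique.
apply is_lim_seq_ext with (u := fun _ => 0); [|apply is_lim_seq_const].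
assert (O : forall n, dn_term' (- n) 0 = - dn_term' n 0).
{ intros n; unfold dn_term'; rewrite opp_IZR.
  replace (0 - PI * - IZR n) with (- (0 - PI * IZR n)) by ring.
  rewrite sinh_opp, cosh_opp; unfold Rdiv; ring. }
assert (Z0 : dn_term' 0 0 = 0) by (assert (H := O 0%Z); simpl in H; lra).
induction n as [|n IHn]; cbn [zsumR]; [lra|].
rewrite <- IHn, O; ring.
Qed.

Lemma dn_term'_half (n : Z) (y : R) :
  dn_term' n (PI / 2 - y) = - (sinh (half_node n - y) / cosh (half_node n - y) ^ 2).
Proof.
unfold dn_term', half_node.
replace (PI / 2 - y - PI * IZR n) with (PI / 2 - PI * IZR n - y) by ring; reflexivity.
Qed.

Lemma dn'_half_PI : dn' (PI / 2) = 0.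
Proof.
assert (H := zseries_reflect (fun n => dn_term' n (PI / 2)) _ (fun n => dn_term'_abs_bound n (PI / 2))).
cbv beta in H; fold (dn' (PI / 2)) in H.
rewrite (zseries_ext _ (fun n => (-1) * dn_term' n (PI / 2) + 0 * dn_term' n (PI / 2))) in H.
- rewrite (zseries_lin (-1) 0 _ _ _ _ (fun n => dn_term'_abs_bound n (PI / 2))
            (fun n => dn_term'_abs_bound n (PI / 2))) in H.
  fold (dn' (PI / 2)) in H; lra.
- intros n; rewrite <- (Rminus_0_r (PI / 2)), !dn_term'_half, half_node_reflect, !Rminus_0_r.
  rewrite sinh_opp, cosh_opp; unfold Rdiv; ring.
Qed.

Lemma cd'_neg (y : R) : 0 < y < PI -> cd' y < 0.
Proof.
intros Hy.
assert (N : forall n, cd_term' n y < 0).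
{ intros n; unfold cd_term'.
  assert (D := cd_den_pos n y); assert (C1 := cosh_ge_1 (half_node n)).
  assert (S1 := sinh_half_node_sq n); assert (s1 := sin_gt_0 y ltac:(lra) ltac:(lra)).
  assert (c1 : cos y ^ 2 <= 1) by (assert (Q := sin_sq y); nra).
  apply Rmult_lt_reg_r with (cd_den n y ^ 2); [apply pow_lt; lra|].
  unfold Rdiv; rewrite Rmult_assoc, Rinv_l, Rmult_0_l, Rmult_1_r by (apply pow_nonzero; lra).
  assert (0 < cosh (half_node n) * sin y) by (apply Rmult_lt_0_compat; lra).
  nra. }
eapply Rle_lt_trans; [|apply (N 0%Z)].
apply (zseries_nonpos_le_term (fun n => cd_term' n y) cd_bound_const).
- intros n; apply cd_bounds.
- intros n; apply Rlt_le, N.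
Qed.

Lemma cosh_le_5_3 (x : R) : 0 <= x <= 1 -> cosh x <= 5 / 3.
Proof.
intros Hx; unfold cosh; rewrite exp_Ropp.
assert (L : 1 <= exp x) by (assert (H := exp_ineq1_le x); lra).
assert (U : exp x <= 3) by (eapply Rle_trans; [apply exp_le, Hx | apply exp_le_3]).
assert (I : exp x * / exp x = 1) by (field; lra).
set (t := exp x) in *; set (i := / t) in *.
assert (I0 : 0 < i) by (apply Rinv_0_lt_compat; lra).
(* t = exp x lies in [1, 3], where t + 1 / t is at most 3 + 1 / 3. *)
assert (0 <= (3 - t) * (t - 1 / 3) * i) by (apply Rmult_le_pos; [nra | lra]).
nra.
Qed.

Lemma sinh_pos (x : R) : 0 < x -> 0 < sinh x.
Proof. intros Hx; rewrite <- sinh_0; apply sinh_lt, Hx. Qed.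

(** The product cosh(u + x) cosh(u - x) is sinh^2 u + cosh^2 x, so the sign of
    the difference is that of cosh^2 x - sinh^2 u for u, x > 0. *)
Lemma sinh_over_cosh_sq_difference (u x : R) :
  sinh (u + x) / cosh (u + x) ^ 2 - sinh (u - x) / cosh (u - x) ^ 2
  = - (2 * sinh x * cosh u * (sinh u ^ 2 - cosh x ^ 2) / (sinh u ^ 2 + cosh x ^ 2) ^ 2).
Proof.
assert (A := cosh_ge_1 (u + x)); assert (B := cosh_ge_1 (u - x)); assert (Cx := cosh_ge_1 x).
assert (P : cosh (u + x) = cosh u * cosh x + sinh u * sinh x).
{ unfold cosh, sinh; rewrite !Ropp_plus_distr, !exp_plus; field. }
assert (Q : cosh (u - x) = cosh u * cosh x - sinh u * sinh x).
{ unfold cosh, sinh, Rminus; rewrite !Ropp_plus_distr, !exp_plus, Ropp_involutive; field. }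
assert (P' : sinh (u + x) = sinh u * cosh x + cosh u * sinh x).
{ unfold cosh, sinh; rewrite !Ropp_plus_distr, !exp_plus; field. }
assert (Q' : sinh (u - x) = sinh u * cosh x - cosh u * sinh x).
{ unfold cosh, sinh, Rminus; rewrite !Ropp_plus_distr, !exp_plus, Ropp_involutive; field. }
assert (Eu := cosh_sq u); assert (Ex := cosh_sq x).
assert (PQ : cosh (u + x) * cosh (u - x) = sinh u ^ 2 + cosh x ^ 2).
{ rewrite P, Q.
  transitivity ((cosh u * cosh u) * (cosh x * cosh x) - sinh u ^ 2 * sinh x ^ 2); [ring|].
  rewrite Eu; replace (sinh x ^ 2) with (cosh x * cosh x - 1) by lra; ring. }
rewrite <- PQ.
transitivity ((sinh (u + x) * cosh (u - x) ^ 2 - sinh (u - x) * cosh (u + x) ^ 2)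
  / (cosh (u + x) * cosh (u - x)) ^ 2); [field; lra|].
unfold Rdiv; rewrite <- Ropp_mult_distr_l_reverse; f_equal.
rewrite P, Q, P', Q'.
set (s := sinh u) in *; set (C := cosh u) in *; set (t := sinh x) in *; set (c := cosh x) in *.
transitivity (2 * t * C * ((C * C) * (c * c) + s ^ 2 * (t * t) - 2 * s ^ 2 * (c * c))); [ring|].
rewrite Eu; replace (t * t) with (c * c - 1) by lra; ring.
Qed.

(** * Monotonicity and the first-order equations *)

Lemma two_cosh_over_sinh_sq_le (k : nat) :
  2 * cosh (PI * IZR (Z.of_nat (S k))) / sinh (PI * IZR (Z.of_nat (S k))) ^ 2
  <= 41 / 10 * (1 / 16) ^ S k.
Proof.
set (u := PI * IZR (Z.of_nat (S k))).
assert (EY : exp u = exp PI ^ S k).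
{ unfold u; rewrite <- (Z.abs_eq (Z.of_nat (S k))) by lia.
  rewrite exp_IZR_abs; f_equal; lia. }
assert (G := exp_PI_ge_16).
assert (H16 : 16 ^ S k <= exp u) by (rewrite EY; apply pow_incr; lra).
assert (P16 : 1 <= 16 ^ k) by (apply pow_R1_Rle; lra).
assert (HY : 16 <= exp u) by (simpl in H16; lra).
set (Y := exp u) in *.
assert (EC : cosh u = (Y * Y + 1) / (2 * Y)) by (unfold cosh; rewrite exp_Ropp; fold Y; field; lra).
assert (ES : sinh u = (Y * Y - 1) / (2 * Y)) by (unfold sinh; rewrite exp_Ropp; fold Y; field; lra).
assert (B : 2 * cosh u / sinh u ^ 2 <= 41 / 10 * / Y).
{ rewrite EC, ES.
  replace (2 * ((Y * Y + 1) / (2 * Y)) / ((Y * Y - 1) / (2 * Y)) ^ 2)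
    with (4 * Y * (Y * Y + 1) / (Y * Y - 1) ^ 2) by (field; split; nra).
  apply Rle_div_l; [apply pow_lt; nra|].
  replace (41 / 10 * / Y * (Y * Y - 1) ^ 2) with ((41 / 10 * (Y * Y - 1) ^ 2) / Y) by (field; lra).
  apply (proj1 (Rle_div_r (4 * Y * (Y * Y + 1)) (41 / 10 * (Y * Y - 1) ^ 2) Y ltac:(lra))).
  assert (Q : 256 <= Y * Y) by nra.
  replace (4 * Y * (Y * Y + 1) * Y) with (4 * (Y * Y) * (Y * Y + 1)) by ring.
  set (W := Y * Y) in *; nra. }
eapply Rle_trans; [exact B|]; apply Rmult_le_compat_l; [lra|].
replace (1 / 16) with (/ 16) by field; rewrite pow_inv.
apply Rinv_le_contravar; [apply pow_lt; lra | exact H16].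
Qed.

Lemma dn_term'_0 (x : R) : dn_term' 0 x = - (sinh x / cosh x ^ 2).
Proof. unfold dn_term'; rewrite Rmult_0_r, Rminus_0_r; reflexivity. Qed.

Lemma dn_term'_pair (k : nat) (x : R) : 0 < x <= 1 ->
  dn_term' (Z.of_nat (S k)) x + dn_term' (- Z.of_nat (S k)) x
  <= sinh x * (41 / 10 * (1 / 16) ^ S k).
Proof.
intros Hx.
assert (R := two_cosh_over_sinh_sq_le k).
unfold dn_term'; rewrite opp_IZR.
set (u := PI * IZR (Z.of_nat (S k))) in *.
replace (x - PI * - IZR (Z.of_nat (S k))) with (u + x) by (unfold u; ring).
replace (x - u) with (- (u - x)) by ring.
rewrite sinh_opp, cosh_opp.
replace (_ + _) with (- (sinh (u + x) / cosh (u + x) ^ 2 - sinh (u - x) / cosh (u - x) ^ 2))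
  by (unfold Rdiv; ring).
rewrite sinh_over_cosh_sq_difference, Ropp_involutive.
assert (Sx := sinh_pos x ltac:(lra)).
assert (Su : 0 < sinh u).
{ apply sinh_pos; unfold u; apply Rmult_lt_0_compat; [apply PI_RGT_0 | apply IZR_lt; lia]. }
assert (Cu := cosh_ge_1 u); assert (Cx := cosh_ge_1 x).
apply Rle_trans with (sinh x * (2 * cosh u / sinh u ^ 2)).
2: { apply Rmult_le_compat_l; [lra | exact R]. }
assert (S2 : 0 < sinh u ^ 2) by (apply pow_lt, Su); assert (C2 : 0 < cosh x ^ 2) by (apply pow_lt; lra).
set (A := sinh u ^ 2) in *; set (B := cosh x ^ 2) in *.
replace (2 * sinh x * cosh u * (A - B) / (A + B) ^ 2)
  with (2 * sinh x * cosh u * ((A - B) / (A + B) ^ 2)) by (field; lra).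
replace (sinh x * (2 * cosh u / A)) with (2 * sinh x * cosh u * / A) by (field; lra).
apply Rmult_le_compat_l; [nra|].
apply Rle_div_l; [apply pow_lt; lra|].
replace (/ A * (A + B) ^ 2) with ((A + B) ^ 2 / A) by (field; lra).
apply Rle_div_r; [lra | nra].
Qed.

(** Pair the terms n and - n: each pair is at most 4.1 sinh x / 16^n, and the
    central term - sinh x / cosh^2 x outweighs the sum of the pairs as long as
    cosh x <= 5/3. *)
Lemma dn'_neg_near_0 (x : R) : 0 < x <= 1 -> dn' x < 0.
Proof.
intros Hx.
assert (Sx := sinh_pos x ltac:(lra)); assert (Cx := cosh_ge_1 x).
assert (C5 := cosh_le_5_3 x ltac:(lra)).
assert (T : forall N, zsumR (fun n => dn_term' n x) N
   <= - (sinh x / cosh x ^ 2) + sinh x * (41 / 150 * (1 - (1 / 16) ^ N))).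
{ induction N as [|N IHN]; cbn [zsumR].
  - rewrite dn_term'_0; simpl; lra.
  - assert (P := dn_term'_pair N x Hx); simpl pow in *; lra. }
assert (U : zseries (fun n => dn_term' n x) <= - (sinh x / cosh x ^ 2) + sinh x * (41 / 150)).
{ apply (zseries_le_const _ _ _ (fun n => dn_term'_abs_bound n x)); intros N.
  eapply Rle_trans; [apply T|].
  assert (P : 0 <= (1 / 16) ^ N) by (apply pow_le; lra); nra. }
fold (dn' x) in U.
(* 41 / 150 is the sum of the bounds 4.1 / 16^n, and is less than 9 / 25. *)
assert (I : 9 / 25 <= / cosh x ^ 2).
{ replace (9 / 25) with (/ (5 / 3) ^ 2) by field.
  apply Rinv_le_contravar; [apply pow_lt; lra | apply pow_incr; lra]. }
unfold Rdiv in U; nra.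
Qed.

(** Near PI / 2 the terms n and 1 - n almost cancel; averaging the series with
    its reflection makes every term negative, as sinh^2 at each node exceeds
    cosh^2 y. *)
Lemma dn'_neg_near_half_PI (y : R) : 0 < y <= 1 -> dn' (PI / 2 - y) < 0.
Proof.
intros Hy; set (x := PI / 2 - y).
assert (Bf := fun n => dn_term'_abs_bound n x).
assert (Bg : forall n, Rabs (dn_term' (1 - n) x) <= (2 * exp (Rabs x) * 2) * zpow (1 / 2) n).
{ intros n; eapply Rle_trans; [apply Bf|].
  rewrite (Rmult_assoc (2 * exp (Rabs x)) 2).
  apply Rmult_le_compat_l; [assert (P := exp_pos (Rabs x)); lra|].
  unfold zpow.
  assert (M : (1 / 2) ^ (Z.abs_nat (1 - n) + 1) <= (1 / 2) ^ Z.abs_nat n).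
  { replace (Z.abs_nat (1 - n) + 1)%nat
      with (Z.abs_nat n + (Z.abs_nat (1 - n) + 1 - Z.abs_nat n))%nat by lia.
    rewrite pow_add.
    assert (P : 0 <= (1 / 2) ^ Z.abs_nat n) by (apply pow_le; lra).
    set (j := (_ - _)%nat).
    assert (Q : (1 / 2) ^ j <= 1 ^ j) by (apply pow_incr; lra); rewrite pow1 in Q; nra. }
  rewrite pow_add, pow_1 in M; lra. }
assert (E : dn' x = zseries (fun n => 1 / 2 * dn_term' n x + 1 / 2 * dn_term' (1 - n) x)).
{ rewrite (zseries_lin (1 / 2) (1 / 2) _ _ _ _ Bf Bg).
  assert (H := zseries_reflect (fun n => dn_term' n x) _ Bf); cbv beta in H; rewrite H.
  fold (dn' x); lra. }
assert (N : forall n, 1 / 2 * dn_term' n x + 1 / 2 * dn_term' (1 - n) x < 0).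
{ intros n; unfold x; rewrite !dn_term'_half, half_node_reflect.
  replace (- half_node n - y) with (- (half_node n + y)) by ring.
  rewrite sinh_opp, cosh_opp.
  replace (_ + _) with (1 / 2 * (sinh (half_node n + y) / cosh (half_node n + y) ^ 2
      - sinh (half_node n - y) / cosh (half_node n - y) ^ 2)) by (unfold Rdiv; ring).
  rewrite sinh_over_cosh_sq_difference.
  assert (Sy := sinh_pos y ltac:(lra)); assert (C1 := cosh_ge_1 (half_node n)).
  assert (C5 := cosh_le_5_3 y ltac:(lra)); assert (Cy := cosh_ge_1 y).
  assert (S2 := sinh_half_node_sq n).
  assert (Cy2 : cosh y ^ 2 <= (5 / 3) ^ 2) by (apply pow_incr; lra).
  assert (P : 0 < 2 * sinh y * cosh (half_node n) * (sinh (half_node n) ^ 2 - cosh y ^ 2)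
              / (sinh (half_node n) ^ 2 + cosh y ^ 2) ^ 2).
  { apply Rdiv_lt_0_compat.
    - apply Rmult_lt_0_compat; [apply Rmult_lt_0_compat|]; lra.
    - apply pow_lt; assert (Q := pow2_ge_0 (cosh y)); lra. }
  lra. }
rewrite E.
eapply Rle_lt_trans; [|apply (N 0%Z)].
apply (zseries_nonpos_le_term (fun n => 1 / 2 * dn_term' n x + 1 / 2 * dn_term' (1 - n) x)
        (2 * exp (Rabs x) * 2)).
- intros n; eapply Rle_trans; [apply Rabs_triang|].
  rewrite !Rabs_mult, (Rabs_pos_eq (1 / 2)) by lra.
  assert (A := Bf n); assert (B := Bg n).
  assert (Q : 0 <= exp (Rabs x) * zpow (1 / 2) n).
  { apply Rmult_le_pos; [apply Rlt_le, exp_pos | apply zpow_nonneg; lra]. }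
  lra.
- intros n; apply Rlt_le, N.
Qed.

Lemma dn'_neg (x : R) : 0 < x < PI / 2 -> dn' x < 0.
Proof.
intros Hx; destruct (Rle_lt_dec x 1) as [H | H]; [apply dn'_neg_near_0; lra|].
(* PI <= 4 ensures that the two ranges cover the interval. *)
replace x with (PI / 2 - (PI / 2 - x)) by ring.
apply dn'_neg_near_half_PI; generalize PI_4; lra.
Qed.

Lemma is_derive_zero_const (f : R -> R) (x y : R) :
  (forall t, is_derive f t 0) -> f x = f y.
Proof.
intros H.
destruct (MVT_gen f x y (fun _ => 0)) as [c [_ E]].
- intros t _; apply H.
- intros t _; eapply continuity_pt_of_derive, H.
- lra.
Qed.

Lemma strictly_decreasing_of_derive (f f' : R -> R) (a b : R) :
  (forall x, is_derive f x (f' x)) -> (forall x, a < x < b -> f' x < 0) ->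
  forall x y, a <= x -> x < y -> y <= b -> f y < f x.
Proof.
intros Hd Hn x y Hx Hxy Hy.
destruct (MVT_cor2 f f' x y Hxy) as [c [E Hc]].
- intros t _; apply is_derive_Reals, Hd.
- assert (N := Hn c ltac:(lra)); nra.
Qed.

Lemma dn_range (x : R) : 0 < x < PI / 2 -> dn (PI / 2) < dn x < dn 0.
Proof.
intros Hx; split; apply (strictly_decreasing_of_derive dn dn' 0 (PI / 2));
  try apply is_derive_dn; try apply dn'_neg; lra.
Qed.

Lemma dn_0_gt : dn (PI / 2) < dn 0.
Proof.
apply (strictly_decreasing_of_derive dn dn' 0 (PI / 2));
  try apply is_derive_dn; try apply dn'_neg; generalize PI_RGT_0; lra.
Qed.

Lemma cd_range (y : R) : 0 < y < PI / 2 -> 0 < cd y < dn (PI / 2).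
Proof.
intros Hy; rewrite dn_half_PI.
split; [apply (Rle_lt_trans _ (cd (PI / 2))); [rewrite cd_half_PI; lra|]|]; apply (strictly_decreasing_of_derive cd cd' 0 (PI / 2)); try apply is_derive_cd; try lra;
  intros t Ht; apply cd'_neg; lra.
Qed.

(** The energy dn'^2 - g dn^2 + dn^4 is constant. Its values at 0 and PI / 2, where
    dn' vanishes, agree and determine g = a^2 + b^2; the energy of cd is read
    off at 0, where cd is b. *)
Lemma dn_cd_first_order :
  (forall x, dn' x ^ 2 = (dn 0 ^ 2 - dn x ^ 2) * (dn x ^ 2 - dn (PI / 2) ^ 2)) /\
  (forall y, cd' y ^ 2 = (dn 0 ^ 2 - cd y ^ 2) * (dn (PI / 2) ^ 2 - cd y ^ 2)).
Proof.
destruct dn_cd_ode as [g [Hdn Hcd]].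
assert (K1 : forall x y, dn' x ^ 2 - g * dn x ^ 2 + dn x ^ 4 = dn' y ^ 2 - g * dn y ^ 2 + dn y ^ 4).
{ intros x y; apply (is_derive_zero_const (fun x => dn' x ^ 2 - g * dn x ^ 2 + dn x ^ 4)).
  intros t; assert (D1 := is_derive_dn t); assert (D2 := Hdn t).
  assert (E1 : Derive (fun x : R => dn x) t = dn' t) by exact (is_derive_unique _ _ _ D1).
  assert (E2 : Derive (fun x : R => dn' x) t = g * dn t - 2 * dn t ^ 3)
    by exact (is_derive_unique _ _ _ D2).
  auto_derive.
  - repeat split; eexists; eassumption.
  - rewrite E1, E2; ring. }
assert (K2 : forall x y, cd' x ^ 2 + g * cd x ^ 2 - cd x ^ 4 = cd' y ^ 2 + g * cd y ^ 2 - cd y ^ 4).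
{ intros x y; apply (is_derive_zero_const (fun x => cd' x ^ 2 + g * cd x ^ 2 - cd x ^ 4)).
  intros t; assert (D1 := is_derive_cd t); assert (D2 := Hcd t).
  assert (E1 : Derive (fun x : R => cd x) t = cd' t) by exact (is_derive_unique _ _ _ D1).
  assert (E2 : Derive (fun x : R => cd' x) t = 2 * cd t ^ 3 - g * cd t)
    by exact (is_derive_unique _ _ _ D2).
  auto_derive.
  - repeat split; eexists; eassumption.
  - rewrite E1, E2; ring. }
assert (A := dn_0_gt); assert (B := dn_pos (PI / 2)).
assert (G : g = dn 0 ^ 2 + dn (PI / 2) ^ 2).
{ assert (E := K1 0 (PI / 2)); rewrite dn'_0, dn'_half_PI in E.
  apply Rmult_eq_reg_l with (dn 0 ^ 2 - dn (PI / 2) ^ 2); [lra|]; nra. }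
split; intros x.
- assert (E := K1 x 0); rewrite dn'_0, G in E; lra.
- assert (E := K2 x 0); rewrite cd'_0, <- dn_half_PI, G in E; lra.
Qed.

(** Separation of variables, with the derivative required only inside the
    interval: at the end points t involves square roots of quantities that
    vanish there. *)
Lemma travel_time (phi t t' : R -> R) (a b s : R) :
  a < b ->
  (forall x, continuous phi x) ->
  (forall x, a <= x <= b -> continuity_pt t x) ->
  (forall x, a < x < b -> is_derive t x (t' x) /\ phi (t x) * t' x = s) ->
  RInt phi (t a) (t b) = s * (b - a).
Proof.
intros Hab Hphi Ht Hd.
assert (Hex : forall u v, ex_RInt phi u v).
{ intros u v; apply (@ex_RInt_continuous R_CompleteNormedModule); intros; apply Hphi. }
set (J := fun u => RInt phi (t a) u).
assert (HJ : forall u, is_derive J u (phi u)).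
{ intros u; apply (is_derive_RInt phi J (t a) u); [|apply Hphi].
  exists (mkposreal 1 Rlt_0_1); intros v _.
  apply (@RInt_correct R_CompleteNormedModule), Hex. }
destruct (MVT_gen (fun x => J (t x)) a b (fun _ => s)) as [c [_ E]].
- rewrite Rmin_left, Rmax_right by lra; intros x Hx.
  destruct (Hd x Hx) as [D F]; rewrite <- F.
  rewrite Rmult_comm; exact (is_derive_comp J t x _ _ (HJ (t x)) D).
- rewrite Rmin_left, Rmax_right by lra; intros x Hx.
  apply (continuity_pt_comp t J); [apply Ht, Hx|].
  exact (continuity_pt_of_derive _ _ _ (HJ (t x))).
- unfold J in E.
  assert (Z0 : RInt phi (t a) (t a) = 0) by exact (RInt_point (V := R_CompleteNormedModule) _ _).
  rewrite Z0 in E; rewrite Rminus_0_r in E; exact E.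
Qed.

(** * Quarter periods and the value dn (PI / 2) *)

Definition quad_minus (a b s : R) : R := a ^ 2 * (1 - s ^ 2) ^ 2 + 4 * b ^ 2 * s ^ 2.
Definition quad_plus (a b s : R) : R := a ^ 2 * (1 + s ^ 2) ^ 2 - 4 * b ^ 2 * s ^ 2.

Lemma quad_minus_pos (a b s : R) : 0 < b < a -> 0 < quad_minus a b s.
Proof.
intros H; unfold quad_minus.
assert (E : 0 < b ^ 2 * (1 + s ^ 2) ^ 2).
{ assert (Q := pow2_ge_0 s); apply Rmult_lt_0_compat; apply pow_lt; lra. }
assert (F : 0 <= (a ^ 2 - b ^ 2) * (1 - s ^ 2) ^ 2).
{ apply Rmult_le_pos; [nra | apply pow2_ge_0]. }
lra.
Qed.

Lemma quad_plus_pos (a b s : R) : 0 < b < a -> 0 < quad_plus a b s.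
Proof.
intros H; unfold quad_plus.
assert (E : 0 < (a ^ 2 - b ^ 2) * (1 + s ^ 2) ^ 2).
{ assert (Q := pow2_ge_0 s); apply Rmult_lt_0_compat; [nra | apply pow_lt; lra]. }
assert (F : 0 <= b ^ 2 * (1 - s ^ 2) ^ 2).
{ apply Rmult_le_pos; apply pow2_ge_0. }
lra.
Qed.

Lemma continuous_inv_sqrt (f : R -> R) (s : R) :
  ex_derive f s -> 0 < f s -> continuous (fun s => 2 / sqrt (f s)) s.
Proof.
intros Hf H0; apply (ex_derive_continuous (fun s => 2 / sqrt (f s))).
auto_derive; repeat split; trivial.
apply Rgt_not_eq, sqrt_lt_R0, H0.
Qed.

Lemma continuous_inv_sqrt_quad_minus (a b s : R) : 0 < b < a ->
  continuous (fun s => 2 / sqrt (quad_minus a b s)) s.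
Proof.
intros H; apply continuous_inv_sqrt; [|apply quad_minus_pos, H].
unfold quad_minus; auto_derive; trivial.
Qed.

Lemma continuous_inv_sqrt_quad_plus (a b s : R) : 0 < b < a ->
  continuous (fun s => 2 / sqrt (quad_plus a b s)) s.
Proof.
intros H; apply continuous_inv_sqrt; [|apply quad_plus_pos, H].
unfold quad_plus; auto_derive; trivial.
Qed.

Lemma opposite_root (x y z : R) : x < 0 -> 0 <= y -> 0 <= z -> x ^ 2 = y ^ 2 * z ^ 2 -> x = - (y * z).
Proof.
intros Hx Hy Hz E.
assert (H : (x - y * z) * (x + y * z) = 0) by nra.
apply Rmult_integral in H; assert (P : 0 <= y * z) by (apply Rmult_le_pos; assumption).
destruct H; lra.
Qed.

Lemma continuity_pt_sqrt_comp (f : R -> R) (x : R) :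
  continuity_pt f x -> 0 <= f x -> continuity_pt (fun x => sqrt (f x)) x.
Proof.
intros Hf H0; apply (continuity_pt_comp f sqrt); [exact Hf | apply continuity_pt_sqrt, H0].
Qed.

Lemma is_derive_sqrt_comp (f : R -> R) (x l : R) :
  is_derive f x l -> 0 < f x -> is_derive (fun x => sqrt (f x)) x (l / (2 * sqrt (f x))).
Proof.
intros Hf H0.
unfold Rdiv.
apply (is_derive_comp sqrt f x (/ (2 * sqrt (f x))) l); [|exact Hf].
apply is_derive_Reals, derivable_pt_lim_sqrt, H0.
Qed.

(** With dn^2 = a^2 cos^2 + b^2 sin^2 of an angle, t is the tangent of half that
    angle. It satisfies t' = dn k / (k + B), and the square root of the
    quartic at t is 2 dn k / (k + B). *)
Lemma dn_period :
  RInt (fun s => 2 / sqrt (quad_minus (dn 0) (dn (PI / 2)) s)) 0 1 = PI / 2.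
Proof.
assert (Hab := dn_0_gt); assert (Hb := dn_pos (PI / 2)); assert (HP := PI_RGT_0).
destruct dn_cd_first_order as [FO _].
set (a := dn 0) in *; set (b := dn (PI / 2)) in *.
assert (Hk2 : 0 < a ^ 2 - b ^ 2) by nra.
set (k := sqrt (a ^ 2 - b ^ 2)).
assert (Hk : 0 < k) by (apply sqrt_lt_R0, Hk2).
assert (Ek : k ^ 2 = a ^ 2 - b ^ 2) by (apply pow2_sqrt; lra).
set (A := fun x => sqrt (a ^ 2 - dn x ^ 2)); set (B := fun x => sqrt (dn x ^ 2 - b ^ 2)).
set (t := fun x => A x / (k + B x)).
assert (B0 : forall x, 0 <= B x) by (intros x; apply sqrt_pos).
assert (t0 : t 0 = 0).
{ unfold t, A; fold a; rewrite Rminus_diag, sqrt_0; unfold Rdiv; ring. }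
assert (t1 : t (PI / 2) = 1).
{ unfold t, A, B; fold b; rewrite Rminus_diag, sqrt_0; fold k; field; lra. }
cut (RInt (fun s => 2 / sqrt (quad_minus a b s)) (t 0) (t (PI / 2)) = PI / 2);
  [rewrite t0, t1; trivial|].
assert (Rg : forall x, 0 <= x <= PI / 2 -> b <= dn x <= a).
{ intros x Hx; destruct (Req_dec x 0) as [-> | N0]; [fold a; lra|].
  destruct (Req_dec x (PI / 2)) as [-> | N1]; [fold b; lra|].
  destruct (dn_range x ltac:(lra)) as [R1 R2]; fold a b in R1, R2; lra. }
rewrite (travel_time (fun s => 2 / sqrt (quad_minus a b s)) t
  (fun x => dn x * k / (k + B x)) 0 (PI / 2) 1).
- lra.
- lra.
- intros s; apply continuous_inv_sqrt_quad_minus; lra.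
- intros x Hx; assert (R1 := Rg x Hx); unfold t.
  assert (Cdn : continuity_pt (fun x => dn x ^ 2) x).
  { eapply continuity_pt_of_derive, is_derive_pow, is_derive_dn. }
  apply (continuity_pt_div A (fun x => k + B x)).
  + apply continuity_pt_sqrt_comp; [|nra].
    apply (continuity_pt_minus (fun _ => a ^ 2) (fun x => dn x ^ 2)); [apply continuity_pt_const; red; reflexivity | exact Cdn].
  + apply (continuity_pt_plus (fun _ => k) B); [apply continuity_pt_const; red; reflexivity|].
    apply continuity_pt_sqrt_comp; [|nra].
    apply (continuity_pt_minus (fun x => dn x ^ 2) (fun _ => b ^ 2)); [exact Cdn | apply continuity_pt_const; red; reflexivity].
  + assert (P := B0 x); lra.
- intros x Hx.
  destruct (dn_range x Hx) as [R1 R2]; fold a b in R1, R2.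
  assert (PA : 0 < a ^ 2 - dn x ^ 2) by nra; assert (PB : 0 < dn x ^ 2 - b ^ 2) by nra.
  assert (A1 : 0 < A x) by (apply sqrt_lt_R0, PA); assert (B1 : 0 < B x) by (apply sqrt_lt_R0, PB).
  assert (EA : A x ^ 2 = a ^ 2 - dn x ^ 2) by (apply pow2_sqrt; lra).
  assert (EB : B x ^ 2 = dn x ^ 2 - b ^ 2) by (apply pow2_sqrt; lra).
  assert (D' : dn' x = - (A x * B x)).
  { apply opposite_root; [apply dn'_neg, Hx | lra | lra | rewrite EA, EB; apply FO]. }
  assert (DD := is_derive_dn x); rewrite D' in DD.
  assert (D2 : is_derive (fun x => dn x ^ 2) x (- (2 * dn x * (A x * B x)))).
  { evar_last; [apply is_derive_pow, DD | simpl; ring]. }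
  assert (DA : is_derive A x (dn x * B x)).
  { evar_last; [apply (is_derive_sqrt_comp (fun x => a ^ 2 - dn x ^ 2)); [|exact PA]|].
    - apply (is_derive_minus (fun _ => a ^ 2) (fun x => dn x ^ 2)); [apply is_derive_const | exact D2].
    - change (sqrt (a ^ 2 - dn x ^ 2)) with (A x).
      unfold minus, plus, opp, zero; simpl; field; lra. }
  assert (DB : is_derive B x (- (dn x * A x))).
  { evar_last; [apply (is_derive_sqrt_comp (fun x => dn x ^ 2 - b ^ 2)); [|exact PB]|].
    - apply (is_derive_minus (fun x => dn x ^ 2) (fun _ => b ^ 2)); [exact D2 | apply is_derive_const].
    - change (sqrt (dn x ^ 2 - b ^ 2)) with (B x).
      unfold minus, plus, opp, zero; simpl; field; lra. }
  (* A / k and B / k are the sine and the cosine of the angle. *)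
  assert (SS : A x ^ 2 + B x ^ 2 = k ^ 2) by lra.
  split.
  + evar_last.
    * apply is_derive_div; [exact DA | | lra].
      apply (is_derive_plus (fun _ => k) B); [apply is_derive_const | exact DB].
    * unfold plus, zero; simpl.
      transitivity (dn x * (k * B x + (A x ^ 2 + B x ^ 2)) / (k + B x) ^ 2); [field; lra|].
      rewrite SS; field; lra.
  + replace (quad_minus a b (t x)) with ((2 * dn x * k / (k + B x)) ^ 2).
    * rewrite sqrt_pow2.
      -- field; repeat split; lra.
      -- apply Rlt_le, Rdiv_lt_0_compat; [|lra]; apply Rmult_lt_0_compat; lra.
    * unfold quad_minus, t.
      assert (HS : 1 - (A x / (k + B x)) ^ 2 = 2 * B x / (k + B x)).
      { transitivity ((k ^ 2 + 2 * k * B x + B x ^ 2 - A x ^ 2) / (k + B x) ^ 2); [field; lra|].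
        rewrite <- SS; replace (A x ^ 2 + B x ^ 2 + 2 * k * B x + B x ^ 2 - A x ^ 2)
          with (2 * B x * (k + B x)) by ring; field; lra. }
      rewrite HS.
      transitivity (4 * (dn x ^ 2 * k ^ 2) / (k + B x) ^ 2); [field; lra|].
      transitivity (4 * (a ^ 2 * B x ^ 2 + b ^ 2 * A x ^ 2) / (k + B x) ^ 2); [|field; lra].
      rewrite EA, EB, Ek; f_equal; ring.
Qed.

(** With cd = b sin of an angle, t is the tangent of half that angle, which
    decreases from 1 to 0. *)
Lemma cd_period :
  RInt (fun s => 2 / sqrt (quad_plus (dn 0) (dn (PI / 2)) s)) 0 1 = PI / 2.
Proof.
assert (Hab := dn_0_gt); assert (Hb := dn_pos (PI / 2)); assert (HP := PI_RGT_0).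
destruct dn_cd_first_order as [_ FO].
set (a := dn 0) in *; set (b := dn (PI / 2)) in *.
set (B := fun x => sqrt (b ^ 2 - cd x ^ 2)).
set (A := fun x => sqrt (a ^ 2 - cd x ^ 2)).
set (t := fun x => cd x / (b + B x)).
assert (B0 : forall x, 0 <= B x) by (intros x; apply sqrt_pos).
assert (t0 : t 0 = 1).
{ unfold t, B; rewrite <- dn_half_PI; fold b; rewrite Rminus_diag, sqrt_0; field; lra. }
assert (t1 : t (PI / 2) = 0).
{ unfold t; rewrite cd_half_PI; unfold Rdiv; ring. }
cut (RInt (fun s => 2 / sqrt (quad_plus a b s)) (t (PI / 2)) (t 0) = PI / 2);
  [rewrite t0, t1; trivial|].
assert (Sw : forall u v, RInt (fun s => 2 / sqrt (quad_plus a b s)) u v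
             = - RInt (fun s => 2 / sqrt (quad_plus a b s)) v u).
{ intros u v; rewrite <- (opp_RInt_swap (V := R_CompleteNormedModule)); [reflexivity|].
  apply (@ex_RInt_continuous R_CompleteNormedModule); intros s _.
  apply continuous_inv_sqrt_quad_plus; lra. }
rewrite Sw.
assert (Rg : forall x, 0 <= x <= PI / 2 -> 0 <= cd x <= b).
{ intros x Hx; destruct (Req_dec x 0) as [-> | N0]; [rewrite <- dn_half_PI; fold b; lra|].
  destruct (Req_dec x (PI / 2)) as [-> | N1]; [rewrite cd_half_PI; lra|].
  destruct (cd_range x ltac:(lra)) as [R1 R2]; fold b in R2; lra. }
rewrite (travel_time (fun s => 2 / sqrt (quad_plus a b s)) t
  (fun x => - (A x * b / (b + B x))) 0 (PI / 2) (-1)).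
- lra.
- lra.
- intros s; apply continuous_inv_sqrt_quad_plus; lra.
- intros x Hx; assert (R1 := Rg x Hx); unfold t.
  assert (Ccd : continuity_pt (fun x => cd x ^ 2) x).
  { eapply continuity_pt_of_derive, is_derive_pow, is_derive_cd. }
  apply (continuity_pt_div cd (fun x => b + B x)).
  + eapply continuity_pt_of_derive, is_derive_cd.
  + apply (continuity_pt_plus (fun _ => b) B); [apply continuity_pt_const; red; reflexivity|].
    apply continuity_pt_sqrt_comp; [|nra].
    apply (continuity_pt_minus (fun _ => b ^ 2) (fun x => cd x ^ 2)); [apply continuity_pt_const; red; reflexivity | exact Ccd].
  + assert (P := B0 x); lra.
- intros x Hx.
  destruct (cd_range x Hx) as [R1 R2]; fold b in R2.
  assert (PA : 0 < a ^ 2 - cd x ^ 2) by nra; assert (PB : 0 < b ^ 2 - cd x ^ 2) by nra.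
  assert (A1 : 0 < A x) by (apply sqrt_lt_R0, PA); assert (B1 : 0 < B x) by (apply sqrt_lt_R0, PB).
  assert (EA : A x ^ 2 = a ^ 2 - cd x ^ 2) by (apply pow2_sqrt; lra).
  assert (EB : B x ^ 2 = b ^ 2 - cd x ^ 2) by (apply pow2_sqrt; lra).
  assert (D' : cd' x = - (A x * B x)).
  { apply opposite_root; [apply cd'_neg; lra | lra | lra | rewrite EA, EB; apply FO]. }
  assert (DD := is_derive_cd x); rewrite D' in DD.
  assert (D2 : is_derive (fun x => cd x ^ 2) x (- (2 * cd x * (A x * B x)))).
  { evar_last; [apply is_derive_pow, DD | simpl; ring]. }
  assert (DB : is_derive B x (cd x * A x)).
  { evar_last; [apply (is_derive_sqrt_comp (fun x => b ^ 2 - cd x ^ 2)); [|exact PB]|].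
    - apply (is_derive_minus (fun _ => b ^ 2) (fun x => cd x ^ 2)); [apply is_derive_const | exact D2].
    - change (sqrt (b ^ 2 - cd x ^ 2)) with (B x).
      unfold minus, plus, opp, zero; simpl; field; lra. }
  split.
  + evar_last.
    * apply is_derive_div; [exact DD | | lra].
      apply (is_derive_plus (fun _ => b) B); [apply is_derive_const | exact DB].
    * unfold plus, zero; simpl.
      transitivity (- (A x * (b * B x + (B x ^ 2 + cd x ^ 2))) / (b + B x) ^ 2); [field; lra|].
      rewrite EB; field; lra.
  + replace (quad_plus a b (t x)) with ((2 * b * A x / (b + B x)) ^ 2).
    * rewrite sqrt_pow2.
      -- field; repeat split; lra.
      -- apply Rlt_le, Rdiv_lt_0_compat; [|lra]; apply Rmult_lt_0_compat; lra.
    * unfold quad_plus, t.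
      assert (HS : 1 + (cd x / (b + B x)) ^ 2 = 2 * b / (b + B x)).
      { transitivity ((b ^ 2 + 2 * b * B x + (B x ^ 2 + cd x ^ 2)) / (b + B x) ^ 2); [field; lra|].
        rewrite EB; field; lra. }
      rewrite HS.
      transitivity (4 * b ^ 2 * A x ^ 2 / (b + B x) ^ 2); [field; lra|].
      rewrite EA; field; lra.
Qed.

Lemma inv_sqrt_lt (x y : R) : 0 < x < y -> 2 / sqrt y < 2 / sqrt x.
Proof.
intros H; assert (P := sqrt_lt_R0 x ltac:(lra)).
apply Rmult_lt_compat_l; [lra|].
apply Rinv_lt_contravar; [|apply sqrt_lt_1; lra].
apply Rmult_lt_0_compat; [exact P | apply sqrt_lt_R0; lra].
Qed.

(** The two quartics are ordered on (0, 1) according to the sign of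
    a^2 - 2 b^2, while the two integrals are equal. *)
Lemma dn_0_sq : dn 0 ^ 2 = 2 * dn (PI / 2) ^ 2.
Proof.
assert (Hab := dn_0_gt); assert (Hb := dn_pos (PI / 2)).
assert (P1 := dn_period); assert (P2 := cd_period).
set (a := dn 0) in *; set (b := dn (PI / 2)) in *.
assert (E : forall s, quad_plus a b s - quad_minus a b s = 4 * s ^ 2 * (a ^ 2 - 2 * b ^ 2)).
{ intros s; unfold quad_plus, quad_minus; ring. }
assert (C1 := fun s => continuous_inv_sqrt_quad_minus a b s ltac:(lra)).
assert (C2 := fun s => continuous_inv_sqrt_quad_plus a b s ltac:(lra)).
destruct (Rtotal_order (a ^ 2) (2 * b ^ 2)) as [L | [L | L]]; [exfalso | exact L | exfalso].
- assert (Q : RInt (fun s => 2 / sqrt (quad_minus a b s)) 0 1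
              < RInt (fun s => 2 / sqrt (quad_plus a b s)) 0 1); [|lra].
  apply RInt_lt; [lra | intros; apply C2 | intros; apply C1 | intros s Hs].
  apply inv_sqrt_lt; split; [apply quad_plus_pos; lra|].
  specialize (E s); assert (0 < s ^ 2) by (apply pow_lt; lra); nra.
- assert (Q : RInt (fun s => 2 / sqrt (quad_plus a b s)) 0 1
              < RInt (fun s => 2 / sqrt (quad_minus a b s)) 0 1); [|lra].
  apply RInt_lt; [lra | intros; apply C1 | intros; apply C2 | intros s Hs].
  apply inv_sqrt_lt; split; [apply quad_minus_pos; lra|].
  specialize (E s); assert (0 < s ^ 2) by (apply pow_lt; lra); nra.
Qed.

Lemma dn_half_PI_lemniscate : PI * dn (PI / 2) = 2 * sqrt 2 * lemniscate_int.
Proof.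
assert (P := cd_period); assert (Hb := dn_pos (PI / 2)).
assert (S2 := sqrt_lt_R0 2 ltac:(lra)); assert (S22 := sqrt_sqrt 2 ltac:(lra)).
set (b := dn (PI / 2)) in *.
assert (E : RInt (fun s => 2 / sqrt (quad_plus (dn 0) b s)) 0 1
            = (sqrt 2 / b) * lemniscate_int).
{ unfold lemniscate_int; rewrite <- RInt_mult_l by apply ex_RInt_lemniscate.
  apply RInt_ext_R; intros s _.
  assert (Q := sqrt_lt_R0 _ (one_plus_pow4_pos s)).
  assert (F : quad_plus (dn 0) b s = 2 * b ^ 2 * (1 + s ^ 4)).
  { unfold quad_plus; rewrite dn_0_sq; fold b; ring. }
  rewrite F, sqrt_mult, sqrt_mult, sqrt_pow2;
    try (left; apply one_plus_pow4_pos); try lra; try apply pow2_ge_0.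
  - transitivity ((sqrt 2 * sqrt 2) / (sqrt 2 * b * sqrt (1 + s ^ 4)));
      [rewrite S22; reflexivity | field; lra].
  - assert (0 <= b ^ 2) by apply pow2_ge_0; lra. }
rewrite E in P.
transitivity (2 * b * (PI / 2)); [field | rewrite <- P; field; lra].
Qed.

(** The arguments PI / 2 - PI n, for n in Z, run twice through the numbers
    PI (k + 1/2), up to sign. *)
Lemma sech_half_series :
  Clim (Csum (fun n => RtoC (/ cosh (PI * (INR n + 1 / 2))))) (RtoC (dn (PI / 2) / 2)).
Proof.
set (v := fun n => / cosh (PI * (INR n + 1 / 2))).
assert (E : forall N, zsumR (fun n => dn_term n (PI / 2)) N = Rsum v N + Rsum v N + v N).
{ induction N as [|N IHN]; cbn [zsumR Rsum].
  - unfold dn_term, v; simpl.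
    replace (PI / 2 - PI * 0) with (PI * (0 + 1 / 2)) by field; ring.
  - rewrite IHN.
    replace (dn_term (Z.of_nat (S N)) (PI / 2)) with (v N).
    + replace (dn_term (- Z.of_nat (S N)) (PI / 2)) with (v (S N)); [ring|].
      unfold dn_term, v; rewrite opp_IZR, <- INR_IZR_INZ; do 2 f_equal; field.
    + unfold dn_term, v; rewrite <- INR_IZR_INZ, S_INR, <- cosh_opp; do 2 f_equal; field. }
assert (V : forall n, v n = dn_term (- Z.of_nat n) (PI / 2)).
{ intros n; unfold dn_term, v; rewrite opp_IZR, <- INR_IZR_INZ; do 2 f_equal; field. }
assert (LV : is_lim_seq v 0).
{ apply is_lim_seq_squeeze_Rabs with (e := fun n => (2 * exp (Rabs (PI / 2))) * (1 / 2) ^ n);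
    [|apply is_lim_seq_geom_scal].
  intros n; rewrite Rminus_0_r, V.
  eapply Rle_trans; [apply dn_term_abs_bound|]; rewrite zpow_opp, zpow_of_nat; lra. }
assert (LZ := zseries_correct _ _ (fun n => dn_term_abs_bound n (PI / 2))); fold (dn (PI / 2)) in LZ.
apply Clim_ext with (u := fun N => RtoC (Rsum v N)).
{ induction n as [|n IHn]; simpl; [reflexivity | rewrite RtoC_plus, IHn; reflexivity]. }
apply Clim_RtoC.
apply is_lim_seq_ext with (u := fun N => / 2 * (zsumR (fun n => dn_term n (PI / 2)) N - v N)).
{ intros N; rewrite E; field. }
replace (dn (PI / 2) / 2) with (/ 2 * (dn (PI / 2) - 0)) by field.
apply is_lim_seq_mult'; [apply is_lim_seq_const | apply is_lim_seq_minus'; assumption].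
Qed.

Theorem corollary1 :
  (qdigamma (exp PI) ((RtoC 1 - Ci) / RtoC 2)
   - qdigamma (exp PI) ((RtoC 1 + Ci) / RtoC 2)
   = - (Ci * RtoC PI)
     - Ci * RtoC (Gamma (1 / 4) ^ 2) / RtoC (4 * sqrt (2 * PI)))%C.
Proof.
rewrite (qdigamma_difference _ sech_half_series).
assert (PP := PI_RGT_0).
assert (S2 := sqrt_lt_R0 2 ltac:(lra)); assert (S22 := sqrt_sqrt 2 ltac:(lra)).
assert (SP := sqrt_lt_R0 PI PP).
assert (E : PI * (dn (PI / 2) / 2) = Gamma (1 / 4) ^ 2 / (4 * sqrt (2 * PI))).
{ rewrite Gamma_quarter_sq, sqrt_mult by lra.
  transitivity ((PI * dn (PI / 2)) / 2); [field|].
  rewrite dn_half_PI_lemniscate.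
  transitivity ((sqrt 2 * sqrt 2) * lemniscate_int / sqrt 2); [field; lra|].
  rewrite S22; field; lra. }
unfold Cdiv at 1; rewrite <- Cmult_assoc.
change (RtoC (Gamma (1 / 4) ^ 2) * / RtoC (4 * sqrt (2 * PI)))%C
  with (RtoC (Gamma (1 / 4) ^ 2) / RtoC (4 * sqrt (2 * PI)))%C.
rewrite <- RtoC_div, <- E, RtoC_mult; [reflexivity|].
rewrite sqrt_mult by lra; assert (0 < sqrt 2 * sqrt PI) by (apply Rmult_lt_0_compat; lra); lra.
Qed.
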